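(* Let $\varepsilon\in(0,\frac12)$, $p>\frac1\varepsilon$, $0\le\beta\le2$, and $T=N\Delta t$ with $N\in\mathbb{N}$, $\Delta t>0$; put $t_n=n\Delta t$. Let $W_A(t)=\int_0^tE(t-s)\,\mathrm{d}W(s)$ and $$W_A^n=\sum_{k=1}^nE^{n-k+1}\Delta W^k,\qquad E^n=(I+\Delta t\,A)^{-n},\qquad \Delta W^k=W(t_k)-W(t_{k-1}).$$ Then there is a constant $C=C(p,\varepsilon,T)$, independent of $N$ and $\Delta t$, such that $$\left(\mathbb{E}\sup_{t_n\in[0,T]}\|W_A(t_n)-W_A^n\|^p\right)^{\frac1p}\le C\,\Delta t^{\frac\beta2}\,\|A^{\frac{\beta-1}{2}+\varepsilon}Q^{\frac12}\|_{\mathrm{HS}}.$$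
   Context: Setting. $\mathcal{D}\subset\mathbb{R}^d$, $d\le 3$, is a bounded spatial domain with smooth boundary; $H=L^2(\mathcal{D})$ with inner product $\langle\cdot,\cdot\rangle$ and norm $\|\cdot\|$. $Au=-\nabla\cdot(\kappa\nabla u)$, where $\kappa$ is smooth and $\kappa(x)>\kappa_0>0$, realized in $H$ with domain $D(A)=H^2(\mathcal{D})\cap H^1_0(\mathcal{D})$; it has an orthonormal eigenbasis $\{e_k\}$ of $H$, $Ae_k=\lambda_ke_k$, with $0<\lambda_1\le\lambda_2\le\cdots\to\infty$. Fractional powers are $A^sv=\sum_k\lambda_k^s\langle v,e_k\rangle e_k$, $s\in\mathbb{R}$. $\{E(t)\}_{t\ge0}$ is the analytic semigroup in $H$ generated by $-A$. $\|\cdot\|_{\mathrm{HS}}$ is the Hilbert-Schmidt norm of operators on $H$ (the asserted bound is void when the norm on the right-hand side is infinite). $\{W(t)\}_{t\ge0}$ is an $H$-valued $Q$-Wiener process ($Q$ its self-adjoint positive semidefinite covariance operator) on a filtered probability space $(\Omega,\mathcal{F},\mathbb{P},\{\mathcal{F}_t\}_{t\ge0})$ with respect to the normal filtration. The supremum over $t_n\in[0,T]$ is over the grid points $t_n=n\Delta t$, $1\le n\le N$. The domain $\mathcal{D}$ and coefficient $\kappa$ are fixed and constants may depend on them. *)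

(* Defs.v *)
From HB Require Import structures.
From mathcomp Require Import all_boot all_order all_algebra.
From mathcomp Require Import all_classical all_reals all_analysis.
Import Order.TTheory GRing.Theory Num.Theory.
Import numFieldNormedType.Exports.
Set Implicit Arguments.
Unset Strict Implicit.
Unset Printing Implicit Defensive.
Local Open Scope classical_set_scope.
Local Open Scope ring_scope.

(* [euclid R d] is 'rV[R]_d with its Borel sigma-algebra; the two types are
   convertible, so that functions on one are functions on the other. *)
Notation euclid R d := (g_sigma_algebraType (@open 'rV[R]_d)).

Section lebesgue.
Context {R : realType}.

Local Notation tup n := (n.-tuple (measurableTypeR R)).

Definition cons_tup n (p : measurableTypeR R * tup n) : tup n.+1 :=
  [tuple of p.1 :: p.2].

Lemma measurable_cons_tup n : measurable_fun [set: _] (@cons_tup n).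
Proof. exact: measurable_cons. Qed.

Definition image_measure d d' (S : measurableType d) (S' : measurableType d')
    (m : {measure set S -> \bar R}) (f : S -> S')
    (mf : measurable_fun [set: S] f) : {measure set S' -> \bar R} :=
  measure_function_pushforward__canonical__measure_function_Measure m mf.

(* Lebesgue measure on n-tuples, as an n-fold product measure. *)
Fixpoint lebesgue_tup n : {measure set (tup n) -> \bar R} :=
  match n with
  | 0 => [the {measure set (tup 0) -> \bar R} of \d_ [tuple]]
  | m.+1 => image_measure
      (product_measure2 (@lebesgue_measure R) (lebesgue_tup m))
      (@measurable_cons_tup m)
  end.

Definition row_tup n (t : tup n) : euclid R n := \row_i tnth t i.

Lemma measurable_row_tup n : measurable_fun [set: tup n] (@row_tup n).
Proof.
apply: (@measurability _ _ (tup n) (euclid R n) setT (@row_tup n)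
  (@open 'rV[R]_n)) => //.
move=> _ [U oU <-]; rewrite setTI.
pose box (q : {ffun 'I_n -> rat} * rat) : set (tup n) := \bigcap_(i in [set: 'I_n])
  ((fun t : tup n => tnth t i) @^-1` ball (ratr (q.1 i) : R) (ratr q.2)).
pose inU (q : {ffun 'I_n -> rat} * rat) : Prop := box q `<=` @row_tup n @^-1` U.
have -> : @row_tup n @^-1` U = \bigcup_k oapp
    (fun q => if `[< inU q >] then box q else set0) set0 (unpickle k).
  apply/seteqP; split => [t /= Ut|t [k _]]; last first.
    case: unpickle => //= q; case: ifPn => // /asboolP; exact.
  have /nbhs_ballP[e /= e0 eU] := open_nbhs_nbhs (conj oU Ut).
  have [r /itvP r0] := rat_in_itvoo (divr_gt0 e0 (ltr0n R 2)).
  have r_gt0 : 0 < ratr r :> R by rewrite r0.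
  have qP (i : 'I_n) : exists q : rat, ball (ratr q : R) (ratr r) (tnth t i).
    have [|q] := @rat_in_itvoo R (tnth t i - ratr r) (tnth t i + ratr r).
      by rewrite ltrBlDr -addrA ltrDl addr_gt0.
    rewrite in_itv/= => /andP[q1 q2]; exists q; rewrite /ball/= ltr_distlC.
    by rewrite ltrBlDr q2 -ltrBlDr q1.
  pose q := [ffun i => projT1 (cid (qP i))].
  have tq : box (q, r) t by move=> i _; rewrite /= ffunE; case: cid.
  exists (pickle (q, r)) => //; rewrite pickleK/= asboolT// => s sq.
  apply: eU; split => // i j; rewrite !mxE.
  have /ball_sym := tq j I; have := sq j I => /= sj tj.
  apply: le_ball (ball_triangle tj sj).
  by rewrite [leRHS]splitr lerD// ltW// r0.
apply: bigcup_measurable => k _; case: unpickle => //= q.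
case: ifP => // _; apply: fin_bigcap_measurable; first exact: finite_finset.
move=> i _; rewrite -[X in measurable X]setTI.
by apply: measurable_tnth => //; rewrite ball_itv; exact: measurable_itv.
Qed.

Definition lebesgue_euclid n : {measure set (euclid R n) -> \bar R} :=
  image_measure (lebesgue_tup n) (@measurable_row_tup n).

Lemma measurable_open n (U : set 'rV[R]_n) :
  open U -> measurable (U : set (euclid R n)).
Proof. by move=> oU; exact: sub_sigma_algebra. Qed.

End lebesgue.

Section smooth.
Context {R : realType} {d : nat}.
Implicit Types f : 'rV[R]_d -> R.

Definition unit_vec (i : 'I_d) : 'rV[R]_d := delta_mx ord0 i.

Definition partial (i : 'I_d) f : 'rV[R]_d -> R := fun x => 'D_(unit_vec i) f x.

Definition partials (s : seq 'I_d) f : 'rV[R]_d -> R := foldr partial f s.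

Definition smooth f := forall s : seq 'I_d, continuous (partials s f) /\
  forall i x, derivable (partials s f) x (unit_vec i).

(* Near each of its boundary points D is, up to relabelling and reorienting
   the coordinates, the set above the graph of a smooth function of the other
   d - 1 coordinates. *)
Definition smooth_boundary (D : set 'rV[R]_d) :=
  forall x0, closure D x0 -> ~ D x0 ->
  exists (r : R) (i : 'I_d) (b : bool) (gamma : 'rV[R]_d -> R),
  [/\ 0 < r, smooth gamma,
      forall x t, gamma (x + t *: unit_vec i) = gamma x &
      forall x : 'rV[R]_d, ball x0 r x -> D x <-> gamma x < (-1) ^+ b * x ord0 i].

Definition test_function (D : set 'rV[R]_d) f :=
  smooth f /\ exists K, [/\ compact K, K `<=` D & forall x, ~ K x -> f x = 0].

End smooth.

Section L2.
Context {R : realType} {d : nat} {D : set 'rV[R]_d} (oD : open D).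

Definition lebesgue_on : {measure set (euclid R d) -> \bar R} :=
  mrestr (@lebesgue_euclid R d) (measurable_open oD).

Local Notation mu := lebesgue_on.

(* Elements of L^2(D) are represented by square-integrable functions, not by
   classes modulo null sets; accordingly [l2_ip] is only semi-definite, and
   equality in L^2(D) is [heq l2_ip] below. *)
Definition L2 := LfunType mu (lee1n 2).

Definition l2_ip (f g : L2) : R := \int[mu]_x (f x * g x).

Definition weak_partial (i : 'I_d) (u g : euclid R d -> R) :=
  forall phi, test_function D phi ->
  \int[mu]_x (u x * partial i phi x) = - \int[mu]_x (g x * phi x).

Definition sobolev2 (u : L2) := exists (g : 'I_d -> L2) (h : 'I_d -> 'I_d -> L2),
  (forall i, weak_partial i u (g i)) /\
  (forall i j, weak_partial j (g i) (h i j)).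

(* closure of the test functions in the norm of H^1(D) *)
Definition sobolev1_0 (u : L2) := exists g : 'I_d -> L2,
  (forall i, weak_partial i u (g i)) /\
  exists phi : nat -> 'rV[R]_d -> R,
  [/\ forall n, test_function D (phi n),
      (fun n => \int[mu]_x ((phi n x - u x) ^+ 2)%:E)%E @ \oo --> 0%E &
      forall i,
      (fun n => \int[mu]_x ((partial i (phi n) x - g i x) ^+ 2)%:E)%E
        @ \oo --> 0%E].

(* [div_form kappa u f]: f = - div (kappa grad u), in the weak sense *)
Definition div_form (kappa : 'rV[R]_d -> R) (u f : L2) :=
  exists g q : 'I_d -> L2,
  [/\ forall i, weak_partial i u (g i),
      forall i, weak_partial i (fun x => kappa x * g i x) (q i) &
      {ae mu, forall x, f x = - \sum_i q i x}].

(* Graph of A : u lies in H^2(D) and in H^1_0(D), and f = A u. *)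
Definition elliptic_op (kappa : 'rV[R]_d -> R) (u f : L2) :=
  [/\ sobolev2 u, sobolev1_0 u & div_form kappa u f].

End L2.
Arguments lebesgue_on {R d D}.
Arguments L2 {R d D}.
Arguments l2_ip {R d D}.
Arguments elliptic_op {R d D}.

(* H is a vector space with a symmetric positive semi-definite form [ip],
   regarded as a Hilbert space after identifying vectors at distance 0.
   Unbounded operators are given by their graphs [H -> H -> Prop]. *)
Section hilbert.
Context {R : realType} {H : lmodType R} (ip : H -> H -> R).

Definition hnorm (u : H) : R := Num.sqrt (ip u u).

Definition heq (u v : H) := hnorm (u - v) = 0.

Definition hcvg (u : nat -> H) (v : H) := (fun n => hnorm (u n - v)) @ \oo --> 0.

Definition bounded_op (L : H -> H) :=
  (forall a u v, heq (L (a *: u + v)) (a *: L u + L v)) /\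
  exists M : R, forall u, hnorm (L u) <= M * hnorm u.

Definition orthonormal_basis (e : nat -> H) :=
  (forall i j, ip (e i) (e j) = (i == j)%:R) /\
  forall v, hcvg (fun n => \sum_(k < n) ip v (e k) *: e k) v.

Definition eigenbasis (A : H -> H -> Prop) (e : nat -> H) (lambda : nat -> R) :=
  [/\ orthonormal_basis e,
      forall k, A (e k) (lambda k *: e k),
      0 < lambda 0%N, nondecreasing_seq lambda & lambda @ \oo --> +oo].

(* graph of A^s *)
Definition frac_power (e : nat -> H) (lambda : nat -> R) (s : R) (v w : H) :=
  hcvg (fun n => \sum_(k < n) (lambda k `^ s * ip v (e k)) *: e k) w.

(* Hilbert-Schmidt norm of the operator with graph B, computed in the
   orthonormal basis e, on which it does not depend; it is +oo as soon as some
   e k is outside the domain of B, since [ereal_inf set0 = +oo]. *)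
Definition hs_norm2 (e : nat -> H) (B : H -> H -> Prop) : \bar R :=
  (\sum_(0 <= k <oo) ereal_inf [set (hnorm w ^+ 2)%:E | w in B (e k)])%E.

Definition hs_norm (e : nat -> H) (B : H -> H -> Prop) : \bar R :=
  (hs_norm2 e B `^ 2^-1)%E.

Definition psd_op (Q : H -> H) :=
  [/\ bounded_op Q, forall u v, ip (Q u) v = ip u (Q v) &
      forall u, 0 <= ip (Q u) u].

Definition is_sqrt_op (Q S : H -> H) :=
  psd_op S /\ forall v, heq (S (S v)) (Q v).

(* E is a strongly continuous semigroup of bounded operators, with generator
   (including its domain) - A. *)
Definition semigroup_of (A : H -> H -> Prop) (E : R -> H -> H) :=
  [/\ forall t, 0 <= t -> bounded_op (E t),
      forall v, heq (E 0 v) v,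
      forall s t v, 0 <= s -> 0 <= t -> heq (E (s + t) v) (E s (E t v)),
      forall v, hnorm (E h v - v) @[h --> 0^'+] --> 0 &
      forall u f, A u f <->
        hnorm (h^-1 *: (E h u - u) + f) @[h --> 0^'+] --> 0].

(* J = (I + dt A)^-1 *)
Definition euler_step (A : H -> H -> Prop) (dt : R) (J : H -> H) :=
  [/\ bounded_op J,
      forall v, exists2 f, A (J v) f & heq (J v + dt *: f) v &
      forall u f, A u f -> heq (J (u + dt *: f)) u].

End hilbert.

Section wiener.
Context {R : realType} {H : lmodType R} (ip : H -> H -> R).
Context {dO : measure_display} {Omega : measurableType dO}.
Variable P : probability Omega R.

Local Notation hnorm := (hnorm ip).

(* The sigma-algebra generated by X : Omega -> H; on a separable Hilbert space
   the continuous linear functionals generate the Borel sigma-algebra. *)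
Definition sigma_of (X : Omega -> H) : set (set Omega) :=
  <<s [set S | exists (h : H) (B : set R),
         measurable B /\ S = (fun w => ip (X w) h) @^-1` B] >>.

Definition normal_filtration (F : R -> set (set Omega)) :=
  [/\ forall t, 0 <= t -> sigma_algebra [set: Omega] (F t) /\
        F t `<=` measurable,
      forall s t, 0 <= s -> s <= t -> F s `<=` F t,
      forall S, measurable S -> P S = 0%E -> F 0 S &
      forall t S, 0 <= t -> (forall s, t < s -> F s S) -> F t S].

(* [normal_prob 0 0] is not the Dirac mass in the library, hence the case
   distinction. *)
Definition gaussian (X : Omega -> R) (v : R) :=
  if v == 0 then {ae P, forall w, X w = 0}
  else forall B : set R, measurable B -> P (X @^-1` B) = normal_prob 0 (Num.sqrt v) B.

Definition Q_wiener (F : R -> set (set Omega)) (Q : H -> H)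
    (W : R -> Omega -> H) :=
  [/\ {ae P, forall w, hnorm (W 0 w) = 0},
      forall t, 0 <= t -> sigma_of (W t) `<=` F t,
      {ae P, forall w, forall t, 0 <= t ->
        hnorm (W s w - W t w) @[s --> within [set s | 0 <= s] (nbhs t)] --> 0},
      forall s t h, 0 <= s -> s <= t ->
        gaussian (fun w => ip (W t w - W s w) h) ((t - s) * ip (Q h) h) &
      forall s t S S', 0 <= s -> s <= t -> F s S ->
        sigma_of (fun w => W t w - W s w) S' -> (P (S `&` S') = P S * P S')%E].

(* the operator-valued elementary process 1_S 1_]a, b] L *)
Record step := Step
  { step_a : R; step_b : R; step_set : set Omega; step_op : H -> H }.

Definition step_valid (F : R -> set (set Omega)) (x : step) :=
  [/\ 0 <= step_a x, step_a x <= step_b x, F (step_a x) (step_set x) &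
      bounded_op ip (step_op x)].

Definition elementary (Phi : seq step) (s : R) (w : Omega) (v : H) : H :=
  \sum_(x <- Phi)
    (\1_(step_set x) w * ((step_a x < s <= step_b x)%R)%:R) *: step_op x v.

Definition elementary_int (Phi : seq step) (W : R -> Omega -> H) (t : R)
    (w : Omega) : H :=
  \sum_(x <- Phi) (\1_(step_set x) w : R) *:
    step_op x (W (Num.min (step_b x) t) w - W (Num.min (step_a x) t) w).

(* I is the Ito integral of Psi over [0, t] against the Q-Wiener process W
   (Qh = Q^(1/2)): the mean-square limit of the integrals of elementary
   processes which approximate Psi in the norm of the Ito isometry. *)
Definition is_ito_integral (F : R -> set (set Omega)) (e : nat -> H)
    (Qh : H -> H) (W : R -> Omega -> H) (Psi : R -> Omega -> H -> H) (t : R)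
    (I : Omega -> H) :=
  sigma_of I `<=` measurable /\
  exists Phi : nat -> seq step,
  [/\ forall n, all (fun x => `[< step_valid F x >]) (Phi n),
      (fun n => \int[P]_w \int[lebesgue_measure]_(s in `[0%R, t])
         hs_norm2 ip e (fun v => [set (elementary (Phi n) s w (Qh v)
                                      - Psi s w (Qh v))%R]))%E @ \oo --> 0%E &
      (fun n => \int[P]_w
         (hnorm (elementary_int (Phi n) W t w - I w) ^+ 2)%:E)%E
        @ \oo --> 0%E].

(* W_A^n = \sum_(1 <= k <= n) J^(n - k + 1) (W(t_k) - W(t_(k-1))) *)
Definition euler_convolution (J : H -> H) (W : R -> Omega -> H) (dt : R)
    (n : nat) (w : Omega) : H :=
  \sum_(1 <= k < n.+1)
    iter (n - k).+1 J (W (k%:R * dt) w - W (k.-1%:R * dt) w).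

End wiener.

(* Main.v *)
Require Import Defs.
From HB Require Import structures.
From mathcomp Require Import all_boot all_order all_algebra.
From mathcomp Require Import all_classical all_reals all_analysis measurable_realfun.
From mathcomp Require Import ring lra.
Import Order.TTheory GRing.Theory Num.Theory.
Import numFieldNormedType.Exports.

(** All operators are diagonal in the eigenbasis [e]: the semigroup multiplies
    [e j] by [expR (- lambda j * t)] ([semigroup_coord]) and an Euler step by
    [(1 + lambda j * dt)^-1] ([euler_coord]). The error therefore splits into
    scalar errors, one for each mode, and that of the [j]-th mode is a
    stochastic integral of an explicit kernel, the difference between an
    exponential and a power, against a scalar Wiener process of variance
    [q j = ip (Q (e j)) (e j)].

    Put [z = lambda j * dt] and [a = (beta - 1) / 2 + eps]. The heart of the
    proof is [mode_bound]: the maximum over all times of the error in one mode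
    has a [p]-norm of at most a constant times
    [N `^ eps * z `^ a * Num.sqrt (dt * q j)]. As [N * dt = T], the powers of
    [dt] combine to [T `^ eps * dt `^ (beta / 2)] ([mode_weightE]), and what is
    left is [lambda j `^ a * Num.sqrt (q j)]. The squares of these numbers add
    up to at most the squared Hilbert-Schmidt norm ([modes_le_hs_norm2]). The
    squares of the modes are added with the triangle inequality in [L^(p/2)],
    available because [p > 1 / eps > 2], whatever the dependence between the
    modes ([max_hnorm_le]).

    For a single mode, all errors and their differences are sub-Gaussian, so
    that their [p]-norms are bounded by their standard deviations, which are
    square norms of kernels. For [z >= 1] the standard deviation is of order
    [z `^ (- 2^-1)] and a union bound over the times costs
    [N `^ p^-1 <= N `^ eps]. For [z <= 1] this would be too crude: it would lose a
    power of [z] when [beta] is close to 2. The error changes by only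
    [z * Num.sqrt n] over [n] steps and forgets its past after [1 / z] steps, so
    that dyadic chaining within the relaxation time ([chaining]) leaves the cost
    of a union bound over [z * N] times, and the gain [z `^ eps] is exactly what
    is needed to reach the exponent [a].

    It remains to see that the modes are sub-Gaussian. The stochastic
    convolution is a mean-square limit of integrals of elementary processes;
    comparing these with Riemann sums of the exponential kernel through the Ito
    isometry shows that each coordinate is the mean-square limit, at a geometric
    rate along dyadic grids, of sums of independent Gaussian increments
    ([stochastic_convolution_approx], [coord_err_approx]). The isometry is
    proved coordinatewise for elementary processes. A coordinate of such a
    process is a continuous functional that no vector of an incomplete space
    need represent; it is approximated by truncated expansions
    ([covariance_rep_cvg]). The second moment of an increment enters only up to
    an unspecified constant factor, since it multiplies a quantity that tends
    to zero. *)

Set Implicit Arguments.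
Unset Strict Implicit.
Unset Printing Implicit Defensive.
Local Open Scope classical_set_scope.
Local Open Scope ring_scope.

(** * Semi-inner product spaces and diagonal operators *)

(** Square-integrable functions, as opposed to their classes modulo null sets,
    only form a space of this kind, neither separated nor complete a priori. *)
Definition semi_inner {R : realType} {H : lmodType R} (ip : H -> H -> R) :=
  [/\ forall u v, ip u v = ip v u,
      forall a u v w, ip (a *: u + v) w = a * ip u w + ip v w &
      forall u, 0 <= ip u u].

Lemma cvgR_unique (R : realType) (f : nat -> R) (a b : R) :
  f @ \oo --> a -> f @ \oo --> b -> a = b.
Proof. by move=> fa fb; exact: (cvg_unique (@norm_hausdorff _ R) fa fb). Qed.

Section semi_inner_theory.
Context {R : realType} {H : lmodType R} (ip : H -> H -> R).
Hypothesis ipP : semi_inner ip.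
Local Notation hnorm := (hnorm ip).
Local Notation heq := (heq ip).

Lemma ipC u v : ip u v = ip v u. Proof. by case: ipP => ->. Qed.

Lemma ip_ge0 u : 0 <= ip u u. Proof. by case: ipP => _ _ ->. Qed.

Lemma ip0l w : ip 0 w = 0.
Proof.
have [_ l _] := ipP; have := l 1 0 0 w.
by rewrite scale1r addr0 mul1r => /eqP; rewrite eq_sym -subr_eq0 addrK => /eqP.
Qed.

Lemma ipDl u v w : ip (u + v) w = ip u w + ip v w.
Proof. by have [_ l _] := ipP; rewrite -{1}(scale1r u) l mul1r. Qed.

Lemma ipZl a u w : ip (a *: u) w = a * ip u w.
Proof. by have [_ l _] := ipP; rewrite -[a *: u]addr0 l ip0l addr0. Qed.

Lemma ipNl u w : ip (- u) w = - ip u w.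
Proof. by rewrite -scaleN1r ipZl mulN1r. Qed.

Lemma ipBl u v w : ip (u - v) w = ip u w - ip v w.
Proof. by rewrite ipDl ipNl. Qed.

Lemma ip_suml I (s : seq I) (Pr : pred I) (F : I -> H) w :
  ip (\sum_(i <- s | Pr i) F i) w = \sum_(i <- s | Pr i) ip (F i) w.
Proof. by apply: (big_morph (fun u => ip u w) (fun u v => ipDl u v w) (ip0l w)). Qed.

Lemma ipDr u v w : ip w (u + v) = ip w u + ip w v.
Proof. by rewrite !(ipC w) ipDl. Qed.

Lemma ipZr a u w : ip w (a *: u) = a * ip w u.
Proof. by rewrite !(ipC w) ipZl. Qed.

Lemma ipBr u v w : ip w (u - v) = ip w u - ip w v.
Proof. by rewrite !(ipC w) ipBl. Qed.

Lemma ipNr u w : ip w (- u) = - ip w u.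
Proof. by rewrite !(ipC w) ipNl. Qed.

Lemma hnorm_ge0 u : 0 <= hnorm u. Proof. exact: sqrtr_ge0. Qed.

Lemma hnorm_sqr u : hnorm u ^+ 2 = ip u u.
Proof. by rewrite sqr_sqrtr// ip_ge0. Qed.

Lemma ip_sqr_le u v : ip u v ^+ 2 <= ip u u * ip v v.
Proof.
(* the discriminant argument; a vector of norm zero has to be treated apart *)
have key t : 0 <= ip u u * t ^+ 2 + ip u v * t *+ 2 + ip v v.
  have := ip_ge0 (t *: u + v).
  by rewrite ipDl !ipDr !ipZl !ipZr (ipC v u) => /le_trans; apply; lra.
have [u0|] := eqVneq (ip u u) 0.
  have [->|uv0] := eqVneq (ip u v) 0; first by rewrite expr0n u0 mul0r.
  have := key (- (ip v v + 1) / (ip u v *+ 2)).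
  rewrite u0 mul0r add0r -mulrnAl mulrC mulfVK; last by rewrite mulrn_eq0.
  lra.
move=> u0; have up : 0 < ip u u by rewrite lt_def u0 ip_ge0.
have := key (- ip u v / ip u u).
rewrite -(ler_pM2l up) mulr0.
have -> : ip u u * (ip u u * (- ip u v / ip u u) ^+ 2 +
    ip u v * (- ip u v / ip u u) *+ 2 + ip v v) =
    ip u u * ip v v - ip u v ^+ 2 by field.
by rewrite subr_ge0.
Qed.

Lemma cauchy_schwarz u v : `|ip u v| <= hnorm u * hnorm v.
Proof.
rewrite -(@ler_pXn2r _ 2) ?nnegrE ?mulr_ge0 ?hnorm_ge0//.
by rewrite real_normK ?num_real// exprMn !hnorm_sqr ip_sqr_le.
Qed.

Lemma hnormD u v : hnorm (u + v) <= hnorm u + hnorm v.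
Proof.
rewrite -(@ler_pXn2r _ 2) ?nnegrE ?addr_ge0 ?hnorm_ge0//.
rewrite sqrrD !hnorm_sqr ipDl !ipDr (ipC v u).
have := le_trans (ler_norm _) (cauchy_schwarz u v); lra.
Qed.

Lemma hnormZ a u : hnorm (a *: u) = `|a| * hnorm u.
Proof. by rewrite /Defs.hnorm ipZl ipZr mulrA -expr2 sqrtrM ?sqr_ge0// sqrtr_sqr. Qed.

Lemma hnormN u : hnorm (- u) = hnorm u.
Proof. by rewrite -scaleN1r hnormZ normrN1 mul1r. Qed.

Lemma hnorm0 : hnorm 0 = 0. Proof. by rewrite /Defs.hnorm ip0l sqrtr0. Qed.

Lemma hnormC u v : hnorm (u - v) = hnorm (v - u).
Proof. by rewrite -opprB hnormN. Qed.

Lemma hnormB_trans w u v : hnorm (u - v) <= hnorm (u - w) + hnorm (w - v).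
Proof. by rewrite -[u - v](subrKA w) hnormD. Qed.

Lemma hnorm_sum I (s : seq I) (F : I -> H) :
  hnorm (\sum_(i <- s) F i) <= \sum_(i <- s) hnorm (F i).
Proof.
elim/big_rec2: _ => [|i y x _ h]; first by rewrite hnorm0.
by rewrite (le_trans (hnormD _ _))// lerD2l.
Qed.

Lemma hnorm_le_abs u v : `|hnorm u - hnorm v| <= hnorm (u - v).
Proof.
have := hnormD (u - v) v; rewrite subrK => h1.
have := hnormD (v - u) u; rewrite subrK (hnormC v u) => h2.
by rewrite ler_norml; apply/andP; split; lra.
Qed.

Lemma heq_ip u v w : heq u v -> ip u w = ip v w.
Proof.
move=> uv; have := cauchy_schwarz (u - v) w.
by rewrite uv mul0r normr_le0 ipBl subr_eq0 => /eqP.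
Qed.

Lemma heq_refl u : heq u u. Proof. by rewrite /Defs.heq subrr hnorm0. Qed.

Lemma heq_sym u v : heq u v -> heq v u.
Proof. by rewrite /Defs.heq hnormC. Qed.

Lemma heq_hnorm u v : heq u v -> hnorm u = hnorm v.
Proof.
move=> uv; have := hnorm_le_abs u v.
by rewrite uv normr_le0 subr_eq0 => /eqP.
Qed.

Lemma ip_heq u v : (forall w, ip u w = ip v w) -> heq u v.
Proof.
by move=> h; rewrite /Defs.heq /Defs.hnorm ipBl h subrr sqrtr0.
Qed.

Lemma heq_trans v u w : heq u v -> heq v w -> heq u w.
Proof.
by move=> uv vw; apply: ip_heq => x; rewrite (heq_ip x uv) (heq_ip x vw).
Qed.

Lemma heq_add u v u' v' : heq u v -> heq u' v' -> heq (u + u') (v + v').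
Proof.
by move=> uv uv'; apply: ip_heq => x; rewrite !ipDl (heq_ip x uv) (heq_ip x uv').
Qed.

Lemma heq_scale a u v : heq u v -> heq (a *: u) (a *: v).
Proof. by move=> uv; apply: ip_heq => x; rewrite !ipZl (heq_ip x uv). Qed.

Lemma squeeze0 (f g : nat -> R) : (forall n, `|f n| <= g n) ->
  g @ \oo --> 0 -> f @ \oo --> 0.
Proof.
move=> fg g0; apply/norm_cvg0P; apply: (@squeeze_cvgr _ _ _ _ (fun=> 0) g) => //.
  by apply: nearW => n; rewrite normr_ge0/=.
exact: cvg_cst.
Qed.

Lemma hcvg_ip (u : nat -> H) v w : hcvg ip u v -> (fun n => ip (u n) w) @ \oo --> ip v w.
Proof.
move=> uv; apply/subr_cvg0.
apply: (@squeeze0 _ (fun n => hnorm (u n - v) * hnorm w)) => [n|].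
  by rewrite -ipBl cauchy_schwarz.
by rewrite -(mul0r (hnorm w)); apply: cvgMl.
Qed.

(** Continuous linear functionals for the semi-norm. They stand in for the
    vectors representing them, whose existence would require completeness. *)
Definition bfun (phi : H -> R) :=
  (forall a u v, phi (a *: u + v) = a * phi u + phi v) /\
  exists M : R, forall u, `|phi u| <= M * hnorm u.

Section bfun.
Variable phi : H -> R.
Hypothesis bphi : bfun phi.

Lemma bfun0 : phi 0 = 0.
Proof.
have := bphi.1 1 0 0.
by rewrite scale1r addr0 mul1r => /eqP; rewrite eq_sym -subr_eq0 addrK => /eqP.
Qed.

Lemma bfunD u v : phi (u + v) = phi u + phi v.
Proof. by rewrite -{1}(scale1r u) bphi.1 mul1r. Qed.

Lemma bfunZ a u : phi (a *: u) = a * phi u.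
Proof. by rewrite -[a *: u]addr0 bphi.1 bfun0 addr0. Qed.

Lemma bfunB u v : phi (u - v) = phi u - phi v.
Proof. by rewrite bfunD -scaleN1r bfunZ mulN1r. Qed.

Lemma bfun_sum I (s : seq I) (F : I -> H) :
  phi (\sum_(i <- s) F i) = \sum_(i <- s) phi (F i).
Proof. exact: (big_morph phi bfunD bfun0). Qed.

Lemma bfun_bound : exists2 M, 0 <= M & forall u, `|phi u| <= M * hnorm u.
Proof.
have [_ [M hM]] := bphi; exists `|M| => // u.
by rewrite (le_trans (hM u))// ler_wpM2r ?hnorm_ge0// ler_norm.
Qed.

Lemma bfun_heq u v : heq u v -> phi u = phi v.
Proof.
move=> uv; have [M _ hM] := bfun_bound.
by have := hM (u - v); rewrite uv mulr0 normr_le0 bfunB subr_eq0 => /eqP.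
Qed.

Lemma bfun_cvg (u : nat -> H) v : hcvg ip u v -> (fun n => phi (u n)) @ \oo --> phi v.
Proof.
have [M M0 hM] := bfun_bound; move=> uv; apply/subr_cvg0.
apply: (@squeeze0 _ (fun n => M * hnorm (u n - v))) => [n|].
  by rewrite -bfunB hM.
by rewrite -(mulr0 M); apply: cvgMr.
Qed.

End bfun.

Lemma bfun_bounded_op L g : bounded_op ip L -> bfun (fun v => ip (L v) g).
Proof.
move=> [Ll [M hM]]; split => [a u v|]; first by rewrite (heq_ip _ (Ll a u v)) ipDl ipZl.
exists (M * hnorm g) => u; rewrite (le_trans (cauchy_schwarz _ _))//.
by rewrite mulrAC ler_wpM2r ?hnorm_ge0.
Qed.

Lemma bfun_comp phi L : bfun phi -> bounded_op ip L -> bfun (phi \o L).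
Proof.
move=> bphi [Ll [M hM]]; have [M' M'0 hM'] := bfun_bound bphi.
split => [a u v/=|]; first by rewrite (bfun_heq bphi (Ll a u v)) bphi.1.
exists (M' * M) => u/=; rewrite (le_trans (hM' _))//.
by rewrite -mulrA ler_wpM2l.
Qed.

Section basis.
Variable e : nat -> H.
Hypothesis eP : orthonormal_basis ip e.

Definition proj n v : H := \sum_(k < n) ip v (e k) *: e k.

Lemma proj_cvg v : hcvg ip (proj ^~ v) v. Proof. exact: eP.2. Qed.

Lemma ip_proj n v w : ip (proj n v) w = \sum_(k < n) ip v (e k) * ip w (e k).
Proof. by rewrite ip_suml; apply: eq_bigr => k _; rewrite ipZl (ipC (e k)). Qed.

Lemma proj_e n v j : (j < n)%N -> ip (proj n v) (e j) = ip v (e j).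
Proof.
move=> jn; rewrite ip_proj (bigD1 (Ordinal jn))//= big1 ?addr0.
  by rewrite eP.1 eqxx mulr1.
by move=> i ij; rewrite eP.1 -(inj_eq val_inj) eq_sym in ij *; rewrite (negbTE ij) mulr0.
Qed.

Lemma parseval_ip v w :
  (fun n => \sum_(k < n) ip v (e k) * ip w (e k)) @ \oo --> ip v w.
Proof.
by under eq_fun do rewrite -ip_proj; exact: hcvg_ip (proj_cvg v).
Qed.

Lemma bfun_expand phi v : bfun phi ->
  (fun n => \sum_(k < n) ip v (e k) * phi (e k)) @ \oo --> phi v.
Proof.
move=> bphi.
rewrite (_ : (fun n => _) = (fun n => phi (proj n v))); first exact/bfun_cvg/proj_cvg.
apply/funext => n; rewrite bfun_sum//.
by apply: eq_bigr => k _; rewrite bfunZ.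
Qed.

Lemma ip_eq_basis u v : (forall k, ip u (e k) = ip v (e k)) -> heq u v.
Proof.
move=> h; apply: ip_heq => w; apply: (cvgR_unique (@parseval_ip u w)).
by under eq_fun do (under eq_bigr do rewrite h); exact: parseval_ip.
Qed.

End basis.
End semi_inner_theory.

Section diagonal.
Context {R : realType} {H : lmodType R} (ip : H -> H -> R).
Hypothesis ipP : semi_inner ip.
Variables (A : H -> H -> Prop) (e : nat -> H) (lambda : nat -> R).
Hypothesis eP : eigenbasis ip A e lambda.
Local Notation hnorm := (hnorm ip).
Local Notation heq := (heq ip).

Let eB : orthonormal_basis ip e. Proof. by case: eP. Qed.
Let Ae k : A (e k) (lambda k *: e k). Proof. by case: eP. Qed.

Lemma eigenvalue_gt0 k : 0 < lambda k.
Proof. by have [_ _ l0 ln _] := eP; rewrite (lt_le_trans l0)// ln. Qed.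

Lemma ip_e i j : ip (e i) (e j) = (i == j)%:R. Proof. by case: eB. Qed.

Lemma hnorm_e i : hnorm (e i) = 1.
Proof. by rewrite /Defs.hnorm ip_e eqxx sqrtr1. Qed.

(** A bounded operator may be applied term by term to the expansion in the
    basis, so that its values on the basis vectors determine all its
    coordinates. *)
Lemma bounded_diag L (a : nat -> R) : bounded_op ip L ->
  (forall k, heq (L (e k)) (a k *: e k)) ->
  forall v j, ip (L v) (e j) = a j * ip v (e j).
Proof.
move=> bL Le v j.
have bphi : bfun ip (fun v => ip (L v) (e j)) by exact: bfun_bounded_op.
have h1 := bfun_expand eB (v := v) bphi; rewrite /= in h1.
refine (cvgR_unique h1 _).
apply/cvg_ballP => r r0; exists j.+1 => // n /= jn.
rewrite (bigD1 (Ordinal jn))//= big1 ?addr0.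
  by rewrite (heq_ip ipP _ (Le j)) (ipZl ipP) ip_e eqxx mulr1 mulrC; exact: ballxx.
move=> i ij; rewrite -(inj_eq val_inj)/= in ij.
by rewrite (heq_ip ipP _ (Le i)) (ipZl ipP) ip_e (negbTE ij) mulr0 mulr0.
Qed.

Section resolvent.
Variables (dt : R) (J : H -> H).
Hypotheses (dt0 : 0 < dt) (JP : euler_step ip A dt J).

Lemma euler_eigen w l : 0 < l -> A w (l *: w) -> heq (J w) ((1 + dt * l)^-1 *: w).
Proof.
move=> l0 Aw; have [bJ _ J3] := JP.
have p : 1 + dt * l != 0 by rewrite gt_eqF// addr_gt0// mulr_gt0.
have := J3 _ _ Aw; rewrite scalerA -[w in w + _]scale1r -scalerDl => h.
apply: ip_heq => // x; rewrite (ipZl ipP) -(heq_ip ipP _ h).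
have := bfunZ (bfun_bounded_op ipP x bJ) (1 + dt * l) w => /= ->.
by rewrite mulKf.
Qed.

Lemma euler_coord v j : ip (J v) (e j) = (1 + lambda j * dt)^-1 * ip v (e j).
Proof.
have [bJ _ _] := JP.
apply: (bounded_diag (a := fun j => (1 + lambda j * dt)^-1)) => // k.
by rewrite mulrC; apply: euler_eigen => //; exact: eigenvalue_gt0.
Qed.

Lemma euler_iter_coord n v j :
  ip (iter n J v) (e j) = (1 + lambda j * dt)^-1 ^+ n * ip v (e j).
Proof.
elim: n => [|n IH] /=; first by rewrite expr0 mul1r.
by rewrite euler_coord IH exprS mulrA.
Qed.

(** The resolvent is diagonal in the eigenbasis, so it turns an eigenvector of
    [A] into one of a diagonal operator; this replaces the symmetry of [A]. *)
Lemma eigenvector_coord w l k : 0 < l -> A w (l *: w) -> lambda k != l ->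
  ip w (e k) = 0.
Proof.
move=> l0 Aw kl; have := euler_coord w k.
rewrite (heq_ip ipP _ (euler_eigen l0 Aw)) (ipZl ipP) => /eqP.
rewrite -subr_eq0 -mulrBl mulf_eq0 => /orP[|/eqP//].
rewrite subr_eq0 => /eqP /invr_inj /addrI; rewrite mulrC => /(mulIf (lt0r_neq0 dt0)).
by move/eqP; rewrite eq_sym (negbTE kl).
Qed.

End resolvent.
End diagonal.

(** * The semigroup in the eigenbasis *)

Section semigroup.
Context {R : realType} {H : lmodType R} (ip : H -> H -> R).
Hypothesis ipP : semi_inner ip.
Variables (A : H -> H -> Prop) (e : nat -> H) (lambda : nat -> R).
Hypothesis eP : eigenbasis ip A e lambda.
Local Notation hnorm := (hnorm ip).
Local Notation heq := (heq ip).
Variables (dt : R) (J : H -> H).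
Hypotheses (dt0 : 0 < dt) (JP : euler_step ip A dt J).
Variable E : R -> H -> H.
Hypothesis EP : semigroup_of ip A E.

Let eB : orthonormal_basis ip e. Proof. by case: eP. Qed.

Let bE t : 0 <= t -> bounded_op ip (E t). Proof. by have [h _ _ _ _] := EP; exact: h. Qed.

Let EZ t a v : 0 <= t -> heq (E t (a *: v)) (a *: E t v).
Proof.
move=> t0; apply: ip_heq => // g; rewrite (ipZl ipP).
exact: (bfunZ (bfun_bounded_op ipP g (bE t0))).
Qed.

Let EB t u v : 0 <= t -> heq (E t (u - v)) (E t u - E t v).
Proof.
move=> t0; apply: ip_heq => // g; rewrite (ipBl ipP).
exact: (bfunB (bfun_bounded_op ipP g (bE t0))).
Qed.

Let ED t u v : 0 <= t -> heq (E t (u + v)) (E t u + E t v).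
Proof.
move=> t0; apply: ip_heq => // g; rewrite (ipDl ipP).
exact: (bfunD (bfun_bounded_op ipP g (bE t0))).
Qed.

Let Esum t n (F : nat -> H) : 0 <= t ->
  heq (E t (\sum_(k < n) F k)) (\sum_(k < n) E t (F k)).
Proof.
move=> t0; apply: ip_heq => // g; rewrite (ip_suml ipP).
exact: (bfun_sum (bfun_bounded_op ipP g (bE t0))).
Qed.

Let Eheq t u v : 0 <= t -> heq u v -> heq (E t u) (E t v).
Proof.
move=> t0 uv; apply: ip_heq => // g.
exact: (bfun_heq (bfun_bounded_op ipP g (bE t0)) uv).
Qed.

(** [E t] commutes with the difference quotients that define the generator. *)
Lemma semigroup_eigenvector t j : 0 <= t -> A (E t (e j)) (lambda j *: E t (e j)).
Proof.
move=> t0; have [_ _ Eadd _ gen] := EP; apply/gen.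
have /gen h := let: And5 _ h _ _ _ := eP in h j.
have [_ [M hM]] := bE t0.
apply: (@squeeze_cvgr _ _ _ _ (fun=> 0)
  (fun h => M * hnorm (h^-1 *: (E h (e j) - e j) + lambda j *: e j))).
- near=> x; rewrite hnorm_ge0/=.
  have x0 : 0 <= x by apply: ltW; near: x; exact: nbhs_right_gt.
  set u := (X in _ <= M * hnorm X); rewrite (le_trans _ (hM u))//.
  rewrite le_eqVlt; apply/orP; left; apply/eqP/heq_hnorm => //.
  apply: heq_sym => //.
  apply: heq_trans (ED _ _ t0) _ => //; apply: heq_add => //; last exact: EZ.
  apply: heq_trans (EZ _ _ t0) _ => //; apply: heq_scale => //.
  apply: heq_trans (EB _ _ t0) _ => //; apply: heq_add => //; last exact: heq_refl.
  apply: heq_trans (heq_sym ipP (Eadd _ _ _ t0 x0)) _ => //.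
  by rewrite [t + x]addrC; exact: (Eadd _ _ _ x0 t0).
- by apply: cvg_cst.
- by rewrite -[X in _ --> X](mulr0 M); apply: cvgMr.
Unshelve. all: by end_near. Qed.

(** The aim is that [E t] multiplies [e j] by an exponential. Differential
    equations are avoided by working in the eigenspace of [lambda j], where
    the semigroup with its decay compensated is [o(h)]-close to the identity. *)
Section eigenspace.
Variable j : nat.
Local Notation l := (lambda j).

(** Up to null vectors, the eigenspace of [l]. It is spanned by finitely many
    basis vectors, since the eigenvalues tend to infinity: estimates on basis
    vectors become operator estimates on [V]. *)
Let V v := forall k, lambda k != l -> ip v (e k) = 0.

Let l0 : 0 < l. Proof. exact: (eigenvalue_gt0 eP). Qed.

Let eigenspace_finite : exists n, forall k, lambda k = l -> (k < n)%N.
Proof.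
have [_ _ _ _ /cvgryPgt/(_ l)[n _ hn]] := eP; exists n => k kl.
by rewrite ltnNge; apply/negP => /hn; rewrite kl ltxx.
Qed.

Let V_E t k : 0 <= t -> lambda k = l -> V (E t (e k)).
Proof.
move=> t0 kl i il; apply: (eigenvector_coord ipP eP dt0 JP (l := l)) => //.
by rewrite -kl; exact: semigroup_eigenvector.
Qed.

Let V_expand n v : (forall k, lambda k = l -> (k < n)%N) -> V v ->
  heq v (\sum_(k < n) ip v (e k) *: e k).
Proof.
move=> hn Vv; apply: (ip_eq_basis ipP eB) => k.
have [kn|nk] := ltnP k n; first by rewrite (proj_e ipP eB).
have kl : lambda k != l by apply: contraTneq nk => /hn; rewrite -ltnNge.
rewrite Vv//; apply/esym; rewrite (ip_suml ipP) big1// => i _.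
by rewrite (ipZl ipP) (ip_e eP) ltn_eqF ?mulr0// (leq_trans _ nk).
Qed.

(** The resolvent confines the eigenvectors [E t (e k)] to [V], and linearity
    does the rest. *)
Let VE t v : 0 <= t -> V v -> V (E t v).
Proof.
move=> t0 Vv k kl; have [n hn] := eigenspace_finite.
rewrite (heq_ip ipP _ (Eheq t0 (V_expand hn Vv))).
rewrite (heq_ip ipP _ (Esum _ (fun k => ip v (e k) *: e k) t0)).
rewrite (ip_suml ipP) big1// => i _; rewrite (heq_ip ipP _ (EZ _ _ t0)) (ipZl ipP).
have [il|il] := eqVneq (lambda i) l; first by rewrite V_E// mulr0.
by rewrite Vv// mul0r.
Qed.

(** The semigroup with its expected decay compensated. *)
Let B t v := expR (l * t) *: E t v.

(** The derivative at 0 of [h |-> expR (l * h) *: E h (e k)] vanishes. *)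
Let B_e eps k : 0 < eps -> lambda k = l ->
  \forall h \near 0^'+, hnorm (B h (e k) - e k) <= eps * h.
Proof.
move=> eps0 kl; have [_ _ _ _ gen] := EP.
have /gen := let: And5 _ h _ _ _ := eP in h k.
rewrite kl => /cvgrPdist_lt.
have d0 : 0 < eps / (2 * expR 1) by rewrite divr_gt0// mulr_gt0// expR_gt0.
move/(_ _ d0) => hnear; near=> h.
have h0 : 0 < h by near: h; exact: nbhs_right_gt.
have hl : l * h <= 1.
  by rewrite mulrC -ler_pdivlMr// mul1r; near: h; apply: nbhs_right_le; rewrite invr_gt0.
have hle : l ^+ 2 * h <= eps / 2.
  rewrite mulrC -ler_pdivlMr ?exprn_gt0//; near: h; apply: nbhs_right_le.
  by rewrite divr_gt0 ?exprn_gt0// divr_gt0.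
have : hnorm (h^-1 *: (E h (e k) - e k) + l *: e k) < eps / (2 * expR 1).
  by near: h; apply: filterS hnear => x; rewrite sub0r normrN ger0_norm ?hnorm_ge0.
set r := _ + _ => rlt.
have -> : B h (e k) - e k =
    (expR (l * h) * (1 - l * h) - 1) *: e k + (expR (l * h) * h) *: r.
  rewrite /B /r scalerDr !scalerA mulfK ?gt_eqF// scalerBr.
  rewrite [_ *: E h (e k) - _ + _]addrAC [RHS]addrC -addrA.
  rewrite -[in RHS](scaleNr (expR (l * h))) -!scalerDl -addrA; congr (_ + _).
  by rewrite -scaleN1r -scalerDl; congr (_ *: _); ring.
rewrite (le_trans (hnormD ipP _ _))// !(hnormZ ipP) (hnorm_e eP) mulr1.
have le1 : `|expR (l * h) * (1 - l * h) - 1| <= l ^+ 2 * h * h.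
  have lh0 : 0 <= l * h by rewrite mulr_ge0// ltW.
  have e1 := expR_ge1Dx (l * h).
  have e2 : expR (l * h) * (1 - l * h) <= 1.
    rewrite -[leRHS](expRxMexpNx_1 (l * h)) ler_wpM2l ?expR_ge0//.
    exact: expR_ge1Dx.
  rewrite ler_norml; apply/andP; split.
    have : (1 + l * h) * (1 - l * h) <= expR (l * h) * (1 - l * h).
      by rewrite ler_wpM2r// subr_ge0.
    lra.
  have : 0 <= l ^+ 2 * h * h by rewrite -mulrA mulr_ge0 ?sqr_ge0// mulr_ge0// ltW.
  lra.
have le2 : `|expR (l * h) * h| * hnorm r <= eps / 2 * h.
  rewrite ger0_norm ?mulr_ge0 ?expR_ge0 ?(ltW h0)//.
  rewrite mulrAC ler_wpM2r ?(ltW h0)//.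
  have -> : eps / 2 = expR 1 * (eps / (2 * expR 1)).
    by field; rewrite gt_eqF ?expR_gt0.
  apply: ler_pM; [exact: expR_ge0|exact: hnorm_ge0| |exact: ltW].
  by rewrite ler_expR.
have le3 : l ^+ 2 * h * h <= eps / 2 * h by rewrite ler_wpM2r// ltW.
have -> : eps * h = eps / 2 * h + eps / 2 * h by field.
by rewrite lerD// (le_trans le1).
Unshelve. all: by end_near. Qed.

Let bB t v : 0 <= t -> forall g, ip (B t v) g = expR (l * t) * ip (E t v) g.
Proof. by move=> t0 g; rewrite /B (ipZl ipP). Qed.

Let B_small eps : 0 < eps ->
  \forall h \near 0^'+, forall v, V v -> hnorm (B h v - v) <= eps * h * hnorm v.
Proof.
move=> eps0; have [n hn] := eigenspace_finite.
have n0 : 0 < n.+1%:R :> R by [].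
have key : \forall h \near 0^'+, forall k : 'I_n, lambda k = l ->
    hnorm (B h (e k) - e k) <= eps / n.+1%:R * h.
  apply: filter_forall => k; have [kl|kl] := pselect (lambda k = l).
    by apply: filterS (B_e (divr_gt0 eps0 n0) kl) => h hh _.
  by apply: nearW.
near=> h; have h0 : 0 <= h by apply: ltW; near: h; exact: nbhs_right_gt.
move=> v Vv; have hk : forall k : 'I_n, lambda k = l ->
  hnorm (B h (e k) - e k) <= eps / n.+1%:R * h by near: h.
have -> : hnorm (B h v - v) =
    hnorm (\sum_(k < n) ip v (e k) *: (B h (e k) - e k)).
  apply: heq_hnorm => //; apply: ip_heq => // g.
  rewrite (ipBl ipP) bB// (heq_ip ipP _ (Eheq h0 (V_expand hn Vv))).
  rewrite (heq_ip ipP _ (Esum _ (fun k => ip v (e k) *: e k) h0)).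
  rewrite [in X in _ - X](heq_ip ipP _ (V_expand hn Vv)) !(ip_suml ipP) mulr_sumr -sumrB.
  apply: eq_bigr => k _; rewrite !(ipZl ipP) (ipBl ipP) bB//.
  by rewrite (heq_ip ipP _ (EZ _ _ h0)) (ipZl ipP); ring.
rewrite (le_trans (hnorm_sum ipP _ _))//.
apply: (@le_trans _ _ (\sum_(k < n) (eps / n.+1%:R * h * hnorm v))).
  apply: ler_sum => k _; rewrite (hnormZ ipP).
  have [kl|kl] := eqVneq (lambda k) l; last first.
    by rewrite Vv// normr0 mul0r !mulr_ge0 ?hnorm_ge0 ?invr_ge0 ?(ltW eps0).
  rewrite mulrC ler_pM ?hnorm_ge0 ?normr_ge0 ?hk//.
  by rewrite (le_trans (cauchy_schwarz ipP _ _))// (hnorm_e eP) mulr1.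
rewrite sumr_const card_ord -[leLHS]mulr_natl !mulrA ler_wpM2r ?hnorm_ge0// ler_wpM2r//.
rewrite [_ * eps]mulrC -mulrA ler_piMr ?(ltW eps0)//.
by rewrite ler_pdivrMr// mul1r ler_nat.
Unshelve. all: by end_near. Qed.

Let VB t v : 0 <= t -> V v -> V (B t v).
Proof. by move=> t0 Vv k kl; rewrite bB// VE// mulr0. Qed.

Let B_add s t v : 0 <= s -> 0 <= t -> heq (B (s + t) v) (B s (B t v)).
Proof.
move=> s0 t0; have [_ _ Eadd _ _] := EP.
apply: ip_heq => // g; rewrite !bB ?addr_ge0// /B (heq_ip ipP _ (EZ _ _ s0)) (ipZl ipP).
by rewrite (heq_ip ipP _ (Eadd _ _ _ s0 t0)) mulrDr expRD mulrA.
Qed.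

Let B_iter eta h n v : 0 <= h -> 0 <= eta ->
  (forall v, V v -> hnorm (B h v - v) <= eta * hnorm v) -> V v ->
  hnorm (B (n%:R * h) v - v) <= ((1 + eta) ^+ n - 1) * hnorm v.
Proof.
move=> h0 eta0 hB Vv; elim: n => [|n IH].
  rewrite mul0r expr0 subrr mul0r; have [_ E0 _ _ _] := EP.
  rewrite le_eqVlt; apply/orP; left; apply/eqP.
  by apply: ip_heq => // g; rewrite bB// mulr0 expR0 mul1r (heq_ip ipP _ (E0 v)).
have nh0 : 0 <= n%:R * h by rewrite mulr_ge0.
set u := B (n%:R * h) v in IH *.
have Vu : V u by exact: VB.
have -> : hnorm (B (n.+1%:R * h) v - v) = hnorm (B h u - v).
  apply: heq_hnorm => //; apply: heq_add => //; last exact: heq_refl.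
  by rewrite -natr1 mulrDl mul1r [_ + h]addrC; exact: (B_add _ h0 nh0).
rewrite (le_trans (hnormB_trans ipP u _ _))//.
have u1 : hnorm u <= (1 + eta) ^+ n * hnorm v.
  have := hnormD ipP (u - v) v; rewrite subrK => /le_trans; apply.
  by rewrite (le_trans (lerD IH (lexx _)))// mulrBl mul1r subrK.
rewrite (le_trans (lerD (hB u Vu) IH))//.
rewrite (le_trans (lerD (ler_wpM2l eta0 u1) (lexx _)))//.
by rewrite exprS le_eqVlt; apply/orP; left; apply/eqP; ring.
Qed.

(** [B t] is the [n]-th iterate of [B (t / n)], which is within [eps * t / n]
    of the identity; hence [B t] is within [expR (eps * t) - 1] of it, for
    every [eps > 0]. *)
Lemma semigroup_eigen t : 0 <= t -> heq (E t (e j)) (expR (- l * t) *: e j).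
Proof.
move=> t0; suff : heq (B t (e j)) (e j).
  move=> h; apply: ip_heq => // g; rewrite (ipZl ipP) -(heq_ip ipP g h) bB//.
  by rewrite mulrA -expRD mulNr addNr expR0 mul1r.
have Vj : V (e j).
  move=> k kl; rewrite (ip_e eP); have [jk|//] := eqVneq j k.
  by rewrite -jk eqxx in kl.
apply/eqP; rewrite eq_le hnorm_ge0 andbT; apply/ler_addgt0Pr => d d0; rewrite add0r.
(* chosen so that expR (eps * t) <= 1 + d *)
pose eps := ln (1 + d) / (t + 1).
have eps0 : 0 < eps by rewrite divr_gt0 ?ln_gt0 ?ltrDl// ltr_wpDl.
have [r /= r0 hr] := B_small eps0.
pose n := (Num.truncn (t / r)).+1; pose h := t / n%:R.
have nh : n%:R * h = t by rewrite mulrC divfK// pnatr_eq0.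
have hl : h < r.
  rewrite ltr_pdivrMr// mulrC -ltr_pdivrMr//.
  by have /andP[] := truncn_itv (divr_ge0 t0 (ltW r0)).
have [->|tn0] := eqVneq t 0.
  have [_ E0 _ _ _] := EP; rewrite (_ : hnorm _ = 0) ?(ltW d0)//.
  by apply: ip_heq => // g; rewrite bB// mulr0 expR0 mul1r (heq_ip ipP _ (E0 _)).
have h0 : 0 < h by rewrite divr_gt0// lt_def tn0.
have hB v : V v -> hnorm (B h v - v) <= eps * h * hnorm v.
  by apply: hr => //=; rewrite sub0r normrN gtr0_norm.
have := B_iter n (ltW h0) (mulr_ge0 (ltW eps0) (ltW h0)) hB Vj.
rewrite nh (hnorm_e eP) mulr1 => /le_trans; apply.
rewrite lerBlDl.
apply: (@le_trans _ _ (expR (eps * h) ^+ n)).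
  have eh : 0 <= eps * h by rewrite mulr_ge0 ?(ltW eps0) ?(ltW h0).
  by apply: lerXn2r; rewrite ?nnegrE ?expR_ge0 ?addr_ge0 ?expR_ge1Dx.
rewrite -expRM_natl mulrCA nh -[leRHS]lnK ?posrE ?addr_gt0// ler_expR.
rewrite /eps mulrAC ler_pdivrMr ?ltr_wpDl// ler_wpM2l ?lerDl//.
by rewrite ln_ge0// lerDl ltW.
Qed.

End eigenspace.

Lemma semigroup_coord t v j : 0 <= t ->
  ip (E t v) (e j) = expR (- lambda j * t) * ip v (e j).
Proof.
move=> t0; apply: (bounded_diag ipP eP (bE t0) (a := fun j => expR (- lambda j * t))) => k.
exact: semigroup_eigen.
Qed.

End semigroup.

(** * Functionals, covariance and its square root *)

Section representation.
Context {R : realType} {H : lmodType R} (ip : H -> H -> R).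
Hypothesis ipP : semi_inner ip.
Variable e : nat -> H.
Hypothesis eB : orthonormal_basis ip e.
Local Notation hnorm := (hnorm ip).

Definition hcauchy (u : nat -> H) := forall eps : R, 0 < eps ->
  exists N, forall m n, (N <= m)%N -> (N <= n)%N -> hnorm (u m - u n) <= eps.

(** In [|w n|^2 = <w n, w n - w N> + <w n, w N>] the Cauchy property makes the
    first term small for a fixed large [N], and weak convergence then the
    second one. *)
Lemma hcauchy_weak0 (w : nat -> H) : hcauchy w ->
  (forall v, (fun n => ip (w n) v) @ \oo --> (0 : R)) ->
  (fun n => hnorm (w n)) @ \oo --> (0 : R).
Proof.
move=> cw w0; apply/cvgr0Pnorm_le => eps eps0.
have [N hN] := cw _ (divr_gt0 eps0 (ltr0n R 2)).
have e2 : 0 < (eps / 2) ^+ 2 by rewrite exprn_gt0// divr_gt0.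
have /cvgr0Pnorm_le/(_ _ e2) := w0 (w N).
move=> wN; near=> n; have Nn : (N <= n)%N by near: n; exact: nbhs_infty_ge.
rewrite ger0_norm ?hnorm_ge0//.
have h1 : ip (w n) (w N) <= (eps / 2) ^+ 2.
  by apply: le_trans (ler_norm _) _; near: n.
have h2 : ip (w n) (w n - w N) <= hnorm (w n) * (eps / 2).
  rewrite (le_trans (ler_norm _))// (le_trans (cauchy_schwarz ipP _ _))//.
  by rewrite ler_wpM2l ?hnorm_ge0// hN.
rewrite (ipBr ipP) -(hnorm_sqr ipP) in h2.
rewrite leNgt; apply/negP => lt1.
have : 0 < (hnorm (w n) - eps) * (hnorm (w n) + eps / 2).
  by rewrite mulr_gt0 ?subr_gt0// addr_gt0 ?divr_gt0// (lt_trans eps0).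
have : 0 < (eps / 2) * (eps / 2) by rewrite mulr_gt0 ?divr_gt0.
rewrite expr2 in h1, h2 *; nra.
Unshelve. all: by end_near. Qed.

Lemma hcauchyB u v : hcauchy u -> hcauchy v -> hcauchy (fun n => u n - v n).
Proof.
move=> cu cv eps eps0; have e2 := divr_gt0 eps0 (ltr0n R 2).
have [N hN] := cu _ e2; have [N' hN'] := cv _ e2; exists (maxn N N') => m n.
rewrite !geq_max => /andP[Nm N'm] /andP[Nn N'n].
have -> : u m - v m - (u n - v n) = (u m - u n) + - (v m - v n).
  by rewrite !opprD !opprK addrACA.
rewrite (le_trans (hnormD ipP _ _))// (hnormN ipP) [leRHS](splitr eps).
by rewrite lerD ?hN ?hN'.
Qed.

Lemma hcauchy_bounded_op L u : bounded_op ip L -> hcauchy u -> hcauchy (L \o u).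
Proof.
move=> [Ll [M hM]] cu eps eps0.
have M1 : 0 < `|M| + 1 by rewrite ltr_wpDl.
have [N hN] := cu _ (divr_gt0 eps0 M1); exists N => m n Nm Nn /=.
have -> : hnorm (L (u m) - L (u n)) = hnorm (L (u m - u n)).
  apply: heq_hnorm => //; apply: ip_heq => // g.
  have bL := bfun_bounded_op ipP g (conj Ll (ex_intro _ M hM)).
  by rewrite (ipBl ipP) (bfunB bL).
rewrite (le_trans (hM _))//.
apply: (@le_trans _ _ ((`|M| + 1) * hnorm (u m - u n))).
  by rewrite ler_wpM2r ?hnorm_ge0// (le_trans (ler_norm _))// lerDl.
by rewrite mulrC -ler_pdivlMr// hN.
Qed.

(** The truncations of the vector that would represent [phi] in a complete
    space. *)
Definition rep (phi : H -> R) n : H := \sum_(k < n) phi (e k) *: e k.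

Lemma ip_rep phi n v : bfun ip phi -> ip (rep phi n) v = phi (proj ip e n v).
Proof.
move=> bphi; rewrite (bfun_sum bphi) (ip_suml ipP); apply: eq_bigr => k _.
by rewrite (bfunZ bphi) (ipZl ipP) (ipC ipP) mulrC.
Qed.

Lemma ip_rep_cvg phi v : bfun ip phi -> (fun n => ip (rep phi n) v) @ \oo --> phi v.
Proof.
move=> bphi; under eq_fun do rewrite (ip_rep _ _ bphi).
by apply: (bfun_cvg bphi); exact: (proj_cvg eB).
Qed.

Lemma rep_e phi n k : ip (rep phi n) (e k) = if (k < n)%N then phi (e k) else 0.
Proof.
rewrite (ip_suml ipP); case: ifPn => kn.
  rewrite (bigD1 (Ordinal kn))//= big1 ?addr0 => [|i ik].
    by rewrite (ipZl ipP) eB.1 eqxx mulr1.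
  by rewrite (ipZl ipP) eB.1 -(inj_eq val_inj)/= in ik *; rewrite (negbTE ik) mulr0.
rewrite big1// => i _; rewrite (ipZl ipP) eB.1 ltn_eqF ?mulr0//.
by rewrite (leq_trans (ltn_ord i))// leqNgt.
Qed.

Lemma ip_rep2 phi psi n : ip (rep phi n) (rep psi n) = \sum_(k < n) phi (e k) * psi (e k).
Proof.
rewrite /rep (ip_suml ipP); apply: eq_bigr => k _.
by rewrite (ipZl ipP) (ipC ipP) -/(rep psi n) rep_e ltn_ord.
Qed.

Lemma rep_bound phi : bfun ip phi -> exists2 M, 0 <= M & forall n, hnorm (rep phi n) <= M.
Proof.
move=> bphi; have [M M0 hM] := bfun_bound bphi; exists M => // n.
have h : hnorm (rep phi n) ^+ 2 <= M * hnorm (rep phi n).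
  rewrite (hnorm_sqr ipP) ip_rep2.
  rewrite (_ : \sum_(_ < _) _ = phi (rep phi n)).
    by rewrite (le_trans (ler_norm _)).
  by rewrite (bfun_sum bphi); apply: eq_bigr => k _; rewrite (bfunZ bphi).
have [->//|h0] := eqVneq (hnorm (rep phi n)) 0.
by rewrite -(@ler_pM2r _ (hnorm (rep phi n))) -?expr2// lt_def h0 hnorm_ge0.
Qed.

(** The squared coefficients [phi (e k) ^+ 2] are summable, by the boundedness
    of [phi]. *)
Lemma rep_cauchy phi : bfun ip phi -> hcauchy (rep phi).
Proof.
move=> bphi; have [M M0 hM] := rep_bound bphi.
pose s n := \sum_(k < n) phi (e k) ^+ 2.
have snd : nondecreasing_seq s.
  apply/nondecreasing_seqP => n.
  by rewrite /s big_ord_recr/= lerDl sqr_ge0.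
have sub : has_ubound (range s).
  exists (M ^+ 2) => _ [n _ <-]; rewrite (_ : s n = hnorm (rep phi n) ^+ 2).
    by rewrite lerXn2r ?nnegrE ?hnorm_ge0.
  by rewrite (hnorm_sqr ipP) ip_rep2; apply: eq_bigr => k _; rewrite expr2.
have sle n : s n <= limn s.
  by apply: nondecreasing_cvgn_le => //; exact: nondecreasing_is_cvgn.
have key m n : (n <= m)%N -> hnorm (rep phi m - rep phi n) ^+ 2 = s m - s n.
  move=> nm; rewrite (hnorm_sqr ipP).
  have hmn : ip (rep phi m) (rep phi n) = s n.
    rewrite (ipC ipP) {1}/rep (ip_suml ipP); apply: eq_bigr => k _.
    by rewrite (ipZl ipP) (ipC ipP) rep_e (leq_trans (ltn_ord k) nm) expr2.
  have hs k : ip (rep phi k) (rep phi k) = s k.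
    by rewrite ip_rep2; apply: eq_bigr => i _; rewrite expr2.
  by rewrite (ipBl ipP) !(ipBr ipP) hmn (ipC ipP (rep phi n)) hmn !hs; ring.
move=> eps eps0; have e2 : 0 < eps ^+ 2 by rewrite exprn_gt0.
have /cvgrPdist_le/(_ _ e2)[N _ hN] : s @ \oo --> limn s by exact: nondecreasing_is_cvgn.
exists N; have wl m n : (n <= m)%N -> (N <= n)%N -> hnorm (rep phi m - rep phi n) <= eps.
  move=> nm Nn; rewrite -(@ler_pXn2r _ 2) ?nnegrE ?hnorm_ge0 ?(ltW eps0)//.
  rewrite key//; have := hN _ Nn; rewrite ger0_norm ?subr_ge0// => /=.
  by apply: le_trans; rewrite lerB.
move=> m n Nm Nn; have [nm|/ltnW mn] := leqP n m; first exact: wl.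
by rewrite (hnormC ipP) wl.
Qed.

Section covariance.
Variables (Q Qh : H -> H).
Hypothesis QhP : is_sqrt_op ip Q Qh.

Lemma ip_sqrt_op u v : ip (Q u) v = ip (Qh u) (Qh v).
Proof.
have [[_ Qs _] QQ] := QhP.
by rewrite -(heq_ip ipP _ (QQ u)) Qs.
Qed.

(** The vectors representing the truncations of [phi] may fail to converge in
    an incomplete space, but their images under [Qh] approach in norm the
    truncations of [phi \o Qh]: both sequences are Cauchy, and their difference
    tends weakly to zero. *)
Lemma sqrt_rep_cvg phi : bfun ip phi ->
  (fun n => hnorm (Qh (rep phi n) - rep (phi \o Qh) n)) @ \oo --> (0 : R).
Proof.
move=> bphi; have [[bQ Qs _] _] := QhP.
have bpsi : bfun ip (phi \o Qh) by exact: (bfun_comp bphi bQ).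
apply: hcauchy_weak0.
  apply: hcauchyB; last exact: rep_cauchy.
  by apply: (hcauchy_bounded_op bQ); exact: rep_cauchy.
move=> v; rewrite -(subrr (phi (Qh v))).
under eq_fun do rewrite (ipBl ipP) Qs.
by apply: cvgB; [exact: ip_rep_cvg|exact: (ip_rep_cvg bpsi)].
Qed.

(** This turns the covariance of the Wiener increments, seen through two
    functionals, into the sum over the basis that enters the Ito isometry. *)
Lemma covariance_rep_cvg phi phi' : bfun ip phi -> bfun ip phi' ->
  (fun n => ip (Q (rep phi n)) (rep phi' n) -
            \sum_(k < n) phi (Qh (e k)) * phi' (Qh (e k))) @ \oo --> (0 : R).
Proof.
move=> b b'; have [[bQ Qs _] _] := QhP.
have [M M0 hM] := rep_bound b'.
have [M' M'0 hM'] := rep_bound (bfun_comp b bQ).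
have [K K0 hK] : exists2 K : R, 0 <= K & forall u, hnorm (Qh u) <= K * hnorm u.
  have [_ [K hK]] := bQ; exists `|K| => // u.
  by rewrite (le_trans (hK _))// ler_wpM2r ?hnorm_ge0// ler_norm.
pose w f n := hnorm (Qh (rep f n) - rep (f \o Qh) n).
apply: (@squeeze0 _ _ (fun n => w phi n * (K * M) + M' * w phi' n)) => [n|]; last first.
  rewrite -[X in _ --> X](addr0 0) -[X in _ --> X + _](mul0r (K * M)).
  rewrite -[X in _ --> _ + X](mulr0 M').
  by apply: cvgD; [apply: cvgMl|apply: cvgMr]; exact: sqrt_rep_cvg.
rewrite ip_sqrt_op -(ip_rep2 (phi \o Qh) (phi' \o Qh)).
set u := Qh (rep phi n); set u' := Qh (rep phi' n).
set h := rep _ n; set h' := rep _ n.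
have -> : ip u u' - ip h h' = ip (u - h) u' + ip h (u' - h').
  by rewrite (ipBl ipP) (ipBr ipP); ring.
rewrite (le_trans (ler_normD _ _))// lerD// (le_trans (cauchy_schwarz ipP _ _))//.
  by rewrite ler_wpM2l ?hnorm_ge0// (le_trans (hK _))// ler_wpM2l.
by rewrite ler_wpM2r ?hnorm_ge0 ?hM'.
Qed.

(** Parseval for [Qh], read through its symmetry. *)
Lemma sqrt_op_parseval j :
  (fun n => \sum_(k < n) ip (Qh (e k)) (e j) ^+ 2) @ \oo --> ip (Q (e j)) (e j).
Proof.
have [[_ Qs _] _] := QhP; rewrite ip_sqrt_op.
have := @parseval_ip _ _ _ ipP _ eB (Qh (e j)) (Qh (e j)).
by under eq_fun do under eq_bigr do rewrite Qs (ipC ipP (e j)) -expr2.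
Qed.

End covariance.
End representation.

(** * Lower integrals and independence *)

(** The integral of a nonnegative function that need not be measurable is its
    lower integral. It is still monotone and homogeneous; additivity holds when
    one of the two functions is measurable. *)
Section lower_integral.
Local Open Scope ereal_scope.
Context d (T : measurableType d) (R : realType) (mu : {measure set T -> \bar R}).
Implicit Types f g : T -> \bar R.

Import HBNNSimple.

Lemma lower_integral_le f b : (forall x, 0 <= f x) ->
  (forall h : {nnsfun T >-> R}, (forall x, (h x)%:E <= f x) ->
     \int[mu]_x (h x)%:E <= b) ->
  \int[mu]_x f x <= b.
Proof.
move=> f0 hb; rewrite ge0_integralTE//; apply: ge_ereal_sup => _ [h /= hf <-].
by rewrite -integralT_nnsfun; exact: hb.
Qed.

Lemma le_lower_integral (D : set T) f g : (forall x, D x -> 0 <= f x) ->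
  (forall x, D x -> f x <= g x) -> \int[mu]_(x in D) f x <= \int[mu]_(x in D) g x.
Proof.
move=> f0 fg; rewrite !(integral_mkcond D).
have f0' x : 0 <= (f \_ D) x.
  by rewrite /patch; case: ifPn => // /[!inE] /f0.
have fg' x : (f \_ D) x <= (g \_ D) x.
  by rewrite /patch; case: ifPn => // /[!inE] /fg.
have g0' x : 0 <= (g \_ D) x by exact: le_trans (fg' x).
apply: lower_integral_le => // h hf.
rewrite [leRHS]ge0_integralTE// integralT_nnsfun.
by apply: ereal_sup_ubound; exists h => //= x; exact: le_trans (hf x) _.
Qed.

(** A simple function below [f + g] exceeds the measurable [g] by a measurable
    function below [f]. *)
Lemma lower_integralD (D : set T) f g : measurable D -> (forall x, D x -> 0 <= f x) ->
  (forall x, D x -> 0 <= g x) -> measurable_fun D g ->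
  \int[mu]_(x in D) (f x + g x) <= \int[mu]_(x in D) f x + \int[mu]_(x in D) g x.
Proof.
move=> mD f0 g0 mg.
pose f' := f \_ D; pose g' := g \_ D.
have f0' x : 0 <= f' x by rewrite /f' /patch; case: ifPn => // /[!inE] /f0.
have g0' x : 0 <= g' x by rewrite /g' /patch; case: ifPn => // /[!inE] /g0.
have mg' : measurable_fun [set: T] g' by exact: (measurable_restrictT g mD).1.
rewrite !(integral_mkcond D) (_ : _ \_ D = (fun x => f' x + g' x)); last first.
  by apply/funext => x; rewrite /f' /g' /patch; case: ifPn => //; rewrite adde0.
apply: lower_integral_le => [x|h hfg]; first exact: adde_ge0.
have mh : measurable_fun [set: T] (fun x => (h x)%:E).
  by apply/measurable_EFinP.
pose k x := maxe ((h x)%:E - g' x) 0.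
have mk : measurable_fun [set: T] k.
  by apply: measurable_maxe => //; apply: emeasurable_funB.
have k0 x : 0 <= k x by rewrite /k le_max lexx orbT.
apply: (@le_trans _ _ (\int[mu]_x (k x + g' x))).
  apply: ge0_le_integral => //.
  - by move=> x _; rewrite lee_fin; exact: fun_ge0.
  - exact: emeasurable_funD.
  - move=> x _; rewrite /k; case: (g' x) (g0' x) => [r r0| _|//].
      rewrite -EFinB -EFin_max -EFinD lee_fin.
      by rewrite -lerBlDr le_max lexx.
    by rewrite addey ?leey// /k; case: leP.
rewrite ge0_integralD//; apply: leeD => //.
suff kf x : k x <= f' x by exact: le_lower_integral.
rewrite /k ge_max f0' andbT; move: (hfg x) (g0' x) (f0' x).
case: (g' x) => [r| |]//; case: (f' x) => [s| |]//= h1 _ _.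
- by rewrite -EFinB lee_fin lerBlDr -lee_fin EFinD.
- by rewrite leey.
- by rewrite leNye.
Qed.

Lemma lower_integralZ (D : set T) f (k : R) : (0 < k)%R -> (forall x, D x -> 0 <= f x) ->
  \int[mu]_(x in D) (k%:E * f x) <= k%:E * \int[mu]_(x in D) f x.
Proof.
move=> k0 f0; pose f' := f \_ D.
have f0' x : 0 <= f' x by rewrite /f' /patch; case: ifPn => // /[!inE] /f0.
rewrite !(integral_mkcond D) (_ : _ \_ D = (fun x => k%:E * f' x)); last first.
  by apply/funext => x; rewrite /f' /patch; case: ifPn => //; rewrite mule0.
apply: lower_integral_le => [x|h hf]; first by rewrite mule_ge0// lee_fin ltW.
have mh : measurable_fun [set: T] (fun x => (h x)%:E) by apply/measurable_EFinP.
have h0 x : 0 <= (h x)%:E by rewrite lee_fin; exact: fun_ge0.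
have ki0 : 0 <= (k^-1)%:E by rewrite lee_fin invr_ge0 ltW.
have : \int[mu]_x ((k^-1)%:E * (h x)%:E) <= \int[mu]_x f' x.
  apply: le_lower_integral => x _; first exact: mule_ge0.
  apply: (@le_trans _ _ ((k^-1)%:E * (k%:E * f' x))); first exact: lee_wpmul2l.
  by rewrite muleA -EFinM mulVf ?gt_eqF// mul1e.
rewrite ge0_integralZl// => hle.
have -> : \int[mu]_x (h x)%:E = k%:E * ((k^-1)%:E * \int[mu]_x (h x)%:E).
  by rewrite muleA -EFinM divff ?gt_eqF// mul1e.
by apply: lee_wpmul2l => //; rewrite lee_fin ltW.
Qed.

End lower_integral.

Section independence.
Local Open Scope ereal_scope.
Context d (T : measurableType d) (R : realType) (P : probability T R).

Definition indep_rv (X Y : T -> R) := forall A B : set R,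
  measurable A -> measurable B ->
  P (X @^-1` A `&` Y @^-1` B) = P (X @^-1` A) * P (Y @^-1` B).

(** By independence the law of the pair agrees with the product measure on
    rectangles, hence is the product measure, and the theorem of Tonelli
    applies. *)
Lemma ge0_expectationM (X Y : T -> R) (f g : R -> R) :
  measurable_fun setT X -> measurable_fun setT Y -> indep_rv X Y ->
  measurable_fun setT f -> measurable_fun setT g ->
  (forall x, 0 <= f x)%R -> (forall x, 0 <= g x)%R ->
  \int[P]_w (f (X w) * g (Y w))%:E = \int[P]_w (f (X w))%:E * \int[P]_w (g (Y w))%:E.
Proof.
move=> mX mY XY mf mg f0 g0.
pose Z w := (X w, Y w).
have mZ : measurable_fun setT (Z : T -> R * R).
  exact: measurable_fun_pair.
pose X' : {RV P >-> R} := mfun_Sub (mem_set mX).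
pose Y' : {RV P >-> R} := mfun_Sub (mem_set mY).
pose m1 := distribution P X'; pose m2 := distribution P Y'.
pose F (z : R * R) := (f z.1 * g z.2)%:E.
have mF : measurable_fun setT F.
  apply/measurable_EFinP; apply: measurable_funM.
    exact: (measurableT_comp mf).
  exact: (measurableT_comp mg).
have F0 z : 0 <= F z by rewrite lee_fin mulr_ge0.
transitivity (\int[pushforward P Z]_z F z).
  by rewrite ge0_integral_pushforward.
transitivity (\int[m1 \x m2]_z F z).
  apply: eq_measure_integral => A mA _; apply/esym.
  refine (@product_measure_unique _ _ _ _ _ m1 m2
    (measure_function_pushforward__canonical__measure_function_Measure P mZ)
    _ A mA) => B C mB mC.
  exact: (XY B C mB mC).
rewrite fubini_tonelli1//.
transitivity (\int[m1]_x ((f x)%:E * \int[m2]_y (g y)%:E)).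
  apply: eq_integral => x _; rewrite /fubini_F -ge0_integralZl//.
  - exact/measurable_EFinP.
  - by move=> y _; rewrite lee_fin.
  - by rewrite lee_fin.
rewrite ge0_integralZr//; last by apply: integral_ge0 => y _; rewrite lee_fin.
- by congr (_ * _); rewrite ge0_integral_pushforward//;
    (try by apply/measurable_EFinP); move=> x _; rewrite lee_fin.
- exact/measurable_EFinP.
- by move=> x _; rewrite lee_fin.
Qed.

End independence.

(** * Gaussian variables *)

Section density.
Local Open Scope ereal_scope.
Context d (T : measurableType d) (R : realType).
Variables (mu nu : {measure set T -> \bar R}) (g : T -> R).
Hypothesis mg : measurable_fun setT g.
Hypothesis g0 : forall x, (0 <= g x)%R.
Hypothesis nuE : forall A, measurable A -> nu A = \int[mu]_(x in A) (g x)%:E.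

Import HBNNSimple.

Lemma integral_density_nnsfun (h : {nnsfun T >-> R}) :
  \int[nu]_x (h x)%:E = \int[mu]_x (h x * g x)%:E.
Proof.
rewrite integralT_nnsfun sintegralE.
transitivity (\int[mu]_x (\sum_(y \in range h) (y * \1_(h @^-1` [set y]) x * g x)%:E)).
  rewrite ge0_integral_fsum//; last 2 first.
  - move=> y; apply/measurable_EFinP; apply: measurable_funM => //.
    exact: measurable_funM.
  - by move=> y x _; rewrite EFinM mule_ge0 ?lee_fin// -lee_fin nnfun_muleindic_ge0.
  apply: eq_fsbigr => r /[!inE] -[t _ hr].
  have r0 : (0 <= r)%R by rewrite -hr; exact: fun_ge0.
  rewrite nuE// [in LHS]integral_mkcond -ge0_integralZl//; last 2 first.
  - by apply/(measurable_restrictT (EFin \o g)) => //; apply/measurable_EFinP/measurable_funTS.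
  - by move=> x _; rewrite /patch; case: ifP; rewrite ?lee_fin.
  apply: eq_integral => x _; rewrite /patch indicE; case: ifPn => _.
    by rewrite mulr1 -EFinM.
  by rewrite mulr0 mul0r mule0.
apply: eq_integral => x _; rewrite [in RHS](fimfunE h) fsumEFin//.
by rewrite !fsbig_finite//= mulr_suml.
Qed.

(** The two sides agree for simple functions, and the left one is a supremum
    over the simple functions below [f]. *)
Lemma integral_density_le (f : T -> R) : measurable_fun setT f ->
  (forall x, 0 <= f x)%R -> \int[nu]_x (f x)%:E <= \int[mu]_x (f x * g x)%:E.
Proof.
move=> mf f0; apply: lower_integral_le => [x|h hf]; first by rewrite lee_fin.
rewrite integral_density_nnsfun; apply: le_lower_integral => x _.
  by rewrite lee_fin mulr_ge0.
by rewrite lee_fin ler_wpM2r// -lee_fin.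
Qed.

End density.

Section gaussian.
Local Open Scope ereal_scope.
Context {R : realType}.

(** Completing the square: the exponential tilt of a centred normal density is
    a normal density with a shifted mean. *)
Lemma normal_mgf (s theta : R) : s != 0%R ->
  \int[normal_prob 0 s]_x (expR (theta * x))%:E <= (expR (theta ^+ 2 * s ^+ 2 / 2))%:E.
Proof.
move=> s0.
have mexp : measurable_fun [set: R] (fun x : R => expR (theta * x)).
  by apply: measurableT_comp => //; exact: measurable_funM.
have h : \int[normal_prob 0 s]_x (expR (theta * x))%:E <=
    \int[lebesgue_measure]_x (expR (theta * x) * normal_pdf 0 s x)%:E.
  apply: integral_density_le => //.
  - exact: measurable_normal_pdf.
  - by move=> x; exact: normal_pdf_ge0.
refine (le_trans h _) => {h}.
pose C := expR (theta ^+ 2 * s ^+ 2 / 2).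
have -> : (fun x : measurableTypeR R => (expR (theta * x) * normal_pdf 0 s x)%:E) =
    (fun x => C%:E * (normal_pdf (theta * s ^+ 2) s x)%:E).
  apply/funext => x; rewrite -EFinM; congr (_%:E).
  rewrite /normal_pdf (negbTE s0) /normal_fun mulrCA [RHS]mulrCA; congr (_ * _)%R.
  rewrite /C -!expRD; congr expR; field.
  by rewrite s0.
rewrite ge0_integralZl//.
- by rewrite integral_normal_pdf mule1.
- by apply/measurable_EFinP; exact: measurable_normal_pdf.
- by move=> x _; rewrite lee_fin normal_pdf_ge0.
- by rewrite lee_fin expR_ge0.
Qed.

Context d (T : measurableType d) (P : probability T R).

Lemma gaussian_law (X Y : T -> R) v (f : R -> R) : gaussian P X v -> gaussian P Y v ->
  measurable_fun setT X -> measurable_fun setT Y ->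
  measurable_fun setT f -> (forall x, 0 <= f x)%R ->
  \int[P]_w (f (X w))%:E = \int[P]_w (f (Y w))%:E.
Proof.
rewrite /gaussian; case: ifPn => _ gX gY mX mY mf f0.
  apply: ge0_ae_eq_integral => //.
  - by apply/measurable_EFinP; exact: measurableT_comp.
  - by apply/measurable_EFinP; exact: measurableT_comp.
  - by move=> x _; rewrite lee_fin.
  - by move=> x _; rewrite lee_fin.
  by apply: filterS2 gX gY => w Xw Yw _; rewrite Xw Yw.
have pf Z : measurable_fun setT Z ->
    \int[P]_w (f (Z w))%:E = \int[pushforward P Z]_x (f x)%:E.
  move=> mZ; rewrite ge0_integral_pushforward//; first exact/measurable_EFinP.
  by move=> x _; rewrite lee_fin.
rewrite !pf//; apply: (@eq_measure_integral _ _ _ _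
  (measure_function_pushforward__canonical__measure_function_Measure P mY)
  (measure_function_pushforward__canonical__measure_function_Measure P mX)) => A mA _.
by rewrite /= /pushforward gX// gY.
Qed.

Lemma gaussian_mgf (X : T -> R) v theta : measurable_fun setT X -> (0 <= v)%R ->
  gaussian P X v ->
  \int[P]_w (expR (theta * X w))%:E <= (expR (theta ^+ 2 * v / 2))%:E.
Proof.
move=> mX v0; rewrite /gaussian.
have mexp : measurable_fun [set: R] (fun x : R => expR (theta * x)).
  by apply: measurableT_comp => //; exact: measurable_funM.
case: ifPn => [/eqP ->|vn0] gX.
  rewrite mulr0 mul0r expR0.
  rewrite (ge0_ae_eq_integral (g := cst 1%E))//.
  - by rewrite integral_cst// mul1e; exact: probability_le1.
  - by apply/measurable_EFinP; exact: (measurableT_comp mexp).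
  - by apply: filterS gX => w Xw _; rewrite Xw mulr0 expR0.
have sv : Num.sqrt v != 0%R by rewrite sqrtr_eq0 -ltNge lt_def vn0.
have := normal_mgf theta sv; rewrite sqr_sqrtr//; apply: le_trans.
pose X' : T -> measurableTypeR R := X.
have mX' : measurable_fun setT X' by exact: mX.
rewrite (_ : \int[P]_w _ = \int[pushforward P X']_x (expR (theta * x))%:E); last first.
  by rewrite ge0_integral_pushforward//; exact/measurable_EFinP.
rewrite le_eqVlt; apply/orP; left; apply/eqP.
apply: (@eq_measure_integral _ _ _ _ _
  (measure_function_pushforward__canonical__measure_function_Measure P mX')) => A mA _.
by rewrite /= /pushforward gX.
Qed.

End gaussian.

(** * Square-integrable functions *)

Section square_integrable.
Context d (T : measurableType d) (R : realType) (mu : {measure set T -> \bar R}).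
Implicit Types f g : T -> R.

Definition sqint f := measurable_fun setT f /\ (\int[mu]_x (f x ^+ 2)%:E < +oo)%E.

Lemma sqint_Lfun f : sqint f <-> f \in Lfun mu 2%:E.
Proof.
split => [[mf if2]|l2f].
  rewrite inE; apply/andP; split; rewrite inE//= /finite_norm unlock.
  rewrite poweR_lty//; apply: le_lt_trans if2.
  rewrite le_eqVlt; apply/orP; left; apply/eqP/eq_integral => x _ /=.
  by rewrite powR_mulrn ?normr_ge0// real_normK ?num_real.
split; first by move: l2f; rewrite inE => /andP[/[!inE]].
have /integrableP[_] := Lfun2_integrable_sqr l2f.
by under eq_integral do rewrite /= ger0_norm ?sqr_ge0//.
Qed.

Lemma sqint_prod f g : sqint f -> sqint g ->
  mu.-integrable setT (EFin \o (fun x => f x * g x)).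
Proof.
by move=> /sqint_Lfun l2f /sqint_Lfun l2g; exact/Lfun1_integrable/Lfun2_mul_Lfun1.
Qed.

Lemma sqintD f g : sqint f -> sqint g -> sqint (fun x => f x + g x).
Proof.
move=> /sqint_Lfun l2f /sqint_Lfun l2g; apply/sqint_Lfun.
exact: (Lfun_addr_closed mu (lee1n 2)).2.
Qed.

Lemma sqintZ a f : sqint f -> sqint (fun x => a * f x).
Proof.
move=> [mf if2]; split; first exact: measurable_funM.
under eq_integral do rewrite exprMn EFinM.
rewrite ge0_integralZl ?lee_fin ?sqr_ge0//.
- by rewrite lte_mul_pinfty// lee_fin sqr_ge0.
- by apply/measurable_EFinP; exact: measurable_funX.
- by move=> x _; rewrite lee_fin sqr_ge0.
Qed.

Lemma sqint0 : sqint (cst 0).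
Proof.
split => //; under eq_integral do rewrite expr0n.
by rewrite integral0.
Qed.

Lemma sqint_sum I (s : seq I) (f : I -> T -> R) : (forall i, sqint (f i)) ->
  sqint (fun x => \sum_(i <- s) f i x).
Proof.
move=> sf; elim: s => [|i s IH].
  by under eq_fun do rewrite big_nil; exact: sqint0.
by under eq_fun do rewrite big_cons; exact: sqintD.
Qed.

Definition moment2 f g : R := \int[mu]_x (f x * g x).

Lemma moment2C f g : moment2 f g = moment2 g f.
Proof. by apply: eq_Rintegral => x _; rewrite mulrC. Qed.

Lemma moment2D f f' g : sqint f -> sqint f' -> sqint g ->
  moment2 (fun x => f x + f' x) g = moment2 f g + moment2 f' g.
Proof.
move=> sf sf' sg; rewrite /moment2.
under eq_Rintegral do rewrite mulrDl.
by rewrite RintegralD//; exact: sqint_prod.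
Qed.

Lemma moment2Z a f g : sqint f -> sqint g ->
  moment2 (fun x => a * f x) g = a * moment2 f g.
Proof.
move=> sf sg; rewrite /moment2.
under eq_Rintegral do rewrite -mulrA.
by rewrite RintegralZl//; exact: sqint_prod.
Qed.

Lemma moment2_suml I (s : seq I) (f : I -> T -> R) g : (forall i, sqint (f i)) -> sqint g ->
  moment2 (fun x => \sum_(i <- s) f i x) g = \sum_(i <- s) moment2 (f i) g.
Proof.
move=> sf sg; elim: s => [|i s IH].
  rewrite big_nil /moment2; under eq_Rintegral do rewrite big_nil mul0r.
  by rewrite /Rintegral integral0.
under eq_fun do rewrite big_cons.
by rewrite big_cons moment2D// ?IH//; exact: sqint_sum.
Qed.

Lemma moment2_sumr I (s : seq I) (f : I -> T -> R) g : (forall i, sqint (f i)) -> sqint g ->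
  moment2 g (fun x => \sum_(i <- s) f i x) = \sum_(i <- s) moment2 g (f i).
Proof.
move=> sf sg; rewrite moment2C moment2_suml//.
by apply: eq_bigr => i _; rewrite moment2C.
Qed.

Lemma moment2_ge0 f : 0 <= moment2 f f.
Proof. by apply: Rintegral_ge0 => x _; rewrite -expr2 sqr_ge0. Qed.

Lemma moment2E f : sqint f -> (\int[mu]_x (f x ^+ 2)%:E = (moment2 f f)%:E)%E.
Proof.
move=> sf; rewrite /moment2 /Rintegral fineK//.
by have := integrable_fin_num measurableT (sqint_prod sf sf).
Qed.

End square_integrable.

Lemma l2_semi_inner (R : realType) (d : nat) (D : set 'rV[R]_d) (oD : open D) :
  semi_inner (l2_ip oD).
Proof.
have s (f : L2 oD) : sqint (lebesgue_on oD) f.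
  by apply/sqint_Lfun; exact: LfunP.
split.
- by move=> u v; exact: (@moment2C _ _ _ (lebesgue_on oD) u v).
- move=> a u v w; rewrite /l2_ip -(@moment2Z _ _ _ (lebesgue_on oD) a u w)//.
  rewrite -(@moment2D _ _ _ (lebesgue_on oD) (fun x => a * u x) v w)//.
  exact: sqintZ.
- by move=> u; exact: (@moment2_ge0 _ _ _ (lebesgue_on oD) u).
Qed.

(** * Increments of the Wiener process *)

Section wiener_moments.
Context {R : realType} {H : lmodType R} (ip : H -> H -> R).
Hypothesis ipP : semi_inner ip.
Context {dO : measure_display} {Omega : measurableType dO}.
Variables (P : probability Omega R) (F : R -> set (set Omega)).
Hypothesis FP : normal_filtration P F.
Variables (Q : H -> H) (W : R -> Omega -> H).
Hypotheses (QP : psd_op ip Q) (WP : Q_wiener ip P F Q W).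

Definition adapted s (G : Omega -> R) := forall B, measurable B -> F s (G @^-1` B).

Lemma adaptedP s G : 0 <= s ->
  adapted s G <-> measurable_fun setT (G : g_sigma_algebraType (F s) -> R).
Proof.
move=> s0; have [/(_ s s0)[sF _] _ _ _] := FP; split => [aG _ B mB|mG B mB].
  by rewrite setTI; apply: sub_sigma_algebra; exact: aG.
have := mG measurableT _ mB; rewrite setTI.
by rewrite [in X in X -> _]/measurable /= sigma_algebra_id.
Qed.

Lemma adapted_measurable s G : 0 <= s -> adapted s G -> measurable_fun setT G.
Proof.
move=> s0 aG _ B mB; rewrite setTI.
by have [/(_ s s0)[_ sub] _ _ _] := FP; apply: sub; exact: aG.
Qed.

Lemma adapted_mono s t G : 0 <= s -> s <= t -> adapted s G -> adapted t G.
Proof.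
by move=> s0 st aG B mB; have [_ mon _ _] := FP; apply: (mon _ _ s0 st); exact: aG.
Qed.

Lemma adapted_indic s S : 0 <= s -> F s S -> adapted s \1_S.
Proof.
move=> s0 FS; apply/(adaptedP _ s0).
by apply: (@measurable_indic _ (g_sigma_algebraType (F s)) R setT S); exact: sub_sigma_algebra.
Qed.

Lemma adaptedM s G G' : 0 <= s -> adapted s G -> adapted s G' ->
  adapted s (fun w => G w * G' w).
Proof.
move=> s0 /(adaptedP _ s0) aG /(adaptedP _ s0) aG'; apply/(adaptedP _ s0).
exact: measurable_funM.
Qed.

Lemma adaptedB s G G' : 0 <= s -> adapted s G -> adapted s G' ->
  adapted s (fun w => G w - G' w).
Proof.
move=> s0 /(adaptedP _ s0) aG /(adaptedP _ s0) aG'; apply/(adaptedP _ s0).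
exact: measurable_funB.
Qed.

Lemma adaptedD s G G' : 0 <= s -> adapted s G -> adapted s G' ->
  adapted s (fun w => G w + G' w).
Proof.
move=> s0 /(adaptedP _ s0) aG /(adaptedP _ s0) aG'; apply/(adaptedP _ s0).
exact: measurable_funD.
Qed.

Lemma adapted_cst s a : 0 <= s -> adapted s (cst a).
Proof. by move=> s0; apply/(adaptedP _ s0). Qed.

Lemma adapted_wiener t h : 0 <= t -> adapted t (fun w => ip (W t w) h).
Proof.
move=> t0 B mB; have [_ /(_ t t0) sub _ _ _] := WP; apply: sub.
by apply: sub_sigma_algebra; exists h, B.
Qed.

Lemma filtration_measurable s S : 0 <= s -> F s S -> measurable S.
Proof. by move=> s0 FS; have [/(_ s s0)[_ sub] _ _ _] := FP; exact: sub. Qed.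

Lemma filtrationI s S S' : 0 <= s -> F s S -> F s S' -> F s (S `&` S').
Proof.
move=> s0 FS FS'.
have := adaptedM s0 (adapted_indic s0 FS) (adapted_indic s0 FS').
move=> /(_ [set 1] (measurable_set1 _)).
rewrite (_ : _ @^-1` _ = S `&` S')//; apply/seteqP; split => w /=; rewrite !indicE -natrM.
  rewrite mulnb; case: (boolP (w \in S)); case: (boolP (w \in S')) => /=; rewrite ?inE//;
    by move=> _ _ /esym/eqP; rewrite oner_eq0.
by move=> [Sw S'w]; rewrite !mem_set.
Qed.

Definition dW s t h w := ip (W t w - W s w) h.

Lemma dWE s t h w : dW s t h w = ip (W t w) h - ip (W s w) h.
Proof. by rewrite /dW (ipBl ipP). Qed.

Lemma dW_split s u t h w : dW s t h w = dW s u h w + dW u t h w.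
Proof. by rewrite !dWE; ring. Qed.

Lemma adapted_dW s t h : 0 <= s -> s <= t -> adapted t (dW s t h).
Proof.
move=> s0 st; have t0 := le_trans s0 st.
rewrite (_ : dW s t h = fun w => ip (W t w) h - ip (W s w) h).
  by apply: adaptedB => //; [|apply: (adapted_mono s0 st)]; exact: adapted_wiener.
by apply/funext => w; exact: dWE.
Qed.

Lemma measurable_dW s t h : 0 <= s -> s <= t -> measurable_fun setT (dW s t h).
Proof.
by move=> s0 st; apply: (adapted_measurable (le_trans s0 st)); exact: adapted_dW.
Qed.

Lemma gaussian_dW s t h : 0 <= s -> s <= t -> gaussian P (dW s t h) ((t - s) * ip (Q h) h).
Proof. by move=> s0 st; have [_ _ _ g _] := WP; exact: g. Qed.

Lemma dW_variance_ge0 s t h : s <= t -> 0 <= (t - s) * ip (Q h) h.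
Proof. by move=> st; rewrite mulr_ge0 ?subr_ge0//; case: QP. Qed.

Lemma indep_dW s t h G : 0 <= s -> s <= t -> adapted s G -> indep_rv P G (dW s t h).
Proof.
move=> s0 st aG A B mA mB; have [_ _ _ _ ind] := WP.
by apply: (ind s t) => //; [exact: aG|apply: sub_sigma_algebra; exists h, B].
Qed.

Lemma mgf_dW s t h theta : 0 <= s -> s <= t ->
  (\int[P]_w (expR (theta * dW s t h w))%:E <=
   (expR (theta ^+ 2 * ((t - s) * ip (Q h) h) / 2))%:E)%E.
Proof.
move=> s0 st; apply: gaussian_mgf; [exact: measurable_dW| |exact: gaussian_dW].
exact: dW_variance_ge0.
Qed.

Lemma sqr_le_expR (x : R) : x ^+ 2 <= 2 * (expR x + expR (- x)).
Proof.
have p (y : R) : 0 <= y -> y ^+ 2 <= 2 * expR y.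
  move=> y0; have := @expR_ge1Dxn R y 1 y0.
  rewrite (_ : 2`!%:R = 2 :> R)//; have := sqr_ge0 y; lra.
have [x0|x0] := leP 0 x.
  by apply: (le_trans (p _ x0)); rewrite mulrDr lerDl mulr_ge0// expR_ge0.
rewrite -sqrrN; apply: (le_trans (p (- x) _)); first by rewrite oppr_ge0 ltW.
by rewrite mulrDr lerDr mulr_ge0// expR_ge0.
Qed.

Lemma sqint_dW s t h : 0 <= s -> s <= t -> sqint P (dW s t h).
Proof.
move=> s0 st; have mX := measurable_dW h s0 st; split => //.
have mexp a : measurable_fun setT (fun w => (expR (a * dW s t h w))%:E).
  by apply/measurable_EFinP; apply: measurableT_comp => //; exact: measurable_funM.
apply: (@le_lt_trans _ _ (\int[P]_w (2%:E * ((expR (1 * dW s t h w))%:E +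
    (expR (-1 * dW s t h w))%:E)))%E).
  apply: le_lower_integral => w _; first by rewrite lee_fin sqr_ge0.
  by rewrite -EFinD -EFinM lee_fin mul1r mulN1r sqr_le_expR.
have e0 a w : (0 <= (expR (a * dW s t h w))%:E)%E by rewrite lee_fin expR_ge0.
rewrite ge0_integralZl//; last 2 first.
- exact: emeasurable_funD.
- by move=> w _; rewrite adde_ge0.
rewrite ge0_integralD//.
have h1 := mgf_dW h 1 s0 st; have h2 := mgf_dW h (-1) s0 st.
apply: (@le_lt_trans _ _ (2%:E * ((expR (1 ^+ 2 * ((t - s) * ip (Q h) h) / 2))%:E +
  (expR ((-1) ^+ 2 * ((t - s) * ip (Q h) h) / 2))%:E))%E).
  by rewrite lee_wpmul2l// leeD.
by rewrite -EFinD -EFinM ltry.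
Qed.

(** The second moment of an increment is a fixed multiple of its variance
    parameter: two increments are compared after rescaling [h], using that
    Gaussian variables with the same parameter have the same law. *)
Lemma second_moment_dW : exists2 c : R, 0 <= c & forall s t h, 0 <= s -> s <= t ->
  moment2 P (dW s t h) (dW s t h) = c * ((t - s) * ip (Q h) h).
Proof.
have [[s0 [t0 [h0 [p1 p2 p3]]]]|none] := pselect (exists s t h,
  [/\ 0 <= s, s <= t & (t - s) * ip (Q h) h != 0]); last first.
  exists 0 => // s t h s0 st; rewrite mul0r.
  have v0 : (t - s) * ip (Q h) h = 0.
    by apply/eqP; apply: contrapT => /negP n; apply: none; exists s, t, h.
  have := gaussian_dW h s0 st; rewrite /gaussian v0 eqxx => ae0.
  apply: EFin_inj; rewrite -moment2E; last exact: sqint_dW.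
  rewrite (ge0_ae_eq_integral (g := cst 0%E))//.
  - by rewrite integral0.
  - by apply/measurable_EFinP; apply: measurable_funX; exact: measurable_dW.
  - by move=> w _; rewrite lee_fin sqr_ge0.
  - by apply: filterS ae0 => w Xw _; rewrite Xw expr0n.
set v0 := _ * _ in p3.
have v0p : 0 < v0 by rewrite lt_def p3 dW_variance_ge0.
exists (moment2 P (dW s0 t0 h0) (dW s0 t0 h0) / v0).
  by rewrite divr_ge0 ?moment2_ge0 ?ltW.
move=> s t h s1 st; set v := _ * ip (Q h) h.
have vp : 0 <= v by exact: dW_variance_ge0.
pose k := Num.sqrt (v / v0).
have k2 : k ^+ 2 = v / v0 by rewrite sqr_sqrtr// divr_ge0// ltW.
have dWk w : dW s0 t0 (k *: h0) w = k * dW s0 t0 h0 w by rewrite /dW (ipZr ipP).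
have [bQ _ _] := QP.
have g1 : gaussian P (dW s0 t0 (k *: h0)) v.
  have := gaussian_dW (k *: h0) p1 p2; rewrite (ipZr ipP).
  rewrite (bfunZ (bfun_bounded_op ipP h0 bQ)).
  rewrite (_ : (t0 - s0) * (k * (k * ip (Q h0) h0)) = k ^+ 2 * v0); last by rewrite /v0; ring.
  by rewrite k2 divfK// gt_eqF.
apply: EFin_inj; rewrite -moment2E; last exact: sqint_dW.
rewrite (gaussian_law (X := dW s t h) (f := fun x => x ^+ 2) (gaussian_dW h s1 st) g1)//;
  [|exact: measurable_dW|exact: measurable_dW|by move=> x; exact: sqr_ge0].
rewrite moment2E; last exact: sqint_dW.
congr (_%:E); rewrite (_ : dW s0 t0 (k *: h0) = fun w => k * dW s0 t0 h0 w); last exact/funext.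
have sq := sqint_dW h0 p1 p2.
rewrite moment2Z//; last exact: sqintZ.
rewrite moment2C moment2Z// mulrA -expr2 k2.
by rewrite mulrC mulrA [RHS]mulrAC.
Qed.

Lemma sqint_le (f g : Omega -> R) : measurable_fun setT f -> (forall w, `|f w| <= `|g w|) ->
  sqint P g -> sqint P f.
Proof.
move=> mf fg [_ ig]; split => //; apply: le_lt_trans ig.
apply: le_lower_integral => w _; first by rewrite lee_fin sqr_ge0.
by rewrite lee_fin -(real_normK (num_real (f w))) -(real_normK (num_real (g w))) lerXn2r ?nnegrE.
Qed.

(** By independence and symmetry of the increment, the four products of positive
    and negative parts cancel. *)
Lemma moment2_adapted_dW s t h G : 0 <= s -> s <= t -> adapted s G -> sqint P G ->
  moment2 P G (dW s t h) = 0.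
Proof.
move=> s0 st aG sG; set X := dW s t h.
have sX : sqint P X by exact: sqint_dW.
have mX := sX.1; have mG := sG.1.
pose pos (x : R) := Num.max x 0; pose neg (x : R) := Num.max (- x) 0.
have mpos : measurable_fun setT pos by exact: measurable_maxr.
have mneg : measurable_fun setT neg.
  by apply: measurable_maxr => //; exact: oppr_measurable.
have pos0 x : 0 <= pos x by rewrite le_max lexx orbT.
have neg0 x : 0 <= neg x by rewrite le_max lexx orbT.
have posneg x : x = pos x + -1 * neg x.
  by rewrite /pos /neg mulN1r; case: (leP x 0) => x0; case: (leP (- x) 0); lra.
have pos1 x : `|pos x| <= `|x|.
  by rewrite ger0_norm// /pos ge_max ler_norm normr_ge0.
have neg1 x : `|neg x| <= `|x|.
  by rewrite ger0_norm// /neg ge_max -normrN ler_norm normr_ge0.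
have sf (f : R -> R) (Y : Omega -> R) : measurable_fun setT f -> (forall x, `|f x| <= `|x|) -> sqint P Y ->
    sqint P (f \o Y).
  move=> mf f1 sY; apply: (sqint_le (g := Y)) => //; last by move=> w; exact: f1.
  by apply: (measurableT_comp mf); exact: sY.1.
have key (f : R -> R) : measurable_fun setT f -> (forall x, 0 <= f x) ->
    moment2 P (f \o G) (pos \o X) = moment2 P (f \o G) (neg \o X).
  move=> mf f0; rewrite /moment2 /Rintegral; congr fine.
  have ind := indep_dW h s0 st aG.
  have e1 := ge0_expectationM mG mX ind mf mpos f0 pos0.
  have e2 := ge0_expectationM mG mX ind mf mneg f0 neg0.
  rewrite /= e1 e2; congr (_ * _)%E.
  have gN : gaussian P (dW s t (- h)) ((t - s) * ip (Q h) h).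
    have := gaussian_dW (- h) s0 st; have [bQ _ _] := QP.
    rewrite (ipNr ipP) -[in Q (- h)]scaleN1r.
    by rewrite (bfunZ (bfun_bounded_op ipP h bQ)) mulN1r opprK.
  rewrite (gaussian_law (gaussian_dW h s0 st) gN)//; last exact: measurable_dW.
  apply: eq_integral => w _; rewrite /pos /neg; congr (Num.max _ _)%:E.
  by rewrite /X /dW (ipNr ipP).
have -> : G = fun w => (pos \o G) w + -1 * (neg \o G) w by apply/funext => w; exact: posneg.
have sneg := sqintZ (-1) (sf _ _ mneg neg1 sG).
rewrite moment2D//; last exact: sf.
rewrite moment2Z//; last exact: sf.
have split (f : R -> R) : measurable_fun setT f -> (forall x, 0 <= f x) -> (forall x, `|f x| <= `|x|) ->
    moment2 P (f \o G) X = 0.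
  move=> mf f0 f1; rewrite moment2C.
  have -> : X = fun w => (pos \o X) w + -1 * (neg \o X) w by apply/funext => w; exact: posneg.
  have sfG := sf _ _ mf f1 sG.
  rewrite moment2D//; [|exact: sf|by apply: sqintZ; exact: sf].
  rewrite moment2Z//; last exact: sf.
  by rewrite moment2C key// [moment2 P (neg \o X) _]moment2C mulN1r subrr.
by rewrite !split// mulr0 addr0.
Qed.

End wiener_moments.

(** * Covariances of localized increments *)

Section ito_isometry.
Context {R : realType} {H : lmodType R} (ip : H -> H -> R).
Hypothesis ipP : semi_inner ip.
Context {dO : measure_display} {Omega : measurableType dO}.
Variables (P : probability Omega R) (F : R -> set (set Omega)).
Hypothesis FP : normal_filtration P F.
Variables (Q : H -> H) (W : R -> Omega -> H).
Hypotheses (QP : psd_op ip Q) (WP : Q_wiener ip P F Q W).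
Variable c : R.
Hypothesis cP : forall s t h, 0 <= s -> s <= t ->
  moment2 P (dW ip W s t h) (dW ip W s t h) = c * ((t - s) * ip (Q h) h).

Local Notation sqint_dW := (sqint_dW ipP FP QP WP).
Local Notation adapted_dW := (adapted_dW ipP FP WP).

(** The integral of the elementary process [\1_S 1_]s, t]], seen in the
    direction [h]. *)
Definition idW (S : set Omega) s t h w := \1_S w * dW ip W s t h w.

Lemma sqint_indicM (S : set Omega) (G : Omega -> R) : measurable S -> sqint P G ->
  sqint P (fun w => \1_S w * G w).
Proof.
move=> mS sG; apply: (sqint_le (g := G)) => //.
  by apply: measurable_funM; [exact: measurable_indic|exact: sG.1].
move=> w; rewrite normrM ger0_norm ?indicE ?ler0n//.
by case: (_ \in _); rewrite ?mul1r ?mul0r.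
Qed.

Lemma sqint_idW S s t h : 0 <= s -> s <= t -> F s S -> sqint P (idW S s t h).
Proof.
move=> s0 st FS; apply: sqint_indicM; last exact: sqint_dW.
exact: (filtration_measurable FP s0).
Qed.

Lemma ipQ_D u v w : ip (Q (u + v)) w = ip (Q u) w + ip (Q v) w.
Proof. by have [bQ _ _] := QP; exact: (bfunD (bfun_bounded_op ipP w bQ)). Qed.

Lemma moment2_idW_diag S s t h : 0 <= s -> s <= t -> F s S ->
  moment2 P (idW S s t h) (idW S s t h) = fine (P S) * (c * ((t - s) * ip (Q h) h)).
Proof.
move=> s0 st FS; have mS := filtration_measurable FP s0 FS.
apply: EFin_inj; rewrite -moment2E; last exact: sqint_idW.
have sqi w : (\1_S w : R) ^+ 2 = \1_S w.
  by rewrite indicE; case: (_ \in _); rewrite ?expr1n ?expr0n.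
have sq := sqint_dW h s0 st.
have aS : adapted F s \1_S by exact: (adapted_indic FP).
have := ge0_expectationM (f := fun x : R => x ^+ 2) (g := fun x : R => x ^+ 2)
  (measurable_indic mS) sq.1 (indep_dW WP h s0 st aS) (exprn_measurable 2) (exprn_measurable 2).
move=> /(_ (fun x => sqr_ge0 x) (fun x => sqr_ge0 x)) /=.
under eq_integral do rewrite -exprMn -/(idW S s t h _).
move=> ->; under eq_integral do rewrite sqi.
rewrite integral_indic// setIT moment2E// cP// [RHS]EFinM fineK//.
exact: fin_num_measure.
Qed.

Lemma moment2_idW_same S s t h h' : 0 <= s -> s <= t -> F s S ->
  moment2 P (idW S s t h) (idW S s t h') = fine (P S) * (c * ((t - s) * ip (Q h) h')).
Proof.
move=> s0 st FS.
have s1 := sqint_idW h s0 st FS; have s2 := sqint_idW h' s0 st FS.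
have := moment2_idW_diag (h + h') s0 st FS.
have -> : idW S s t (h + h') = fun w => idW S s t h w + idW S s t h' w.
  by apply/funext => w; rewrite /idW /dW (ipDr ipP) mulrDr.
have s12 := sqintD s1 s2.
rewrite moment2D// (moment2C _ (idW S s t h)) moment2D//.
rewrite [in X in _ + X]moment2C moment2D// !moment2_idW_diag//.
rewrite (moment2C _ (idW S s t h') (idW S s t h)).
have [_ Qs _] := QP.
rewrite ipQ_D !(ipDr ipP) (Qs h' h) (ipC ipP h').
set a := fine (P S); set x := moment2 _ _ _; set y := ip (Q h) h'.
by move=> e; apply: (@mulfI _ 2) => //; lra.
Qed.

(** The part of the longer increment after [t] is uncorrelated with everything
    that is known at time [t]. *)
Lemma moment2_idW_start S s t t' h h' : 0 <= s -> s <= t -> t <= t' -> F s S ->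
  moment2 P (idW S s t h) (idW S s t' h') = fine (P S) * (c * ((t - s) * ip (Q h) h')).
Proof.
move=> s0 st tt' FS; have t0 := le_trans s0 st; have st' := le_trans st tt'.
have [_ mon _ _] := FP; have FtS := mon _ _ s0 st _ FS.
have s1 := sqint_idW h s0 st FS; have s2 := sqint_idW h' s0 st FS.
have s3 := sqint_idW h' t0 tt' FtS.
have -> : idW S s t' h' = fun w => idW S s t h' w + idW S t t' h' w.
  by apply/funext => w; rewrite /idW (dW_split ipP W s t t') mulrDr.
rewrite moment2C moment2D// moment2C moment2_idW_same//.
rewrite [X in _ + X](_ : _ = 0) ?addr0// moment2C.
have sX : sqint P (fun w => \1_S w * idW S s t h w).
  by apply: sqint_indicM => //; exact: (filtration_measurable FP s0).
rewrite -(moment2_adapted_dW ipP FP QP WP h' t0 tt' _ sX); last first.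
  apply: (adaptedM FP) => //; first exact: (adapted_indic FP).
  apply: (adaptedM FP) => //; [exact: (adapted_indic FP)|exact: adapted_dW].
by apply: eq_Rintegral => w _; rewrite /idW; ring.
Qed.

(** The first increment is cut at the start of the second one; its earlier
    part is known at that time, hence uncorrelated with the second increment. *)
Lemma moment2_idW_ordered S S' a b a' b' h h' : 0 <= a -> a <= b -> a' <= b' -> a <= a' ->
  F a S -> F a' S' ->
  moment2 P (idW S a b h) (idW S' a' b' h') =
  fine (P (S `&` S')) * (c * (Num.max 0 (Num.min b b' - Num.max a a') * ip (Q h) h')).
Proof.
move=> a0 ab a'b' aa' FS FS'; have a'0 := le_trans a0 aa'.
have [_ mon _ _] := FP; have Fa'S := mon _ _ a0 aa' _ FS.
have FSS' : F a' (S `&` S') by exact: (filtrationI FP).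
have mS := filtration_measurable FP a0 FS.
have mS' := filtration_measurable FP a'0 FS'.
have disj u : a <= u -> u <= a' -> moment2 P (idW S a u h) (idW S' a' b' h') = 0.
  move=> au ua'; have u0 := le_trans a0 au.
  have sX : sqint P (fun w => \1_S' w * idW S a u h w).
    by apply: sqint_indicM => //; exact: sqint_idW.
  rewrite -(moment2_adapted_dW ipP FP QP WP h' a'0 a'b' _ sX); last first.
    apply: (adaptedM FP) => //; first exact: (adapted_indic FP).
    apply: (adaptedM FP) => //; first exact: (adapted_indic FP).
    by apply: (adapted_mono FP u0 ua'); exact: adapted_dW.
  by apply: eq_Rintegral => w _; rewrite /idW; ring.
have [ba'|a'b] := leP b a'.
  rewrite disj// [Num.max a a']max_r//.
  rewrite [Num.max 0 _]max_l ?mul0r ?mulr0// subr_le0 ge_min.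
  by rewrite ba'.
have a'b_ := ltW a'b.
have -> : idW S a b h = fun w => idW S a a' h w + idW S a' b h w.
  by apply/funext => w; rewrite /idW (dW_split ipP W a a' b) mulrDr.
rewrite moment2D; [|exact: sqint_idW..].
rewrite disj// add0r.
have same u v k k' : moment2 P (idW S a' u k) (idW S' a' v k') =
    moment2 P (idW (S `&` S') a' u k) (idW (S `&` S') a' v k').
  apply: eq_Rintegral => w _; rewrite /idW indicI /=.
  have i2 (A : set Omega) : (\1_A w : R) * \1_A w = \1_A w.
    by rewrite indicE; case: (_ \in _); rewrite ?mulr1 ?mulr0.
  rewrite -[in LHS](i2 S) -[in LHS](i2 S'); ring.
rewrite same [Num.max a a']max_r//.
have [bb'|b'b] := leP b b'.
  rewrite moment2_idW_start// [Num.max 0 _]max_r// subr_ge0.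
  by rewrite ltW.
have [_ Qs _] := QP.
rewrite moment2C moment2_idW_start ?(ltW b'b)// [Num.max 0 _]max_r ?subr_ge0//.
by rewrite (Qs h' h) (ipC ipP h').
Qed.

Lemma moment2_idW S S' a b a' b' h h' : 0 <= a -> a <= b -> 0 <= a' -> a' <= b' ->
  F a S -> F a' S' ->
  moment2 P (idW S a b h) (idW S' a' b' h') =
  fine (P (S `&` S')) * (c * (Num.max 0 (Num.min b b' - Num.max a a') * ip (Q h) h')).
Proof.
move=> a0 ab a'0 a'b' FS FS'; have /orP[aa'|a'a] := le_total a a'; first exact: moment2_idW_ordered.
have [_ Qs _] := QP.
rewrite moment2C moment2_idW_ordered// setIC (minC b') (maxC a') (Qs h' h) (ipC ipP h').
by [].
Qed.

End ito_isometry.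

(** * Fatou's lemma and step functions *)

Section fatou_variants.
Local Open Scope ereal_scope.
Context d (T : measurableType d) (R : realType) (mu : {measure set T -> \bar R}).

Lemma limn_einf_le (u : nat -> \bar R) b : (\forall n \near \oo, u n <= b) -> limn_einf u <= b.
Proof.
move=> [N _ hN]; rewrite limn_einf_lim; apply: lime_le; first exact: is_cvg_einfs.
near=> n; apply: (@le_trans _ _ (u n)).
  by apply: ereal_inf_lbound; exists n => /=.
by apply: hN => /=; near: n; exact: nbhs_infty_ge.
Unshelve. all: by end_near. Qed.

Lemma fatou_le (f_ : nat -> T -> R) (f : T -> R) (B : \bar R) :
  (forall n, measurable_fun setT (f_ n)) -> (forall n x, 0 <= f_ n x)%R ->
  (forall x, (fun n => f_ n x) @ \oo --> f x) ->
  (forall delta : R, (0 < delta)%R ->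
    \forall n \near \oo, \int[mu]_x (f_ n x)%:E <= B + delta%:E) ->
  \int[mu]_x (f x)%:E <= B.
Proof.
move=> mf f0 cf hB.
apply: (@le_trans _ _ (limn_einf (fun n => \int[mu]_x (f_ n x)%:E))).
  rewrite (_ : \int[mu]_x (f x)%:E = \int[mu]_x limn_einf (fun n => (f_ n x)%:E)).
    apply: fatou => // n; first by apply/measurable_EFinP.
    by move=> x _; rewrite lee_fin.
  apply: eq_integral => x _.
  have /cvg_limn_einf_sup[-> _]// : (fun n => (f_ n x)%:E) @ \oo --> (f x)%:E.
  by apply: cvg_EFin; [exact: nearW|exact: cf].
case: B hB => [B| |] hB; last 2 first.
- by rewrite leey.
- have [N _ /(_ N (leqnn N))] := hB 1%R ltr01.
  rewrite leNgt lt_neqAle; case/negP; rewrite leNye andbT.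
  have : 0 <= \int[mu]_x (f_ N x)%:E by apply: integral_ge0 => x _; rewrite lee_fin.
  by apply: contraTneq => <-.
apply/lee_addgt0Pr => delta delta0.
exact: limn_einf_le (hB _ delta0).
Qed.

Lemma ae_fatou_le (f_ : nat -> T -> R) (f : T -> R) (B : \bar R) :
  measurable_fun setT f -> (forall x, 0 <= f x)%R ->
  (forall n, measurable_fun setT (f_ n)) -> (forall n x, 0 <= f_ n x)%R ->
  {ae mu, forall x, (fun n => f_ n x) @ \oo --> f x} ->
  (forall delta : R, (0 < delta)%R ->
    \forall n \near \oo, \int[mu]_x (f_ n x)%:E <= B + delta%:E) ->
  \int[mu]_x (f x)%:E <= B.
Proof.
move=> mf0 f00 mf f0 [N [mN N0 cN]] hB.
pose i : T -> R := \1_(~` N).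
have mi : measurable_fun setT i by apply: measurable_indic; exact: measurableC.
have i01 x : (0 <= i x <= 1)%R by rewrite /i indicE; case: (_ \in _); rewrite ?lexx ?ler01.
rewrite (_ : \int[mu]_x (f x)%:E = \int[mu]_x (f x * i x)%:E); last first.
  apply: ge0_ae_eq_integral => //.
  - by apply/measurable_EFinP.
  - by apply/measurable_EFinP; exact: measurable_funM.
  - by move=> x _; rewrite lee_fin.
  - by move=> x _; rewrite lee_fin mulr_ge0//; case/andP: (i01 x).
  exists N; split => // x /=; apply: contraPP => nN; apply/not_implyP => -[] _; apply.
  by rewrite /i indicE mem_set// mulr1.
apply: (@fatou_le (fun n x => f_ n x * i x)%R).
- by move=> n; exact: measurable_funM.
- by move=> n x; rewrite mulr_ge0//; case/andP: (i01 x).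
- move=> x; have [Nx|nNx] := pselect (N x).
    have -> : i x = 0%R by rewrite /i indicE memNset//= => /(_ Nx).
    by rewrite mulr0; under eq_fun do rewrite mulr0; exact: cvg_cst.
  apply: cvgMl; apply: contrapT => h; exact: (nNx (cN _ h)).
- move=> delta delta0; apply: filterS (hB _ delta0) => n; apply: le_trans.
  apply: le_lower_integral => x _; first by rewrite lee_fin mulr_ge0//; case/andP: (i01 x).
  by rewrite lee_fin ler_piMr//; case/andP: (i01 x).
Qed.

End fatou_variants.

Section overlap.
Context {R : realType}.
Local Notation leb := (@lebesgue_measure R).

Definition itv_ind (a b s : R) : R := (a < s <= b)%R%:R.

Definition overlap (a b a' b' : R) : R := Num.max 0 (Num.min b b' - Num.max a a').

Lemma itv_indE a b : itv_ind a b = \1_(`]a, b]%classic : set R).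
Proof.
apply/funext => s; rewrite indicE /itv_ind; congr (_%:R); congr nat_of_bool.
by apply/idP/idP => [h|/set_mem/=]; rewrite ?in_itv//; apply/mem_set; rewrite /= in_itv.
Qed.

Lemma sqint_itv_ind a b : sqint leb (itv_ind a b).
Proof.
rewrite itv_indE; split; first exact: measurable_indic.
under eq_integral => s _.
  rewrite (_ : (_ ^+ 2) = \1_(`]a, b]%classic : set R) s); first over.
  by rewrite indicE; case: (_ \in _); rewrite ?expr1n ?expr0n.
rewrite integral_indic//= setIT lebesgue_measure_itv/=.
by case: ifP => _; rewrite ?ltry// -EFinB ltry.
Qed.

Lemma moment2_itv_ind a b a' b' :
  moment2 leb (itv_ind a b) (itv_ind a' b') = overlap a b a' b'.
Proof.
rewrite /moment2 /Rintegral.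
under eq_integral => s _.
  rewrite (_ : itv_ind a b s * itv_ind a' b' s =
    itv_ind (Num.max a a') (Num.min b b') s); last first.
    rewrite /itv_ind -natrM mulnb gt_max le_min; congr (nat_of_bool _)%:R.
    by case: (a < s); case: (a' < s); case: (s <= b).
  rewrite itv_indE; over.
rewrite integral_indic//= setIT lebesgue_measure_itv/= lte_fin /overlap.
case: ltP => h; first by rewrite -EFinB/= [Num.max 0 _]max_r// subr_ge0 ltW.
by rewrite [Num.max 0 _]max_l// subr_le0.
Qed.

Context {dO : measure_display} {Omega : measurableType dO} (P : probability Omega R).

Lemma moment2_indic (S S' : set Omega) : measurable S -> measurable S' ->
  moment2 P \1_S \1_S' = fine (P (S `&` S')).
Proof.
move=> mS mS'; rewrite /moment2 /Rintegral; congr fine.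
under eq_integral do rewrite -[X in X%:E]/((\1_S \* \1_S') _) -indicI.
by rewrite integral_indic ?setIT//; exact: measurableI.
Qed.

Lemma sqint_indic (S : set Omega) : measurable S -> sqint P \1_S.
Proof.
move=> mS; split; first exact: measurable_indic.
apply: (@le_lt_trans _ _ (\int[P]_w 1%E)%E).
  apply: le_lower_integral => w _; first by rewrite lee_fin sqr_ge0.
  by rewrite lee_fin indicE; case: (_ \in _); rewrite ?expr1n ?expr0n.
rewrite (_ : (fun=> 1%E) = cst 1%E)// integral_cst// mul1e.
by rewrite (le_lt_trans (probability_le1 P _))// ltry.
Qed.

(** Replacing [x i * x j] by a covariance turns the double sum into the second
    moment of the stochastic integral of a step process. *)
Lemma integral_step_sqr n (a b x : 'I_n -> R) (S : 'I_n -> set Omega) t :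
  (forall i, 0 <= a i) -> (forall i, b i <= t) -> (forall i, measurable (S i)) ->
  (\int[P]_w \int[leb]_(s in `]0%R, t])
      ((\sum_(i < n) \1_(S i) w * itv_ind (a i) (b i) s * x i) ^+ 2)%:E =
  (\sum_(i < n) \sum_(j < n) fine (P (S i `&` S j)) *
     (overlap (a i) (b i) (a j) (b j) * (x i * x j)))%:E)%E.
Proof.
move=> a0 bt mS.
under eq_integral => w _.
  rewrite (_ : (\int[_]_(_ in _) _)%E = (\sum_(i < n) \sum_(j < n)
    (x i * x j * overlap (a i) (b i) (a j) (b j)) * (\1_(S i) w * \1_(S j) w))%:E).
    over.
  have sI i : sqint leb (fun s => \1_(S i) w * x i * itv_ind (a i) (b i) s).
    by apply: sqintZ; exact: sqint_itv_ind.
  rewrite integral_mkcond.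
  transitivity (\int[leb]_s ((\sum_(i < n) \1_(S i) w * x i * itv_ind (a i) (b i) s) ^+ 2)%:E)%E.
    apply: eq_integral => s _; rewrite /patch; case: ifPn => [_|sD].
      by congr ((_ ^+ 2)%:E); apply: eq_bigr => i _; rewrite mulrAC.
    rewrite big1 ?expr0n// => i _; rewrite /itv_ind.
    case: (boolP (a i < s <= b i)) => [/andP[as_ sb]|_]; last by rewrite mulr0.
    case/negP: sD; apply/mem_set; rewrite /= in_itv/= (le_lt_trans (a0 i) as_)/=.
    exact: le_trans sb (bt i).
  rewrite moment2E; last exact: sqint_sum.
  rewrite moment2_suml//; last exact: sqint_sum.
  congr (_%:E); apply: eq_bigr => i _; rewrite moment2_sumr//.
  apply: eq_bigr => j _; rewrite moment2Z//; last exact: sqint_itv_ind.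
  rewrite moment2C moment2Z//; [|exact: sqint_itv_ind..].
  by rewrite moment2C moment2_itv_ind; ring.
have sS i j : sqint P (fun w => x i * x j * overlap (a i) (b i) (a j) (b j) * \1_(S i) w).
  by apply: sqintZ; exact: sqint_indic.
have iS i j : P.-integrable setT (EFin \o (fun w => x i * x j * overlap (a i) (b i) (a j) (b j) *
    (\1_(S i) w * \1_(S j) w))).
  have := sqint_prod (sS i j) (sqint_indic (mS j)).
  by apply: eq_integrable => // w _ /=; rewrite !mulrA.
under eq_integral do rewrite -sumEFin.
rewrite (@integral_sum _ _ _ _ _ _ _ (fun i w => (\sum_(j < n) x i * x j *
  overlap (a i) (b i) (a j) (b j) * (\1_(S i) w * \1_(S j) w))%:E))//; last first.
  move=> i; under eq_fun do rewrite -sumEFin.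
  by apply: integrable_sum => // j _; exact: iS.
rewrite -sumEFin; apply: eq_bigr => i _.
under eq_integral do rewrite -sumEFin.
rewrite (@integral_sum _ _ _ _ _ _ _ (fun j w => (x i * x j *
  overlap (a i) (b i) (a j) (b j) * (\1_(S i) w * \1_(S j) w))%:E))//; last by move=> j; exact: iS.
rewrite -sumEFin; apply: eq_bigr => j _.
rewrite -(moment2_indic (mS i) (mS j)).
under eq_integral do rewrite mulrA.
rewrite -(@fineK _ (\int[P]_w _)%E); last first.
  by apply: integrable_fin_num => //; exact: (sqint_prod (sS i j) (sqint_indic (mS j))).
rewrite -/(Rintegral _ _ _) -/(moment2 P (fun w => x i * x j * overlap _ _ _ _ * \1_(S i) w) \1_(S j)).
by rewrite moment2Z//; [congr (_%:E); ring|exact: sqint_indic..].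
Qed.

End overlap.

(** * The Ito isometry *)

Section lower_integral_superadditive.
Local Open Scope ereal_scope.
Context d (T : measurableType d) (R : realType) (mu : {measure set T -> \bar R}).

Import HBNNSimple.

(** Simple functions below [f] and below [g] add up to one below [f + g]. The
    lower integral is what the isometry is about, because the distance between
    an integrand and its elementary approximations may fail to be measurable. *)
Lemma lower_integral_superD (D : set T) (f g : T -> \bar R) :
  (forall x, D x -> 0 <= f x) -> (forall x, D x -> 0 <= g x) ->
  \int[mu]_(x in D) f x + \int[mu]_(x in D) g x <= \int[mu]_(x in D) (f x + g x).
Proof.
move=> f0 g0; pose f' := f \_ D; pose g' := g \_ D.
have f0' x : 0 <= f' x by rewrite /f' /patch; case: ifPn => // /[!inE] /f0.
have g0' x : 0 <= g' x by rewrite /g' /patch; case: ifPn => // /[!inE] /g0.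
rewrite !(integral_mkcond D).
rewrite [X in _ <= X](_ : _ = \int[mu]_x (f' x + g' x)); last first.
  by apply: eq_integral => x _; rewrite /f' /g' /patch; case: ifPn => //; rewrite adde0.
rewrite -/f' -/g'.
set X := \int[mu]_x (f' x + g' x).
have [->|Xoo] := eqVneq X +oo; first by rewrite leey.
have X0 : 0 <= X by apply: integral_ge0 => x _; exact: adde_ge0.
have fin Y : 0 <= Y -> Y <= X -> Y \is a fin_num.
  by move=> Y0 YX; rewrite ge0_fin_numE// (le_lt_trans YX)// ltey.
have hX h : (forall x, 0 <= h x) -> (forall x, h x <= f' x + g' x) -> \int[mu]_x h x <= X.
  by move=> h0 hfg; exact: le_lower_integral.
have fg : \int[mu]_x g' x \is a fin_num.
  by apply: fin; [exact: integral_ge0|apply: hX => // x; rewrite leeDr].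
rewrite -leeBrDr//; apply: lower_integral_le => // h hf.
have h0 x : 0 <= (h x)%:E by rewrite lee_fin; exact: fun_ge0.
have fh : \int[mu]_x (h x)%:E \is a fin_num.
  apply: fin; [exact: integral_ge0|apply: hX => // x].
  by rewrite (le_trans (hf x))// leeDl.
rewrite leeBrDr// addeC -leeBrDr//; apply: lower_integral_le => // k kg.
have k0 x : 0 <= (k x)%:E by rewrite lee_fin; exact: fun_ge0.
rewrite leeBrDr// -ge0_integralD//; last 2 first.
- by apply/measurable_EFinP.
- by apply/measurable_EFinP.
by apply: hX => x; [exact: adde_ge0|rewrite addeC leeD].
Qed.

Lemma lower_integral_super_sum (D : set T) (f : nat -> T -> \bar R) n :
  (forall k x, D x -> 0 <= f k x) ->
  \sum_(k < n) \int[mu]_(x in D) f k x <= \int[mu]_(x in D) \sum_(k < n) f k x.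
Proof.
move=> f0; elim: n => [|n IH].
  by rewrite big_ord0; apply: integral_ge0 => x Dx; apply: sume_ge0 => k _; exact: f0.
rewrite big_ord_recr/=; under [leRHS]eq_integral do rewrite big_ord_recr/=.
apply: le_trans (lower_integral_superD _ _); last by move=> x; exact: f0.
  by rewrite leeD2r.
by move=> x Dx; apply: sume_ge0 => k _; exact: f0.
Qed.

End lower_integral_superadditive.

Section ito_isometry_functional.
Context {R : realType} {H : lmodType R} (ip : H -> H -> R).
Hypothesis ipP : semi_inner ip.
Context {dO : measure_display} {Omega : measurableType dO}.
Variables (P : probability Omega R) (F : R -> set (set Omega)).
Hypothesis FP : normal_filtration P F.
Variables (Q Qh : H -> H) (W : R -> Omega -> H).
Hypotheses (QP : psd_op ip Q) (QhP : is_sqrt_op ip Q Qh) (WP : Q_wiener ip P F Q W).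
Variable c : R.
Hypothesis c0 : 0 <= c.
Hypothesis cP : forall s t h, 0 <= s -> s <= t ->
  moment2 P (dW ip W s t h) (dW ip W s t h) = c * ((t - s) * ip (Q h) h).
Variable e : nat -> H.
Hypothesis eB : orthonormal_basis ip e.

Local Notation leb := (@lebesgue_measure R).
Local Notation sqint_idW := (sqint_idW ipP FP QP WP).

Lemma measurable_functional_dW s t phi : 0 <= s -> s <= t -> bfun ip phi ->
  measurable_fun setT (fun w => phi (W t w - W s w)).
Proof.
move=> s0 st bphi.
apply: (@measurable_fun_cvg _ _ _ _ (fun n w => dW ip W s t (rep e phi n) w)) => //.
  by move=> n; exact: (measurable_dW ipP FP WP).
move=> w _; rewrite /dW; under eq_fun do rewrite (ipC ipP).
exact: (ip_rep_cvg ipP eB bphi).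
Qed.

Section steps.
Variables (n : nat) (a b : 'I_n -> R) (S : 'I_n -> set Omega) (phi : 'I_n -> H -> R) (t : R).
Hypotheses (a0 : forall i, 0 <= a i) (ab : forall i, a i <= b i) (bt : forall i, b i <= t)
  (FS : forall i, F (a i) (S i)) (bphi : forall i, bfun ip (phi i)).

(** For functionals represented by vectors both sides are the same double sum
    of covariances. A functional that no vector represents is a pointwise
    limit of such ones, and the lemma of Fatou turns the equality into an
    inequality. *)
Lemma ito_isometry_functional :
  (\int[P]_w ((\sum_(i < n) \1_(S i) w * phi i (W (b i) w - W (a i) w)) ^+ 2)%:E <=
   c%:E * \int[P]_w \int[leb]_(s in `]0%R, t]) \sum_(0 <= k <oo)
     ((\sum_(i < n) \1_(S i) w * itv_ind (a i) (b i) s * phi i (Qh (e k))) ^+ 2)%:E)%E.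
Proof.
have mS i : measurable (S i) by exact: (filtration_measurable FP (a0 i)).
have mbp i : measurable_fun setT (fun w => phi i (W (b i) w - W (a i) w)).
  exact: measurable_functional_dW.
set B := (X in (_ <= X)%E).
pose p i j := fine (P (S i `&` S j)).
pose l i j := overlap (a i) (b i) (a j) (b j).
pose Z K w := \sum_(i < n) idW ip W (S i) (a i) (b i) (rep e (phi i) K) w.
pose g K := \sum_(i < n) \sum_(j < n) p i j * (c * (l i j * ip (Q (rep e (phi i) K)) (rep e (phi j) K))).
pose s K := \sum_(i < n) \sum_(j < n) p i j * (c * (l i j * \sum_(k < K) phi i (Qh (e k)) * phi j (Qh (e k)))).
have sI i K : sqint P (idW ip W (S i) (a i) (b i) (rep e (phi i) K)) by exact: sqint_idW.
have ZE K : (\int[P]_w (Z K w ^+ 2)%:E = (g K)%:E)%E.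
  rewrite moment2E; last by apply: sqint_sum => i.
  rewrite moment2_suml//; last by apply: sqint_sum => i.
  congr (_%:E); apply: eq_bigr => i _; rewrite moment2_sumr//.
  by apply: eq_bigr => j _; rewrite (moment2_idW ipP FP QP WP cP).
have sB K : ((s K)%:E <= B)%E.
  rewrite (_ : (s K)%:E = c%:E * \sum_(k < K) \int[P]_w \int[leb]_(s in `]0%R, t])
     ((\sum_(i < n) \1_(S i) w * itv_ind (a i) (b i) s * phi i (Qh (e k))) ^+ 2)%:E)%E.
    apply: lee_wpmul2l; first by rewrite lee_fin.
    pose q m w r := ((\sum_(i < n) \1_(S i) w * itv_ind (a i) (b i) r *
        phi i (Qh (e m))) ^+ 2)%:E.
    have q0 m w r : (0 <= q m w r)%E by rewrite lee_fin sqr_ge0.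
    apply: (le_trans (@lower_integral_super_sum _ _ _ P setT
      (fun k w => \int[leb]_(r in `]0%R, t]) q k w r)%E K _)).
      by move=> k w _; apply: integral_ge0 => r _; exact: q0.
    apply: le_lower_integral => w _.
      by apply: sume_ge0 => k _; apply: integral_ge0 => r _; exact: q0.
    apply: (le_trans (@lower_integral_super_sum _ _ _ leb _ (fun k => q k w) K _)).
      by move=> k r _; exact: q0.
    apply: le_lower_integral => r _; first by apply: sume_ge0 => k _; exact: q0.
    rewrite -(big_mkord xpredT (fun k => ((\sum_(i < n) \1_(S i) w *
      itv_ind (a i) (b i) r * phi i (Qh (e k))) ^+ 2)%:E)).
    by apply: nneseries_lim_ge => k _ _; exact: q0.
  under eq_bigr do rewrite (integral_step_sqr P _ a0 bt mS).
  rewrite sumEFin -EFinM; congr (_%:E); rewrite exchange_big/= mulr_sumr.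
  apply: eq_bigr => i _; rewrite exchange_big/= mulr_sumr; apply: eq_bigr => j _.
  rewrite -/(p i j) -/(l i j) -mulr_sumr -mulr_sumr.
  by rewrite mulrCA.
have gs : (fun K => g K - s K) @ \oo --> (0 : R).
  rewrite (_ : (fun K => _) = (fun K => \sum_(i < n) \sum_(j < n) (p i j * (c * l i j)) *
     (ip (Q (rep e (phi i) K)) (rep e (phi j) K) -
      \sum_(k < K) phi i (Qh (e k)) * phi j (Qh (e k))))); last first.
    apply/funext => K; rewrite -sumrB; apply: eq_bigr => i _.
    rewrite -sumrB; apply: eq_bigr => j _; ring.
  rewrite -[X in _ --> X](@big1 R 0 +%R _ (index_enum 'I_n) xpredT (fun=> 0))//.
  apply: cvg_big => [|i _]; first exact: add_continuous.
  rewrite -[X in _ --> X](@big1 R 0 +%R _ (index_enum 'I_n) xpredT (fun=> 0))//.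
  apply: cvg_big => [|j _]; first exact: add_continuous.
  rewrite -[X in _ --> X](mulr0 (p i j * (c * l i j))); apply: cvgMr.
  exact: (covariance_rep_cvg ipP eB QhP).
apply: (@fatou_le _ _ _ _ (fun K w => Z K w ^+ 2)).
- move=> K; apply: measurable_funX; apply: measurable_sum => i.
  by have [] := sI i K.
- by move=> K w; exact: sqr_ge0.
- move=> w; rewrite !expr2; under eq_fun do rewrite expr2.
  suff h : Z ^~ w @ \oo --> \sum_(i < n) \1_(S i) w * phi i (W (b i) w - W (a i) w).
    exact: cvgM.
  apply: cvg_big => [|i _]; first exact: add_continuous.
  apply: cvgMr; rewrite /dW; under eq_fun do rewrite (ipC ipP).
  exact: (ip_rep_cvg ipP eB (bphi i)).
- move=> delta delta0; have /cvgr0Pnorm_le/(_ _ delta0) := gs.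
  apply: filterS => K hK; rewrite ZE.
  rewrite (_ : g K = s K + (g K - s K)); last by ring.
  by rewrite EFinD leeD// lee_fin (le_trans (ler_norm _)).
Qed.

End steps.

End ito_isometry_functional.

(** * Riemann sums for the stochastic convolution *)

Section ito_integral.
Context {R : realType} {H : lmodType R} (ip : H -> H -> R).
Hypothesis ipP : semi_inner ip.
Context {dO : measure_display} {Omega : measurableType dO}.
Variables (P : probability Omega R) (F : R -> set (set Omega)).
Hypothesis FP : normal_filtration P F.
Variables (Q Qh : H -> H) (W : R -> Omega -> H).
Hypotheses (QP : psd_op ip Q) (QhP : is_sqrt_op ip Q Qh) (WP : Q_wiener ip P F Q W).
Variable c : R.
Hypothesis c0 : 0 <= c.
Hypothesis cP : forall s t h, 0 <= s -> s <= t ->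
  moment2 P (dW ip W s t h) (dW ip W s t h) = c * ((t - s) * ip (Q h) h).
Variable e : nat -> H.
Hypothesis eB : orthonormal_basis ip e.

Local Notation leb := (@lebesgue_measure R).
Local Notation hnorm := (hnorm ip).

Section elementary.
Variables (Phi : seq (@step R H _ Omega)) (t : R) (g : H).
Hypothesis t0 : 0 <= t.
Hypothesis PhiP : all (fun x => `[< step_valid ip F x >]) Phi.

Let n := size Phi.
Let x i := tnth (in_tuple Phi) i.
Let a i := Num.min (step_a (x i)) t.
Let b i := Num.min (step_b (x i)) t.
(* a step starting after time t contributes nothing; its event is emptied so
   that it belongs to the filtration at the truncated starting time *)
Let S i := if step_a (x i) <= t then step_set (x i) else set0.
Let phi i v := ip (step_op (x i) v) g.

Let xP i : step_valid ip F (x i).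
Proof.
have /(all_nthP (x i))/(_ i (ltn_ord i)) /asboolP := PhiP.
by rewrite {2}/x (tnth_nth (x i)).
Qed.

Let a0 i : 0 <= a i. Proof. by rewrite le_min t0 andbT; case: (xP i). Qed.

Let ab i : a i <= b i.
Proof. by have [_ h _ _] := xP i; rewrite /a /b le_min2. Qed.

Let bt i : b i <= t. Proof. by rewrite ge_min lexx orbT. Qed.

Let FS i : F (a i) (S i).
Proof.
rewrite /S /a; case: ifPn => h; first by rewrite min_l//; case: (xP i).
rewrite min_r ?ltW// ?ltNge//.
by have [/(_ t t0)[[F0 _ _] _] _ _ _] := FP.
Qed.

Let bphi i : bfun ip (phi i).
Proof. by have [_ _ _ bL] := xP i; exact: bfun_bounded_op. Qed.

Let elementary_intE w : ip (elementary_int Phi W t w) g =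
  \sum_(i < n) \1_(S i) w * phi i (W (b i) w - W (a i) w).
Proof.
rewrite /elementary_int big_tnth (ip_suml ipP); apply: eq_bigr => i _.
rewrite (ipZl ipP) -/(x i) -/(a i) -/(b i) -/(phi i _) /S; case: ifPn => //.
rewrite -ltNge => ta; have tb : t < step_b (x i).
  by apply: lt_le_trans ta _; case: (xP i).
by rewrite /a /b !min_r ?ltW// subrr (bfun0 (bphi i)) !mulr0.
Qed.

Let elementaryE s w v : 0 < s <= t -> ip (elementary Phi s w v) g =
  \sum_(i < n) \1_(S i) w * itv_ind (a i) (b i) s * phi i v.
Proof.
move=> /andP[s0 st]; rewrite /elementary big_tnth (ip_suml ipP).
apply: eq_bigr => i _; rewrite (ipZl ipP) -/(x i) -/(phi i _) /S /itv_ind /a /b.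
congr (_ * _); rewrite gt_min le_min st andbT.
rewrite [t < s]ltNge st/= orbF; case: ifPn => //; rewrite -ltNge => ta.
by rewrite ltNge (le_trans st (ltW ta))/= !mulr0.
Qed.

Lemma measurable_elementary_int : measurable_fun setT (fun w => ip (elementary_int Phi W t w) g).
Proof.
under eq_fun do rewrite elementary_intE.
apply: measurable_sum => i; apply: measurable_funM.
  by apply: measurable_indic; exact: (filtration_measurable FP (a0 i)).
exact: (measurable_functional_dW ipP FP WP eB).
Qed.

Lemma ito_isometry_elementary :
  (\int[P]_w (ip (elementary_int Phi W t w) g ^+ 2)%:E <=
   c%:E * \int[P]_w \int[leb]_(s in `]0%R, t]) \sum_(0 <= k <oo)
     (ip (elementary Phi s w (Qh (e k))) g ^+ 2)%:E)%E.
Proof.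
under eq_integral do rewrite elementary_intE.
apply: (le_trans (ito_isometry_functional ipP FP QP QhP WP c0 cP eB a0 ab bt FS bphi)).
apply: lee_wpmul2l; first by rewrite lee_fin.
have sq0 (y : nat -> R) : (0 <= \sum_(0 <= k <oo) (y k ^+ 2)%:E)%E.
  by apply: nneseries_ge0 => k _ _; rewrite lee_fin sqr_ge0.
apply: le_lower_integral => w _; first exact: integral_ge0.
apply: le_lower_integral => s /=; rewrite in_itv/= => st //.
by apply: lee_nneseries => k _ *; rewrite ?elementaryE// lee_fin sqr_ge0.
Qed.

End elementary.

Variables (A : H -> H -> Prop) (lambda : nat -> R).
Hypothesis eP : eigenbasis ip A e lambda.
Variable E : R -> H -> H.
Variable j : nat.
Hypothesis Ecoord : forall t v, 0 <= t ->
  ip (E t v) (e j) = expR (- lambda j * t) * ip v (e j).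

Section approximation.
Variables (t : R) (I : Omega -> H).
Hypothesis t0 : 0 <= t.
Hypothesis IP : is_ito_integral ip P F e Qh W (fun s _ => E (t - s)) t I.
Variables (m : nat) (tau gamma : nat -> R) (eta : R).
Hypotheses (tau0 : tau 0%N = 0) (taut : tau m = t).
Hypothesis tau_nd : {homo tau : i k / (i <= k)%N >-> i <= k}.
Hypothesis eta0 : 0 <= eta.
Hypothesis etaP : forall i s, (i < m)%N -> tau i < s <= tau i.+1 ->
  `|expR (- lambda j * (t - s)) - gamma i| <= eta.

Local Notation q := (ip (Q (e j)) (e j)).

(** The integral against the [j]-th coordinate of [W] of the step function
    with value [gamma i] between [tau i] and [tau i.+1]. *)
Definition riemann_sum w := \sum_(i < m) gamma i * dW ip W (tau i) (tau i.+1) (e j) w.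

Let tau_ge0 i : 0 <= tau i. Proof. by rewrite -tau0 tau_nd. Qed.

(** The step process whose integral has minus the Riemann sum as its [j]-th
    coordinate. Appended to a list of steps, it subtracts the Riemann sum from
    the integral of that list. *)
Let Theta : seq (@step R H _ Omega) := [seq Step (tau i) (tau i.+1) [set: Omega]
  (fun v => (- gamma i * ip v (e j)) *: e j) | i <- iota 0 m].

Let ThetaP : all (fun x => `[< step_valid ip F x >]) Theta.
Proof.
rewrite all_map; apply/allP => i _ /=; apply/asboolP; split => /=.
- exact: tau_ge0.
- exact: tau_nd.
- have [/(_ _ (tau_ge0 i))[sF _] _ _ _] := FP.
  by rewrite -(setD0 setT); have [F0 FC _] := sF; exact: FC.
split => [x u v|].
  rewrite (_ : (- gamma i * ip (x *: u + v) (e j)) *: e j =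
    x *: ((- gamma i * ip u (e j)) *: e j) + (- gamma i * ip v (e j)) *: e j).
    exact: heq_refl.
  by rewrite scalerA -scalerDl (ipDl ipP) (ipZl ipP); congr (_ *: _); ring.
exists `|gamma i| => u; rewrite (hnormZ ipP) (hnorm_e eP) mulr1 normrM normrN.
by rewrite ler_wpM2l// (le_trans (cauchy_schwarz ipP _ _))// (hnorm_e eP) mulr1.
Qed.

Let Theta_int w : ip (elementary_int Theta W t w) (e j) = - riemann_sum w.
Proof.
rewrite /elementary_int big_map (ip_suml ipP) /riemann_sum.
rewrite -[m in LHS]subn0 -/(index_iota 0 m) big_mkord -sumrN; apply: eq_bigr => i _ /=.
rewrite indicT scale1r (ipZl ipP) (ip_e eP) eqxx mulr1 mulNr /dW.
by rewrite !min_l// -taut tau_nd// ltnW.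
Qed.

Let Theta_elementary s w v : 0 < s <= t -> exists2 i, (i < m)%N /\ tau i < s <= tau i.+1 &
  ip (elementary Theta s w v) (e j) = - gamma i * ip v (e j).
Proof.
move=> /andP[s0 st].
have m0 : (0 < m)%N.
  rewrite lt0n; apply/eqP => m0; have t00 : t = 0 by rewrite -taut m0 tau0.
  by move: s0; rewrite ltNge (le_trans st)// t00.
have ex : exists i, s <= tau i.+1 by exists m.-1; rewrite prednK// taut.
case: (ex_minnP ex) => i si imin; exists i.
  have im : (i < m)%N by rewrite -(prednK m0) ltnS imin// prednK// taut.
  split => //; rewrite si andbT; case: i si imin im => [_ _ _|i _ imin _]; first by rewrite tau0.
  by rewrite ltNge; apply/negP => /imin; rewrite ltnn.
have im : (i < m)%N by rewrite -(prednK m0) ltnS imin// prednK// taut.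
rewrite /elementary big_map (ip_suml ipP).
rewrite -[m in LHS]subn0 -/(index_iota 0 m) big_mkord (bigD1 (Ordinal im))//= big1 ?addr0.
  have -> : tau i < s <= tau i.+1.
    rewrite si andbT; case: i si imin im => [_ _ _|i _ imin _]; first by rewrite tau0.
    by rewrite ltNge; apply/negP => /imin; rewrite ltnn.
  by rewrite indicT mulr1 scale1r (ipZl ipP) (ip_e eP) eqxx mulr1.
move=> k; rewrite -(inj_eq val_inj)/= => ki.
have [h|_] := boolP (tau k < s <= tau k.+1); last first.
  by rewrite mulr0 scale0r (ip0l ipP).
case/andP: h => ks sk.
have ik : (i < k)%N by rewrite ltn_neqAle eq_sym ki imin.
by move: ks; rewrite ltNge (le_trans si)// tau_nd.
Qed.

Lemma measurable_ito_coord : measurable_fun setT (fun w => ip (I w) (e j)).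
Proof.
move=> _ B mB; rewrite setTI; have [sub _] := IP; apply: sub.
by apply: sub_sigma_algebra; exists (e j), B.
Qed.

Lemma measurable_riemann_sum : measurable_fun setT riemann_sum.
Proof.
apply: measurable_sum => i; apply: measurable_funM => //.
by apply: (measurable_dW ipP FP WP); [exact: tau_ge0|exact: tau_nd].
Qed.

Let sqrD_le (x y : R) : (x + y) ^+ 2 <= 2 * x ^+ 2 + 2 * y ^+ 2.
Proof. have := sqr_ge0 (x - y); rewrite sqrrB sqrrD; lra. Qed.

Lemma series_q : (\sum_(0 <= k <oo) (ip (Qh (e k)) (e j) ^+ 2)%:E = q%:E)%E.
Proof.
apply/cvg_lim => //; under eq_fun do rewrite big_mkord sumEFin.
by apply: cvg_EFin; [exact: nearW|exact: (sqrt_op_parseval ipP eB QhP)].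
Qed.

Lemma q_ge0 : 0 <= q. Proof. by case: QP. Qed.

(** The elementary processes that define the integral, minus the step process
    of the Riemann sum, are elementary. The isometry bounds their integrals by
    the distance to the convolution kernel, which tends to zero, plus the
    error [eta] of the step approximation of the kernel in the [j]-th mode. *)
Lemma stochastic_convolution_approx :
  (\int[P]_w ((ip (I w) (e j) - riemann_sum w) ^+ 2)%:E <=
   (4 * c * t * eta ^+ 2 * q)%:E)%E.
Proof.
have [_ [Phi [Phiv hs0 ms0]]] := IP.
pose hs n := (\int[P]_w \int[leb]_(s in `[0%R, t])
  hs_norm2 ip e (fun v => [set (elementary (Phi n) s w (Qh v) - E (t - s) (Qh v))%R]))%E.
pose ms n := (\int[P]_w (hnorm (elementary_int (Phi n) W t w - I w) ^+ 2)%:E)%E.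
have hs_ge0 s w n : (0 <= hs_norm2 ip e (fun v => [set (elementary (Phi n) s w (Qh v) -
    E (t - s) (Qh v))%R]))%E.
  apply: nneseries_ge0 => k _ _; apply: le_ereal_inf_tmp => _ [u _ <-].
  by rewrite lee_fin sqr_ge0.
have pt n s w : 0 < s <= t -> (\sum_(0 <= k <oo)
    (ip (elementary (Phi n ++ Theta) s w (Qh (e k))) (e j) ^+ 2)%:E <=
    2%:E * hs_norm2 ip e (fun v => [set (elementary (Phi n) s w (Qh v) - E (t - s) (Qh v))%R])
    + (2 * eta ^+ 2 * q)%:E)%E.
  move=> st; rewrite -nneseriesZl; last first.
    by move=> k _; apply: le_ereal_inf_tmp => _ [u _ <-]; rewrite lee_fin sqr_ge0.
  rewrite EFinM -series_q -nneseriesZl; last by move=> k _; rewrite lee_fin sqr_ge0.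
  rewrite -nneseriesD; last 2 first.
  - move=> k _ _; apply: mule_ge0 => //; apply: le_ereal_inf_tmp => _ [u _ <-].
    by rewrite lee_fin sqr_ge0.
  - move=> k _ _; rewrite -EFinM lee_fin; apply: mulr_ge0; last exact: sqr_ge0.
    by rewrite mulr_ge0 ?sqr_ge0.
  apply: lee_nneseries => [k _ _|k _]; first by rewrite lee_fin sqr_ge0.
  rewrite image_set1 ereal_inf1 -!EFinM -EFinD lee_fin.
  have [i [im si] thE] := Theta_elementary w (Qh (e k)) st.
  rewrite /elementary big_cat (ipDl ipP) -/(elementary (Phi n) s w _) -/(elementary Theta s w _).
  rewrite thE; set u := elementary _ _ _ _.
  have st' : 0 <= t - s by rewrite subr_ge0; case/andP: st.
  rewrite (_ : ip u (e j) + - gamma i * ip (Qh (e k)) (e j) =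
     ip (u - E (t - s) (Qh (e k))) (e j) +
     (expR (- lambda j * (t - s)) - gamma i) * ip (Qh (e k)) (e j)); last first.
    by rewrite (ipBl ipP) Ecoord//; ring.
  apply: (le_trans (sqrD_le _ _)); apply: lerD.
    rewrite ler_wpM2l// -(real_normK (num_real (ip _ _))) lerXn2r ?nnegrE ?hnorm_ge0//.
    by rewrite (le_trans (cauchy_schwarz ipP _ _))// (hnorm_e eP) mulr1.
  rewrite exprMn mulrA; apply: ler_wpM2r; first exact: sqr_ge0.
  apply: ler_wpM2l => //.
  rewrite -(real_normK (num_real (expR _ - _))) lerXn2r ?nnegrE//.
  exact: etaP.
pose C := 2 * eta ^+ 2 * q * t.
have eqt0 : 0 <= 2 * eta ^+ 2 * q.
  by apply: mulr_ge0; [rewrite mulr_ge0 ?sqr_ge0|exact: q_ge0].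
have C0 : 0 <= C by rewrite mulr_ge0.
have zn n : (\int[P]_w ((ip (elementary_int (Phi n) W t w) (e j) - riemann_sum w) ^+ 2)%:E <=
    c%:E * (2%:E * hs n + C%:E))%E.
  have := @ito_isometry_elementary (Phi n ++ Theta) t (e j) t0.
  rewrite all_cat Phiv ThetaP => /(_ isT).
  rewrite (_ : (\int[P]_w _)%E = (\int[P]_w ((ip (elementary_int (Phi n) W t w) (e j) -
    riemann_sum w) ^+ 2)%:E)%E); last first.
    apply: eq_integral => w _; rewrite /elementary_int big_cat (ipDl ipP).
    by rewrite -/(elementary_int Theta W t w) Theta_int.
  move=> /le_trans; apply; rewrite lee_wpmul2l ?lee_fin//.
  pose hw w := (\int[leb]_(s in `[0%R, t]) hs_norm2 ip e (fun v =>
      [set (elementary (Phi n) s w (Qh v) - E (t - s) (Qh v))%R]))%E.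
  have hw0 w : (0 <= hw w)%E by apply: integral_ge0.
  apply: (@le_trans _ _ (\int[P]_w (2%:E * hw w + C%:E))%E); last first.
    apply: (le_trans (@lower_integralD _ _ _ P setT (fun w => 2%:E * hw w)%E (cst C%:E)
      measurableT _ _ _)) => //.
    - by move=> w _; rewrite mule_ge0.
    - apply: leeD; first exact: lower_integralZ.
      rewrite (_ : (fun=> C%:E) = cst C%:E)// integral_cst//.
      by rewrite -[leRHS]mule1 lee_wpmul2l ?lee_fin// probability_le1.
  apply: le_lower_integral => w _.
    by apply: integral_ge0 => s _; apply: nneseries_ge0 => k _ _; rewrite lee_fin sqr_ge0.
  apply: (@le_trans _ _ (\int[leb]_(s in `]0%R, t])
    (2%:E * hs_norm2 ip e (fun v => [set (elementary (Phi n) s w (Qh v) -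
       E (t - s) (Qh v))%R]) + (2 * eta ^+ 2 * q)%:E))%E).
    apply: le_lower_integral => s; rewrite /= in_itv/= => st.
      by apply: nneseries_ge0 => k _ _; rewrite lee_fin sqr_ge0.
    exact: pt.
  apply: (le_trans (@lower_integralD _ _ _ leb `]0%R, t]%classic _ (cst (2 * eta ^+ 2 * q)%:E)
      _ _ _ _)) => //.
  - by move=> s _; rewrite mule_ge0.
  apply: leeD; last first.
    rewrite (_ : (fun=> (2 * eta ^+ 2 * q)%:E) = cst (2 * eta ^+ 2 * q)%:E)// integral_cst//=.
    rewrite lebesgue_measure_itv/= /C [leRHS]EFinM; case: ifPn => _.
      by rewrite -EFinB subr0.
    by rewrite mule0 mule_ge0 ?lee_fin.
  apply: (le_trans (@lower_integralZ _ _ _ leb `]0%R, t]%classic _ 2 _ _)) => //.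
  rewrite lee_wpmul2l// /hw [leLHS]integral_mkcond [leRHS]integral_mkcond.
  apply: le_lower_integral => s _.
    by rewrite /patch; case: ifP.
  rewrite /patch; case: ifPn => [/set_mem/=|_]; last by case: ifP.
  by rewrite in_itv/= => /andP[s0 st]; rewrite mem_set//= in_itv/= (ltW s0).
have key n : (\int[P]_w ((ip (I w) (e j) - riemann_sum w) ^+ 2)%:E <=
    2%:E * ms n + 2%:E * (c%:E * (2%:E * hs n + C%:E)))%E.
  pose z w := ip (elementary_int (Phi n) W t w) (e j) - riemann_sum w.
  apply: (@le_trans _ _ (\int[P]_w (2%:E * (hnorm (elementary_int (Phi n) W t w - I w) ^+ 2)%:E
     + 2%:E * (z w ^+ 2)%:E))%E).
    apply: le_lower_integral => w _; first by rewrite lee_fin sqr_ge0.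
    rewrite -!EFinM -EFinD lee_fin.
    rewrite (_ : ip (I w) (e j) - riemann_sum w =
       - ip (elementary_int (Phi n) W t w - I w) (e j) + z w); last first.
      by rewrite /z (ipBl ipP); ring.
    apply: (le_trans (sqrD_le _ _)); rewrite lerD2r ler_wpM2l// sqrrN.
    rewrite -(real_normK (num_real (ip _ _))) lerXn2r ?nnegrE ?hnorm_ge0//.
    by rewrite (le_trans (cauchy_schwarz ipP _ _))// (hnorm_e eP) mulr1.
  apply: (le_trans (@lower_integralD _ _ _ P setT _ (fun w => 2%:E * (z w ^+ 2)%:E)%E
      measurableT _ _ _)).
  - by move=> w _; rewrite -EFinM lee_fin; apply: mulr_ge0 => //; exact: sqr_ge0.
  - by move=> w _; rewrite -EFinM lee_fin; apply: mulr_ge0 => //; exact: sqr_ge0.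
  - under eq_fun do rewrite -EFinM; apply/measurable_EFinP; apply: measurable_funM => //.
    apply: measurable_funX; apply: measurable_funB; last exact: measurable_riemann_sum.
    exact: (measurable_elementary_int _ t0 (Phiv n)).
  apply: leeD.
    by apply: lower_integralZ => // w _; rewrite lee_fin sqr_ge0.
  apply: (le_trans (@lower_integralZ _ _ _ P setT (fun w => (z w ^+ 2)%:E) 2 _ _)) => //.
    by move=> w _; rewrite lee_fin sqr_ge0.
  by apply: lee_wpmul2l => //; exact: zn.
apply/lee_addgt0Pr => delta delta0.
pose d1 := delta / (2 + 4 * c).
have c4 : 0 < 2 + 4 * c by rewrite ltr_wpDr// mulr_ge0.
have d10 : 0 < d1 by rewrite divr_gt0.
have ev (u : nat -> \bar R) : u @ \oo --> 0%E -> \forall n \near \oo, (u n <= d1%:E)%E.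
  move=> /fine_cvgP[fu /cvgr0Pnorm_le/(_ _ d10) hu].
  apply: filterS2 fu hu => n fun_ /= hun.
  by rewrite -(fineK fun_) lee_fin (le_trans (ler_norm _)).
have [n [/= hn mn]] : exists n, (hs n <= d1%:E)%E /\ (ms n <= d1%:E)%E.
  by have [n _ /(_ n (leqnn n))] := filterI (ev hs hs0) (ev ms ms0); exists n.
apply: (le_trans (key n)).
apply: (@le_trans _ _ (2%:E * d1%:E + 2%:E * (c%:E * (2%:E * d1%:E + C%:E)))%E).
  apply: leeD; first by rewrite lee_wpmul2l.
  rewrite lee_wpmul2l// lee_wpmul2l ?lee_fin// leeD2r//.
  by rewrite lee_wpmul2l.
rewrite -!EFinM -!EFinD -?EFinM -?EFinD -?EFinM -?EFinD lee_fin /C le_eqVlt; apply/orP; left; apply/eqP.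
rewrite /d1; field; exact: lt0r_neq0.
Qed.

End approximation.
End ito_integral.

(** * Sub-Gaussian variables *)

Section subgaussian.
Context d (T : measurableType d) (R : realType) (P : probability T R).
Implicit Types X Y : T -> R.

Definition subgaussian X v := forall theta : R,
  (\int[P]_w (expR (theta * X w))%:E <= (expR (theta ^+ 2 * v / 2))%:E)%E.

Let measurable_expM theta X : measurable_fun setT X ->
  measurable_fun setT (fun w => expR (theta * X w)).
Proof. by move=> mX; apply: measurableT_comp => //; exact: measurable_funM. Qed.

Lemma subgaussian_le X v v' : v <= v' -> subgaussian X v -> subgaussian X v'.
Proof.
move=> vv' sX theta; apply: (le_trans (sX theta)).
by rewrite lee_fin ler_expR ler_wpM2r// ler_wpM2l// sqr_ge0.
Qed.

(** Exponential moments of independent variables multiply. *)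
Lemma subgaussian_indepD X Y a v v' : measurable_fun setT X -> measurable_fun setT Y ->
  indep_rv P X Y -> subgaussian X v -> subgaussian Y v' ->
  subgaussian (fun w => X w + a * Y w) (v + a ^+ 2 * v').
Proof.
move=> mX mY XY sX sY theta.
have mexp (b : R) : measurable_fun [set: R] (fun x : R => expR (b * x)).
  by apply: measurableT_comp => //; exact: measurable_funM.
have -> : (\int[P]_w (expR (theta * (X w + a * Y w)))%:E =
    \int[P]_w (expR (theta * X w))%:E * \int[P]_w (expR (theta * a * Y w))%:E)%E.
  have := ge0_expectationM mX mY XY (mexp theta) (mexp (theta * a))
    (fun=> expR_ge0 _) (fun=> expR_ge0 _).
  move=> /= <-; apply: eq_integral => w _.
  by rewrite mulrDr expRD mulrA.
rewrite mulrDr mulrDl expRD EFinM; apply: lee_pmul.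
- by apply: integral_ge0 => w _; rewrite lee_fin expR_ge0.
- by apply: integral_ge0 => w _; rewrite lee_fin expR_ge0.
- exact: sX.
- by rewrite mulrA -exprMn; exact: sY.
Qed.

(** The squared errors have a summable sum of expectations, so they are almost
    surely summable. *)
Lemma l2_cvg_ae X (X_ : nat -> T -> R) D : measurable_fun setT X ->
  (forall n, measurable_fun setT (X_ n)) ->
  (forall n, (\int[P]_w ((X w - X_ n w) ^+ 2)%:E <= (D * 2^-1 ^+ n)%:E)%E) ->
  {ae P, forall w, (fun n => X_ n w) @ \oo --> X w}.
Proof.
move=> mX mX_ hX.
have msq n : measurable_fun setT (fun w => ((X w - X_ n w) ^+ 2)%:E).
  by apply/measurable_EFinP; apply: measurable_funX; exact: measurable_funB.
have sq0 n w : (0 <= ((X w - X_ n w) ^+ 2)%:E)%E by rewrite lee_fin sqr_ge0.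
have D0 : 0 <= D.
  rewrite -lee_fin -[D]mulr1 -(expr0 2^-1); apply: le_trans (hX 0%N).
  exact: integral_ge0.
have fin : (\int[P]_w \sum_(0 <= n <oo) ((X w - X_ n w) ^+ 2)%:E < +oo)%E.
  rewrite integral_nneseries//.
  apply: (@le_lt_trans _ _ (D * 2)%:E); last exact: ltry.
  apply: lime_le; first by apply: is_cvg_nneseries => n _ _; exact: integral_ge0.
  apply: nearW => n; rewrite big_mkord.
  apply: (@le_trans _ _ (\sum_(k < n) (D * 2^-1 ^+ k)%:E)%E); first exact: lee_sum.
  rewrite sumEFin lee_fin -mulr_sumr ler_wpM2l//.
  rewrite (_ : \sum_(i < n) 2^-1 ^+ i = 2 * (1 - 2^-1 ^+ n)).
    by rewrite ler_piMr// lerBlDr lerDl exprn_ge0.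
  elim: n => [|n IH]; first by rewrite big_ord0 expr0 subrr mulr0.
  by rewrite big_ord_recr/= IH exprS; field.
have ig : P.-integrable setT (fun w => \sum_(0 <= n <oo) ((X w - X_ n w) ^+ 2)%:E)%E.
  apply/integrableP; split; first exact: ge0_emeasurable_sum.
  by under eq_integral do rewrite gee0_abs ?nneseries_ge0//.
apply: filterS (integrable_ae measurableT ig) => w /(_ Logic.I) hw.
have h := hw; rewrite ge0_fin_numE in h; last exact: nneseries_ge0.
have := cvg_series_cvg_0 (nnseries_is_cvg (fun n => sqr_ge0 (X w - X_ n w)) h).
move=> /cvgrPdist_lt c0; apply/cvgrPdist_lt => eps eps0.
have e2 : 0 < eps ^+ 2 by rewrite exprn_gt0.
apply: filterS (c0 _ e2) => n; rewrite sub0r normrN ger0_norm ?sqr_ge0//.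
by rewrite -(real_normK (num_real (X w - _))) ltr_pXn2r ?nnegrE ?(ltW eps0).
Qed.

(** A geometric rate in mean square gives almost sure convergence, and the
    lemma of Fatou passes the exponential moments to the limit. *)
Lemma subgaussian_l2_cvg X (X_ : nat -> T -> R) D v : measurable_fun setT X ->
  (forall n, measurable_fun setT (X_ n)) ->
  (forall n, (\int[P]_w ((X w - X_ n w) ^+ 2)%:E <= (D * 2^-1 ^+ n)%:E)%E) ->
  (forall n, subgaussian (X_ n) v) -> subgaussian X v.
Proof.
move=> mX mX_ hX sX theta.
apply: (@ae_fatou_le _ _ _ P (fun n w => expR (theta * X_ n w))).
- exact: measurable_expM.
- by move=> w; exact: expR_ge0.
- by move=> n; exact: measurable_expM.
- by move=> n w; exact: expR_ge0.
- apply: filterS (l2_cvg_ae mX mX_ hX) => w cw.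
  have cm : (fun n => theta * X_ n w) @ \oo --> theta * X w by exact: cvgMr.
  exact: (cvg_comp _ _ cm (@continuous_expR R (theta * X w))).
- move=> delta delta0; apply: nearW => n; apply: (le_trans (sX n theta)).
  by rewrite -EFinD lee_fin lerDl ltW.
Qed.

Lemma powR_le_expR (p x : R) : 0 < p -> `|x| `^ p <= p `^ p * (expR x + expR (- x)).
Proof.
move=> p0.
have h : `|x| / p <= expR (`|x| / p).
  by rewrite (le_trans _ (expR_ge1Dx _))// lerDr.
have {}h : `|x| `^ p <= p `^ p * expR `|x|.
  rewrite -[X in X `^ _ <= _](divfK (lt0r_neq0 p0)) mulrC powRM ?(ltW p0)//; last first.
    by rewrite divr_ge0 ?(ltW p0).
  rewrite ler_wpM2l ?powR_ge0//.
  rewrite -[X in _ <= expR X](divfK (lt0r_neq0 p0)) expRM.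
  by rewrite ge0_ler_powR ?nnegrE ?divr_ge0 ?expR_ge0 ?(ltW p0).
apply: (le_trans h); rewrite ler_wpM2l ?powR_ge0//.
have [x0|x0] := leP 0 x; first by rewrite ger0_norm// lerDl expR_ge0.
by rewrite ltr0_norm// lerDr expR_ge0.
Qed.

Definition gauss_cst (p : R) := (p `^ p * (2 * expR 2^-1)) `^ p^-1.

Definition Lp_le (p : R) X (C : R) := (\int[P]_w (`|X w| `^ p)%:E <= (C `^ p)%:E)%E.

(** The power is dominated by exponentials of [X / Num.sqrt v]. When [v]
    vanishes the bound is the limit of those for positive variances. *)
Lemma subgaussian_Lp p X v : 0 < p -> measurable_fun setT X -> 0 <= v -> subgaussian X v ->
  Lp_le p X (gauss_cst p * Num.sqrt v).
Proof.
move=> p0 mX v0 sX; rewrite /Lp_le.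
set K := p `^ p * (2 * expR 2^-1).
have K0 : 0 < K by rewrite mulr_gt0 ?powR_gt0// mulr_gt0// expR_gt0.
have gK : gauss_cst p `^ p = K.
  by rewrite /gauss_cst -powRrM mulVf ?gt_eqF// powRr1// ltW.
have key u : 0 < u -> v <= u -> (\int[P]_w (`|X w| `^ p)%:E <= (K * Num.sqrt u `^ p)%:E)%E.
  move=> u0 vu; have su0 : 0 < Num.sqrt u by rewrite sqrtr_gt0.
  have sX' := subgaussian_le vu sX.
  pose s := (Num.sqrt u)^-1.
  have h1 theta : theta ^+ 2 = u^-1 -> (\int[P]_w (expR (theta * X w))%:E <= (expR 2^-1)%:E)%E.
    move=> th; apply: (le_trans (sX' theta)).
    by rewrite th mulVf ?gt_eqF// div1r.
  have s2 : s ^+ 2 = u^-1 by rewrite exprVn sqr_sqrtr// ltW.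
  apply: (@le_trans _ _ (\int[P]_w ((Num.sqrt u `^ p * p `^ p)%:E *
      ((expR (s * X w))%:E + (expR (- s * X w))%:E)))%E).
    apply: le_lower_integral => w _; first by rewrite lee_fin powR_ge0.
    rewrite -EFinD -EFinM lee_fin -mulrA mulNr.
    have -> : `|X w| `^ p = Num.sqrt u `^ p * `|s * X w| `^ p.
      rewrite -powRM ?sqrtr_ge0// normrM ger0_norm ?invr_ge0 ?sqrtr_ge0//.
      by rewrite mulVKf// gt_eqF.
    by rewrite ler_wpM2l ?powR_ge0// powR_le_expR.
  have me theta : measurable_fun setT (fun w => (expR (theta * X w))%:E).
    by apply/measurable_EFinP; exact: measurable_expM.
  rewrite ge0_integralZl ?lee_fin ?mulr_ge0 ?powR_ge0//; last 2 first.
  - exact: emeasurable_funD.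
  - by move=> w _; rewrite -EFinD lee_fin addr_ge0 ?expR_ge0.
  rewrite ge0_integralD//.
  have -> : K * Num.sqrt u `^ p = Num.sqrt u `^ p * p `^ p * (expR 2^-1 + expR 2^-1).
    by rewrite /K; ring.
  rewrite [leRHS]EFinM lee_wpmul2l ?lee_fin ?mulr_ge0 ?powR_ge0// EFinD.
  by apply: leeD; apply: h1; rewrite ?sqrrN.
rewrite powRM ?sqrtr_ge0 ?powR_ge0// gK.
have [v00|vn0] := eqVneq v 0; last by apply: key => //; rewrite lt_def vn0.
rewrite v00 sqrtr0 powR0 ?gt_eqF// mulr0.
apply/lee_addgt0Pr => delta delta0; rewrite add0e.
pose u := ((delta / K) `^ p^-1) ^+ 2.
have u0 : 0 < u by rewrite exprn_gt0// powR_gt0// divr_gt0.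
apply: (le_trans (key u u0 _)); first by rewrite v00 ltW.
rewrite lee_fin /u sqrtr_sqr ger0_norm ?powR_ge0// -powRrM mulVf ?gt_eqF// powRr1 ?divr_ge0 ?(ltW delta0) ?(ltW K0)//.
by rewrite mulrC divfK// gt_eqF.
Qed.

Lemma Lp_le_norm p X C : 0 < p -> 0 <= C -> Lp_le p X C <->
  ('N[P]_p%:E[EFin \o X] <= C%:E)%E.
Proof.
move=> p0 C0; rewrite /Lp_le unlock /=.
set a := (\int[P]_w _)%E; have a0 : (0 <= a)%E by apply: integral_ge0 => w _; rewrite lee_fin powR_ge0.
have cE : (C%:E = (C `^ p)%:E `^ p^-1)%E.
  by rewrite poweR_EFin -powRrM divff ?gt_eqF// powRr1.
split => h.
  by rewrite [leRHS]cE; apply: gt0_ler_poweR => //; rewrite ?in_itv/= ?leey ?lee_fin ?powR_ge0 ?invr_ge0 ?(ltW p0) ?a0.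
have aE : (a = (a `^ p^-1) `^ p)%E by rewrite -poweRrM mulVf ?gt_eqF// poweRe1.
rewrite aE -poweR_EFin; apply: gt0_ler_poweR => //; first exact: ltW.
- by rewrite in_itv/= leey poweR_ge0.
- by rewrite in_itv/= leey lee_fin C0.
Qed.

Lemma Lp_leD p X Y C C' : 1 <= p -> 0 <= C -> 0 <= C' -> measurable_fun setT X ->
  measurable_fun setT Y -> Lp_le p X C -> Lp_le p Y C' ->
  Lp_le p (fun w => X w + Y w) (C + C').
Proof.
move=> p1 C0 C'0 mX mY; have p0 : 0 < p by exact: lt_le_trans p1.
move=> /(Lp_le_norm _ p0 C0) hX /(Lp_le_norm _ p0 C'0) hY.
apply/(Lp_le_norm _ p0 (addr_ge0 C0 C'0)).
by apply: (le_trans (minkowski_EFin P mX mY p1)); rewrite EFinD leeD.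
Qed.

End subgaussian.

(** * Maxima and chaining *)

Section chaining.
Context d (T : measurableType d) (R : realType) (P : probability T R).
Variable p : R.
Hypothesis p1 : 1 <= p.

Let p0 : 0 < p. Proof. exact: lt_le_trans p1. Qed.

Lemma Lp_le_mono (X Y : T -> R) C C' : C <= C' -> 0 <= C ->
  (forall w, `|X w| <= `|Y w|) -> Lp_le P p Y C -> Lp_le P p X C'.
Proof.
move=> CC' C0 XY; rewrite /Lp_le => h.
apply: (@le_trans _ _ (\int[P]_w (`|Y w| `^ p)%:E)%E).
  apply: le_lower_integral => w _; first by rewrite lee_fin powR_ge0.
  by rewrite lee_fin ge0_ler_powR ?nnegrE ?(ltW p0).
by apply: (le_trans h); rewrite lee_fin ge0_ler_powR ?nnegrE ?(ltW p0)// (le_trans C0).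
Qed.

(** A bound on the [p]-norm of the maximum of the first [n] variables,
    expressed through a measurable majorant. *)
Definition dominated (Z : nat -> T -> R) n C := exists S : T -> R,
  [/\ measurable_fun setT S, forall w, 0 <= S w,
      forall i w, (i < n)%N -> `|Z i w| <= S w & Lp_le P p S C].

(** The maximum is at most the [p]-th root of the sum of the [p]-th powers. *)
Lemma Lp_max (Z : nat -> T -> R) n C : 0 <= C -> (forall i, measurable_fun setT (Z i)) ->
  (forall i, (i < n)%N -> Lp_le P p (Z i) C) ->
  dominated Z n (n%:R `^ p^-1 * C).
Proof.
move=> C0 mZ hZ.
have mZp i : measurable_fun setT (fun w => `|Z i w| `^ p).
  by apply: (measurableT_comp (measurable_powR p)); exact: measurableT_comp.
pose V w := \sum_(i < n) `|Z i w| `^ p.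
have V0 w : 0 <= V w by apply: sumr_ge0 => i _; exact: powR_ge0.
have VK w : (V w `^ p^-1) `^ p = V w by rewrite -powRrM mulVf ?gt_eqF// powRr1.
exists (fun w => V w `^ p^-1); split.
- by apply: (measurableT_comp (measurable_powR p^-1)); apply: measurable_sum.
- by move=> w; exact: powR_ge0.
- move=> i w iN; rewrite -[leLHS](powRr1 (normr_ge0 _)) -[X in _ `^ X <= _](divff (lt0r_neq0 p0)) powRrM.
  rewrite ge0_ler_powR ?nnegrE ?powR_ge0 ?invr_ge0 ?(ltW p0)//.
  rewrite /V (bigD1 (Ordinal iN))//= lerDl.
  by apply: sumr_ge0 => k _; exact: powR_ge0.
rewrite /Lp_le; under eq_integral do rewrite ger0_norm ?powR_ge0// VK /V -sumEFin.
rewrite ge0_integral_sum//; last by move=> i; apply/measurable_EFinP.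
rewrite powRM ?powR_ge0// -powRrM mulVf ?gt_eqF// powRr1//.
apply: (@le_trans _ _ (\sum_(i < n) (C `^ p)%:E)%E).
  by apply: lee_sum => i _; exact: hZ.
by rewrite sumEFin sumr_const card_ord lee_fin mulr_natl.
Qed.

Local Notation s := (Num.sqrt 2 : R).
Local Notation g := (2 `^ p^-1 : R).

(** The first summand is the cost for the even times, whose increments are
    larger by [s]; the second one that of the increments to the odd times, the
    maximum of which grows by [g] when their number doubles. *)
Fixpoint chain_cst m : R := if m is k.+1 then s * chain_cst k + g ^+ k else 0.

Lemma chain_cst_ge0 m : 0 <= chain_cst m.
Proof.
by elim: m => [//|m IH] /=; rewrite addr_ge0 ?mulr_ge0 ?sqrtr_ge0// exprn_ge0// powR_ge0.
Qed.

Lemma chain_cst_le m : 2 < p -> chain_cst m <= s ^+ m / (s - g).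
Proof.
move=> p2; have gs : 0 < s - g.
  rewrite subr_gt0 -[X in _ < X]powR12_sqrt// /powR pnatr_eq0 ltr_expR.
  by rewrite ltr_pM2r ?ltf_pV2 ?posrE// ln_gt0// ltr1n.
suff -> : chain_cst m = (s ^+ m - g ^+ m) / (s - g).
  by rewrite ler_wpM2r ?invr_ge0 ?(ltW gs)// gerBl exprn_ge0// powR_ge0.
elim: m => [|m IH] /=; first by rewrite !expr0 subrr mul0r.
by rewrite IH !exprS; field; rewrite gt_eqF.
Qed.

(** Dyadic chaining: a process whose increments have the size of those of a
    random walk is bounded along the even times, and each odd time is compared
    with the even time before it. As [p > 2], the cost of taking the maximum of
    twice as many increments is more than compensated by their smaller size. *)
Lemma chaining m (Z : nat -> T -> R) K a b : 0 <= a -> 0 <= b ->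
  (forall i, measurable_fun setT (Z i)) ->
  (forall i, (i < K * 2 ^ m)%N -> Lp_le P p (Z i) b) ->
  (forall i l, (i <= l)%N -> (l < K * 2 ^ m)%N ->
     Lp_le P p (fun w => Z l w - Z i w) (a * Num.sqrt (l - i)%:R)) ->
  dominated Z (K * 2 ^ m) (K%:R `^ p^-1 * (b + a * chain_cst m)).
Proof.
elim: m Z a b => [|m IH] Z a b a0 b0 mZ hb ha.
  by rewrite expn0 muln1 mulr0 addr0 in hb *; exact: Lp_max.
have K2 : (K * 2 ^ m.+1 = (K * 2 ^ m).*2)%N by rewrite expnS mulnCA mul2n.
have lt2 i : (i < K * 2 ^ m)%N -> (i.*2 < K * 2 ^ m.+1)%N by rewrite K2 ltn_double.
have lt2S i : (i < K * 2 ^ m)%N -> (i.*2.+1 < K * 2 ^ m.+1)%N.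
  by move=> h; rewrite K2 -doubleS leq_double.
have [||| S [mS S0 SZ hS]] := IH (fun i => Z i.*2) (s * a) b (mulr_ge0 (sqrtr_ge0 _) a0) b0.
- by move=> i; exact: mZ.
- by move=> i h; apply: hb; exact: lt2.
- move=> i l il h; have := ha i.*2 l.*2; rewrite leq_double => /(_ il (lt2 _ h)).
  by rewrite -doubleB -[(l - i).*2]muln2 natrM sqrtrM// mulrA (mulrC (a * _)) mulrA.
have [|| S' [mS' S'0 S'Z hS']] := @Lp_max (fun i w => Z i.*2.+1 w - Z i.*2 w) (K * 2 ^ m) a a0.
- by move=> i; exact: measurable_funB.
- move=> i h; have := ha i.*2 i.*2.+1 (leqnSn _) (lt2S _ h).
  by rewrite subSnn sqrtr1 mulr1.
exists (fun w => S w + S' w); split.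
- exact: measurable_funD.
- by move=> w; rewrite addr_ge0.
- move=> i w; rewrite K2 => iK; have i2 : (i./2 < K * 2 ^ m)%N by rewrite -ltn_double; apply: leq_ltn_trans iK; rewrite -{2}(odd_double_half i) leq_addl.
  rewrite -(odd_double_half i); case: (odd i) => /=; last first.
    by rewrite add0n (le_trans (SZ _ w i2))// lerDl.
  rewrite add1n (_ : Z i./2.*2.+1 w = Z i./2.*2 w + (Z i./2.*2.+1 w - Z i./2.*2 w)); last by ring.
  by rewrite (le_trans (ler_normD _ _))// lerD// ?SZ// S'Z.
have -> : K%:R `^ p^-1 * (b + a * chain_cst m.+1) =
    K%:R `^ p^-1 * (b + s * a * chain_cst m) + (K * 2 ^ m)%:R `^ p^-1 * a.
  have -> : (K * 2 ^ m)%:R `^ p^-1 = K%:R `^ p^-1 * g ^+ m :> R.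
    rewrite natrM powRM// natrX -powR_mulrn// -powRrM (mulrC m%:R) powRrM.
    by rewrite powR_mulrn ?powR_ge0.
  by rewrite /=; ring.
apply: Lp_leD => //.
- by rewrite mulr_ge0 ?powR_ge0// addr_ge0// mulr_ge0 ?chain_cst_ge0// mulr_ge0 ?sqrtr_ge0.
- by rewrite mulr_ge0 ?powR_ge0.
Qed.

End chaining.

(** * Kernel of the Euler error *)

Section sums.
Context {R : realType}.
Implicit Types x : R.

Lemma geometric_sum_le x n : 0 <= x < 1 -> \sum_(i < n) x ^+ i <= (1 - x)^-1.
Proof.
move=> /andP[x0 x1]; have x10 : 0 < 1 - x by rewrite subr_gt0.
rewrite -[leRHS]mul1r ler_pdivlMr// mulrC -opprB mulNr -subrX1 opprB.
by rewrite lerBlDr lerDl exprn_ge0.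
Qed.

Lemma exprB_le x y n : 0 <= y <= x -> x ^+ n.+1 - y ^+ n.+1 <= n.+1%:R * x ^+ n * (x - y).
Proof.
move=> /andP[y0 yx]; have x0 := le_trans y0 yx.
elim: n => [|n IH]; first by rewrite !expr1 expr0 !mul1r.
have -> : x ^+ n.+2 - y ^+ n.+2 = x * (x ^+ n.+1 - y ^+ n.+1) + (x - y) * y ^+ n.+1.
  by rewrite (exprS x n.+1) (exprS y n.+1); ring.
have -> : n.+2%:R * x ^+ n.+1 * (x - y) = x * (n.+1%:R * x ^+ n * (x - y)) + (x - y) * x ^+ n.+1.
  by rewrite -[n.+2%:R]natr1 exprS; ring.
by rewrite lerD ?ler_wpM2l ?subr_ge0// lerXn2r.
Qed.

Lemma bernoulli_ineq x n : 0 <= x -> 1 + n%:R * x <= (1 + x) ^+ n.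
Proof.
move=> x0; elim: n => [|n IH]; first by rewrite mul0r addr0 expr0.
rewrite exprS; apply: (@le_trans _ _ ((1 + x) * (1 + n%:R * x))).
  have h : 0 <= n%:R * x * x by rewrite !mulr_ge0.
  by rewrite -natr1; lra.
by rewrite ler_wpM2l// addr_ge0.
Qed.

Lemma sum_blocks (f : nat -> R) n mm : (0 < mm)%N ->
  \sum_(i < n * mm) f (i %/ mm)%N = mm%:R * \sum_(k < n) f k.
Proof.
move=> mm0; rewrite -(big_mkord xpredT (fun i => f (i %/ mm)%N)).
elim: n => [|n IH]; first by rewrite mul0n big_geq// big_ord0 mulr0.
rewrite mulSn addnC (@big_cat_nat _ _ _ (n * mm))//= ?leq_addr// IH big_ord_recr/= mulrDr.
congr (_ + _); rewrite -{1}[(n * mm)%N]add0n big_addn addnC addnK.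
rewrite big_mkord (eq_bigr (fun=> f n)) => [|i _].
  by rewrite sumr_const card_ord mulr_natl.
by rewrite addnC divnMDl// divn_small ?addn0.
Qed.

Lemma sum_rev (f : nat -> R) n : \sum_(k < n) f (n - k.+1)%N = \sum_(k < n) f k.
Proof. by rewrite [RHS](reindex_inj rev_ord_inj). Qed.

End sums.

Section kernel.
Context {R : realType}.
Variable z : R.
Hypothesis z0 : 0 < z.

Local Notation rr := ((1 + z)^-1).
Local Notation rho := (expR (- z)).

(** Error of the implicit Euler step at age between [a] and [a + 1] steps. *)
Definition gker (y : R) a := expR (- (z * (a%:R + y))) - rr ^+ a.+1.

Let z1p : 0 < 1 + z. Proof. by rewrite addr_gt0. Qed.
Let rr0 : 0 < rr. Proof. by rewrite invr_gt0. Qed.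
Let rr1 : rr <= 1. Proof. by rewrite invf_le1// lerDl ltW. Qed.
Let rho_rr : rho <= rr. Proof. by rewrite expRN lef_pV2 ?posrE ?expR_gt0// expR_ge1Dx. Qed.

Let rr_rho : rr - rho <= z ^+ 2.
Proof.
have h : rr <= 1 - z + z ^+ 2.
  rewrite -[leLHS]mul1r ler_pdivrMr//.
  have : 0 <= z ^+ 3 by rewrite exprn_ge0// ltW.
  by rewrite (_ : (1 - z + z ^+ 2) * (1 + z) = 1 + z ^+ 3); [lra|ring].
by have := expR_ge1Dx (- z); lra.
Qed.

Lemma expRN_lip (u v : R) : 0 <= u -> u <= v -> `|expR (- u) - expR (- v)| <= v - u.
Proof.
move=> u0 uv; rewrite ger0_norm ?subr_ge0 ?ler_expR ?lerN2//.
have -> : expR (- u) - expR (- v) = expR (- u) * (1 - expR (- (v - u))).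
  by rewrite mulrBr mulr1 -expRD; congr (_ - expR _); ring.
have h1 : expR (- u) <= 1 by rewrite -[leRHS]expR0 ler_expR oppr_le0.
have h2 : 1 - expR (- (v - u)) <= v - u by have := expR_ge1Dx (- (v - u)); lra.
rewrite -[leRHS]mul1r ler_pM ?expR_ge0 ?subr_ge0//.
by rewrite -[leRHS]expR0 ler_expR oppr_le0 subr_ge0.
Qed.

Section small.
Hypothesis z1 : z <= 1.

Local Notation w := (z / 3).
Local Notation th := ((1 + z / 3)^-1).

Let w0 : 0 < w. Proof. by rewrite divr_gt0. Qed.
Let w1p : 0 < 1 + w. Proof. by rewrite addr_gt0. Qed.
Let th0 : 0 < th. Proof. by rewrite invr_gt0. Qed.
Let th1 : th < 1. Proof. by rewrite invf_lt1// ltrDl. Qed.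

Let rr_th2 : rr <= th ^+ 2.
Proof.
rewrite exprVn lef_pV2 ?posrE ?exprn_gt0//.
have : z ^+ 2 <= z by rewrite expr2 ler_piMr// ltW.
rewrite (_ : (1 + w) ^+ 2 = 1 + 2 * z / 3 + z ^+ 2 / 9); last by field.
by move=> zz; have z0' := z0; lra.
Qed.

Let th2_th : th ^+ 2 <= th. Proof. by rewrite expr2 ler_piMr// ltW. Qed.

Let thn_le1 n : th ^+ n <= 1. Proof. by rewrite exprn_ile1// ltW. Qed.
Let thn_ge0 n : 0 <= th ^+ n. Proof. by rewrite exprn_ge0// ltW. Qed.

Let rrn_th2 n : rr ^+ n <= (th ^+ n) ^+ 2.
Proof. by rewrite -exprM mulnC exprM lerXn2r ?nnegrE ?exprn_ge0 ?(ltW rr0) ?(ltW th0). Qed.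

Let linear_decay n : n.+1%:R * z * th ^+ n <= 3.
Proof.
have h : n.+1%:R * w <= (1 + w) ^+ n.
  apply: le_trans (bernoulli_ineq n (ltW w0)).
  rewrite -natr1 mulrDl mul1r addrC lerD2r.
  by have z1' := z1; have z0' := z0; lra.
rewrite exprVn ler_pdivrMr ?exprn_gt0//.
by rewrite (_ : n.+1%:R * z = 3 * (n.+1%:R * w)); [rewrite ler_wpM2l|field].
Qed.

(** Replacing the age by an integer costs [z], and comparing [expR (- z) ^+ n]
    with [rr ^+ n] costs [n * z ^+ 2 * rr ^+ n.-1]. As [rr <= th ^+ 2], half
    of the decay absorbs the factor [n * z], and the other half is kept. *)
Lemma gker_le y a : 0 <= y <= 1 -> `|gker y a| <= 4 * z * th ^+ a.
Proof.
move=> /andP[y0 y1]; have a0 : 0 <= a%:R :> R by [].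
have h1 : `|expR (- (z * (a%:R + y))) - expR (- (z * a.+1%:R))| <= z * th ^+ a.
  have -> : expR (- (z * (a%:R + y))) - expR (- (z * a.+1%:R)) =
      expR (- (z * a%:R)) * (expR (- (z * y)) - expR (- z)).
    by rewrite mulrBr -!expRD -natr1; congr (expR _ - expR _); ring.
  rewrite normrM ger0_norm ?expR_ge0// mulrC ler_pM ?expR_ge0//.
    have zy : z * y <= z by rewrite ler_piMr// ltW.
    apply: le_trans (expRN_lip _ zy) _; first by rewrite mulr_ge0// ltW.
    by rewrite gerBl mulr_ge0// ltW.
  rewrite -mulNr expRM_natr lerXn2r ?nnegrE ?expR_ge0 ?(ltW th0)//.
  by rewrite (le_trans rho_rr)// (le_trans rr_th2).
have h2 : `|expR (- (z * a.+1%:R)) - rr ^+ a.+1| <= 3 * z * th ^+ a.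
  rewrite -mulNr expRM_natr distrC ger0_norm; last first.
    by rewrite subr_ge0 lerXn2r ?nnegrE ?expR_ge0 ?(ltW rr0).
  have := @exprB_le _ rr rho a; rewrite expR_ge0 rho_rr => /(_ isT) /le_trans; apply.
  apply: (@le_trans _ _ (a.+1%:R * (th ^+ a) ^+ 2 * z ^+ 2)).
    apply: ler_pM => //; rewrite ?mulr_ge0 ?exprn_ge0 ?subr_ge0 ?(ltW rr0)//.
    by rewrite ler_wpM2l.
  rewrite (_ : _ * z ^+ 2 = (a.+1%:R * z * th ^+ a) * (z * th ^+ a)); last by ring.
  by rewrite -[3 * z * _]mulrA ler_wpM2r// mulr_ge0// ltW.
rewrite /gker -[_ - _](subrKA (expR (- (z * a.+1%:R)))).
rewrite (le_trans (ler_normD _ _))// (le_trans (lerD h1 h2))//.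
by rewrite le_eqVlt; apply/orP; left; apply/eqP; ring.
Qed.

(** One more step multiplies the two terms of the error by [rho] and [rr],
    both [z]-close to 1 and [z ^+ 2]-close to each other. *)
Lemma gker_step_le y a : 0 <= y <= 1 -> `|gker y a.+1 - gker y a| <= 5 * z ^+ 2 * th ^+ a.
Proof.
move=> y01; have -> : gker y a.+1 - gker y a = (rho - 1) * gker y a + (rho - rr) * rr ^+ a.+1.
  rewrite /gker -natr1 (_ : - (z * (a%:R + 1 + y)) = - z + - (z * (a%:R + y))); last by ring.
  by rewrite expRD (exprS _ a.+1); ring.
rewrite (le_trans (ler_normD _ _))// !normrM.
have h1 : `|rho - 1| <= z.
  rewrite distrC ger0_norm ?subr_ge0; last by rewrite -[leRHS]expR0 ler_expR oppr_le0 ltW.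
  by have := expR_ge1Dx (- z); lra.
have h2 : `|rho - rr| <= z ^+ 2 by rewrite distrC ger0_norm ?subr_ge0.
have h3 : `|rr ^+ a.+1| <= th ^+ a.
  rewrite ger0_norm ?exprn_ge0 ?(ltW rr0)//.
  rewrite exprS (le_trans (ler_wpM2r _ rr1)) ?exprn_ge0 ?(ltW rr0)// mul1r.
  by rewrite (le_trans (rrn_th2 a))// expr2 ler_piMr.
apply: (le_trans (lerD (ler_pM (normr_ge0 _) (normr_ge0 _) h1 (gker_le a y01))
  (ler_pM (normr_ge0 _) (normr_ge0 _) h2 h3))).
by rewrite le_eqVlt; apply/orP; left; apply/eqP; ring.
Qed.

Let th_sub : (1 - th)^-1 <= 4 / z.
Proof.
rewrite (_ : 4 / z = (z / 4)^-1); last by field; rewrite gt_eqF.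
rewrite lef_pV2 ?posrE ?subr_gt0 ?divr_gt0//.
rewrite (_ : 1 - th = w * th); last by field; apply: lt0r_neq0; have := z0; lra.
rewrite ler_pdivlMr//.
have : z ^+ 2 <= z by rewrite expr2 ler_piMr// ltW.
rewrite (_ : z / 4 * (1 + w) = z / 4 + z ^+ 2 / 12); last by field.
by move=> zz; have z0' := z0; lra.
Qed.

Lemma sum_th_le n : \sum_(k < n) th ^+ k <= 4 / z.
Proof. by apply: le_trans th_sub; apply: geometric_sum_le; rewrite (ltW th0) th1. Qed.

Lemma sum_th2_le n : \sum_(k < n) (th ^+ k) ^+ 2 <= 4 / z.
Proof.
apply: le_trans (sum_th_le n); apply: ler_sum => k _.
by rewrite expr2 ler_piMr.
Qed.

Lemma gker_sqr_le y a : 0 <= y <= 1 -> gker y a ^+ 2 <= 16 * z ^+ 2 * (th ^+ a) ^+ 2.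
Proof.
move=> y01; rewrite -(real_normK (num_real _)).
rewrite (_ : 16 * _ * _ = (4 * z * th ^+ a) ^+ 2); last by ring.
by rewrite lerXn2r ?nnegrE ?gker_le// !mulr_ge0// ltW.
Qed.

Lemma gker_diff_sqr_le y a n : 0 <= y <= 1 ->
  (gker y (a + n) - gker y a) ^+ 2 <= 100 * z ^+ 3 * n%:R * (th ^+ a) ^+ 2.
Proof.
move=> y01; pose G := \sum_(k < n) th ^+ k.
have G0 : 0 <= G by apply: sumr_ge0.
have h : `|gker y (a + n) - gker y a| <= 5 * z ^+ 2 * th ^+ a * G.
  rewrite /G; elim: n {G G0} => [|n IH]; first by rewrite addn0 subrr normr0 big_ord0 mulr0.
  rewrite -[_ - _](subrKA (gker y (a + n))) addrC big_ord_recr/= mulrDr.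
  rewrite (le_trans (ler_normD _ _))// lerD// addnS.
  by rewrite (le_trans (gker_step_le _ y01))// exprD mulrA.
have Gn : G <= n%:R.
  apply: (@le_trans _ _ (\sum_(k < n) 1)); first by apply: ler_sum.
  by rewrite sumr_const card_ord.
have GG : G ^+ 2 <= n%:R * (4 / z).
  by rewrite expr2 ler_pM ?sum_th_le.
rewrite -(real_normK (num_real _)).
apply: (@le_trans _ _ ((5 * z ^+ 2 * th ^+ a * G) ^+ 2)).
  have h5 : 0 <= 5 * z ^+ 2 * th ^+ a by apply: mulr_ge0 => //; apply: mulr_ge0 => //; exact: sqr_ge0.
  by rewrite lerXn2r ?nnegrE// mulr_ge0.
rewrite (_ : _ ^+ 2 = 25 * z ^+ 4 * (th ^+ a) ^+ 2 * G ^+ 2); last by ring.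
rewrite (_ : 100 * _ * _ * _ = 25 * z ^+ 4 * (th ^+ a) ^+ 2 * (n%:R * (4 / z))); last first.
  by field; rewrite gt_eqF.
apply: ler_wpM2l => //; apply: mulr_ge0; last exact: sqr_ge0.
by apply: mulr_ge0 => //; rewrite exprn_ge0// ltW.
Qed.

End small.

Section grid.
Variable mm : nat.
Hypothesis mm0 : (0 < mm)%N.

Let mmR : 0 < mm%:R :> R. Proof. by rewrite ltr0n. Qed.

(** The kernel of the error at time [n], on the [i]-th cell of a grid that
    divides every time step into [mm] cells. *)
Definition err_kernel n i : R := if (i < n * mm)%N then
  expR (- (z * (n%:R - i%:R / mm%:R))) - rr ^+ (n - i %/ mm) else 0.

Let pos i : R := 1 - (i %% mm)%N%:R / mm%:R.

Let pos01 i : 0 <= pos i <= 1.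
Proof.
rewrite /pos subr_ge0 gerBl divr_ge0 ?(ltW mmR)// andbT ler_pdivrMr// mul1r ler_nat.
by rewrite ltnW// ltn_mod.
Qed.

Let cell_lt n i : (i < n * mm)%N -> (i %/ mm < n)%N. Proof. by rewrite ltn_divLR. Qed.

Lemma err_kernelE n i : (i < n * mm)%N -> err_kernel n i = gker (pos i) (n - (i %/ mm).+1).
Proof.
move=> h; rewrite /err_kernel h /gker; have hn := cell_lt h.
congr (expR (- (z * _)) - _ ^+ _); last by rewrite -subSn.
rewrite /pos natrB// {1}(divn_eq i mm) natrD natrM -natr1.
by field; rewrite gt_eqF.
Qed.

(** The two terms of the kernel are summed separately, as geometric series. *)
Lemma err_kernel_large n :
  \sum_(i < n * mm) err_kernel n i ^+ 2 <= mm%:R * (2 / z).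
Proof.
pose qq := expR (- (2 * z / mm%:R)).
have zm : 0 < 2 * z / mm%:R by rewrite divr_gt0// mulr_gt0.
have qq01 : 0 <= qq < 1 by rewrite expR_ge0/= -[ltRHS]expR0 ltr_expR oppr_lt0.
have rr01 : 0 <= rr ^+ 2 < 1.
  by rewrite exprn_ge0 ?(ltW rr0)//= exprn_ilt1 ?(ltW rr0)// invf_lt1// ltrDl.
apply: (@le_trans _ _ (\sum_(i < n * mm) (2 * qq ^+ (n * mm - i.+1).+1 +
    2 * rr ^+ 2 * (rr ^+ 2) ^+ (n - (i %/ mm).+1)))).
  apply: ler_sum => i _; rewrite /err_kernel ltn_ord.
  have sq (x y : R) : (x - y) ^+ 2 <= 2 * x ^+ 2 + 2 * y ^+ 2.
    by have := sqr_ge0 (x + y); rewrite sqrrB sqrrD; lra.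
  apply: (le_trans (sq _ _)); rewrite -mulrA; apply: lerD; rewrite ler_wpM2l//.
    rewrite /qq -!expRM_natl ler_expR subnSK// le_eqVlt; apply/orP; left; apply/eqP.
    by rewrite natrB ?(ltW (ltn_ord i))// ?natrM; [field; rewrite gt_eqF|rewrite ltnW].
  by rewrite -exprS subnSK ?cell_lt// -!exprM mulnC.
rewrite big_split/= -!mulr_sumr.
rewrite (sum_rev (fun k => qq ^+ k.+1)) (sum_blocks (fun k => (rr ^+ 2) ^+ (n - k.+1)))//.
rewrite (sum_rev (fun k => (rr ^+ 2) ^+ k)).
rewrite (_ : mm%:R * (2 / z) = 2 * (mm%:R / (2 * z)) + mm%:R / z); last first.
  by field; rewrite gt_eqF.
apply: lerD.
  rewrite ler_wpM2l//; under eq_bigr do rewrite exprS.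
  rewrite -mulr_sumr (le_trans (ler_wpM2l _ (geometric_sum_le _ qq01))) ?expR_ge0//.
  have h : (1 + 2 * z / mm%:R) * qq <= 1.
    by rewrite /qq expRN ler_pdivrMr ?expR_gt0// mul1r expR_ge1Dx.
  rewrite ler_pdivrMr ?subr_gt0; last by case/andP: qq01.
  by rewrite -invf_div ler_pdivlMl//; lra.
rewrite mulrCA -mulrA ler_wpM2l ?(ltW mmR)//.
apply: (@le_trans _ _ (2 * (rr ^+ 2 * (1 - rr ^+ 2)^-1))).
  rewrite ler_wpM2l// ler_wpM2l ?geometric_sum_le//; by case/andP: rr01.
have -> : rr ^+ 2 * (1 - rr ^+ 2)^-1 = (z * (2 + z))^-1.
  have -> : 1 - rr ^+ 2 = z * (2 + z) * rr ^+ 2 by field; rewrite gt_eqF.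
  by rewrite [in LHS]invfM mulrCA mulfV ?mulr1// gt_eqF// exprn_gt0.
rewrite invfM mulrCA ler_piMr ?invr_ge0 ?(ltW z0)//.
by rewrite ler_pdivrMr ?addr_gt0// mul1r lerDl ltW.
Qed.

Hypothesis z1 : z <= 1.

Local Notation th := ((1 + z / 3)^-1).

Lemma err_kernel_cell_le n i : (i < n * mm)%N ->
  err_kernel n i ^+ 2 <= 16 * z ^+ 2 * (th ^+ (n - (i %/ mm).+1)) ^+ 2.
Proof. by move=> h; rewrite err_kernelE// gker_sqr_le. Qed.

Lemma err_kernel_small n :
  \sum_(i < n * mm) err_kernel n i ^+ 2 <= mm%:R * (64 * z).
Proof.
apply: (@le_trans _ _ (\sum_(i < n * mm) 16 * z ^+ 2 * (th ^+ (n - (i %/ mm).+1)) ^+ 2)).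
  by apply: ler_sum => i _; exact: err_kernel_cell_le.
rewrite -mulr_sumr (sum_blocks (fun k => (th ^+ (n - k.+1)) ^+ 2))//.
rewrite (sum_rev (fun k => (th ^+ k) ^+ 2)) mulrCA ler_wpM2l ?(ltW mmR)//.
apply: (le_trans (ler_wpM2l _ (sum_th2_le z1 n))); first by rewrite mulr_ge0 ?sqr_ge0.
by rewrite le_eqVlt; apply/orP; left; apply/eqP; field; rewrite gt_eqF.
Qed.

(** On the cells before time [l] the two kernels differ in age by [n - l]
    steps, each worth [z ^+ 2]; the cells after [l] contribute one kernel of
    size [z] on [n - l] steps. *)
Lemma err_kernel_diff l n : (l <= n)%N ->
  \sum_(i < n * mm) (err_kernel n i - err_kernel l i) ^+ 2 <=
  mm%:R * (416 * z ^+ 2 * (n - l)%:R).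
Proof.
move=> ln; have lnm : (l * mm <= n * mm)%N by rewrite leq_mul2r ln orbT.
rewrite -(big_mkord xpredT (fun i => (err_kernel n i - err_kernel l i) ^+ 2)).
rewrite (@big_cat_nat _ _ _ (l * mm))//=.
have -> : mm%:R * (416 * z ^+ 2 * (n - l)%:R) =
    mm%:R * (400 * z ^+ 2 * (n - l)%:R) + mm%:R * (16 * z ^+ 2 * (n - l)%:R) by ring.
apply: lerD.
  rewrite big_mkord.
  apply: (@le_trans _ _ (\sum_(i < l * mm) 100 * z ^+ 3 * (n - l)%:R *
      (th ^+ (l - (i %/ mm).+1)) ^+ 2)).
    apply: ler_sum => i _; have iln : (i < n * mm)%N by exact: leq_trans lnm.
    rewrite !err_kernelE//.
    rewrite (_ : (n - (i %/ mm).+1)%N = (l - (i %/ mm).+1 + (n - l))%N).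
      exact: (gker_diff_sqr_le z1 _ _ (pos01 i)).
    by rewrite addnC addnBA ?cell_lt// subnK.
  rewrite -mulr_sumr (sum_blocks (fun k => (th ^+ (l - k.+1)) ^+ 2))//.
  rewrite (sum_rev (fun k => (th ^+ k) ^+ 2)) mulrCA ler_wpM2l ?(ltW mmR)//.
  apply: (le_trans (ler_wpM2l _ (sum_th2_le z1 l))).
    by apply: mulr_ge0 => //; rewrite mulr_ge0// exprn_ge0// ltW.
  by rewrite le_eqVlt; apply/orP; left; apply/eqP; field; rewrite gt_eqF.
apply: (@le_trans _ _ (\sum_(l * mm <= i < n * mm) 16 * z ^+ 2)).
  rewrite big_nat_cond [leRHS]big_nat_cond; apply: ler_sum => i /andP[/andP[li iin] _].
  rewrite {2}/err_kernel ltnNge li/= subr0 (le_trans (err_kernel_cell_le iin))//.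
  apply: ler_piMr; first by apply: mulr_ge0 => //; exact: sqr_ge0.
  have w0 : 0 < z / 3 by rewrite divr_gt0.
  by rewrite -exprM exprn_ile1// ?invr_ge0 ?addr_ge0 ?(ltW w0)// invf_le1 ?lerDl ?(ltW w0)// addr_gt0.
rewrite sumr_const_nat -mulnBl -[leLHS]mulr_natl natrM.
by rewrite le_eqVlt; apply/orP; left; apply/eqP; ring.
Qed.

End grid.
End kernel.

(** * The error in one mode *)

Section coordinate_error.
Context {R : realType} {H : lmodType R} (ip : H -> H -> R).
Hypothesis ipP : semi_inner ip.
Context {dO : measure_display} {Omega : measurableType dO}.
Variables (P : probability Omega R) (F : R -> set (set Omega)).
Hypothesis FP : normal_filtration P F.
Variables (Q Qh : H -> H) (W : R -> Omega -> H).
Hypotheses (QP : psd_op ip Q) (QhP : is_sqrt_op ip Q Qh) (WP : Q_wiener ip P F Q W).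

(** Induction on the number of increments: each one is independent of the sum
    of the previous ones, which is adapted. *)
Lemma subgaussian_wiener_sum (tau gamma : nat -> R) h m : 0 <= tau 0%N ->
  {homo tau : i k / (i <= k)%N >-> i <= k} ->
  adapted F (tau m) (fun w => \sum_(i < m) gamma i * dW ip W (tau i) (tau i.+1) h w) /\
  subgaussian P (fun w => \sum_(i < m) gamma i * dW ip W (tau i) (tau i.+1) h w)
    (\sum_(i < m) gamma i ^+ 2 * ((tau i.+1 - tau i) * ip (Q h) h)).
Proof.
move=> tau0 tau_nd.
have t0 i : 0 <= tau i by rewrite (le_trans tau0)// tau_nd.
elim: m => [|m [aS sS]].
  have E : (fun w : Omega => \sum_(i < 0) gamma i * dW ip W (tau i) (tau i.+1) h w) = cst 0.
    by apply/funext => w; rewrite big_ord0.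
  rewrite E; split; first exact: (adapted_cst FP).
  move=> theta; under eq_integral do rewrite mulr0 expR0.
  rewrite big_ord0 mulr0 mul0r expR0 (_ : (fun=> 1%E) = cst 1%E)// integral_cst// mul1e.
  exact: probability_le1.
have tm : tau m <= tau m.+1 by exact: tau_nd.
have E : (fun w : Omega => \sum_(i < m.+1) gamma i * dW ip W (tau i) (tau i.+1) h w) =
    (fun w => (\sum_(i < m) gamma i * dW ip W (tau i) (tau i.+1) h w) +
       gamma m * dW ip W (tau m) (tau m.+1) h w).
  by apply/funext => w; rewrite big_ord_recr.
rewrite E big_ord_recr/=; split.
  apply: (adaptedD FP) => //; first by apply: (adapted_mono FP (t0 m) tm).
  apply: (adaptedM FP) => //; first exact: (adapted_cst FP).
  exact: (adapted_dW ipP FP WP).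
apply: subgaussian_indepD => //.
- exact: (adapted_measurable FP (t0 m)).
- exact: (measurable_dW ipP FP WP).
- exact: (indep_dW WP).
- by move=> theta; exact: (mgf_dW ipP FP QP WP).
Qed.

Variable c : R.
Hypothesis c0 : 0 <= c.
Hypothesis cP : forall s t h, 0 <= s -> s <= t ->
  moment2 P (dW ip W s t h) (dW ip W s t h) = c * ((t - s) * ip (Q h) h).
Variables (A : H -> H -> Prop) (e : nat -> H) (lambda : nat -> R).
Hypothesis eP : eigenbasis ip A e lambda.
Variable E : R -> H -> H.
Hypothesis EP : semigroup_of ip A E.
Variables (dt : R) (J : H -> H).
Hypotheses (dt0 : 0 < dt) (JP : euler_step ip A dt J).
Variable WA : R -> Omega -> H.
Hypothesis WAP : forall t : R, 0 <= t ->
  is_ito_integral ip P F e Qh W (fun (s : R) _ => E (t - s)) t (WA t).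
Variable j : nat.

Local Notation z := (lambda j * dt).
Local Notation q := (ip (Q (e j)) (e j)).
Local Notation rr := ((1 + z)^-1).

Let eB : orthonormal_basis ip e. Proof. by case: eP. Qed.
Let l0 : 0 < lambda j. Proof. exact: (eigenvalue_gt0 eP). Qed.
Let z0 : 0 < z. Proof. exact: mulr_gt0. Qed.
Let q0 : 0 <= q. Proof. by case: QP. Qed.

Definition coord_err n w := ip (WA (n%:R * dt) w - euler_convolution J W dt n w) (e j).

Let tn0 n : 0 <= n%:R * dt. Proof. by rewrite mulr_ge0// ltW. Qed.

Section grid.
Variable k : nat.
Local Notation mm := (2 ^ k)%N.

Definition grid i : R := i%:R / mm%:R * dt.

Let mm0 : (0 < mm)%N. Proof. by rewrite expn_gt0. Qed.
Let mmR : 0 < mm%:R :> R. Proof. by rewrite ltr0n. Qed.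

Let grid_nd : {homo grid : i l / (i <= l)%N >-> i <= l}.
Proof.
by move=> i l il; rewrite /grid ler_wpM2r ?(ltW dt0)// ler_wpM2r ?invr_ge0 ?(ltW mmR)// ler_nat.
Qed.

Let grid0 : grid 0 = 0. Proof. by rewrite /grid !mul0r. Qed.

Let grid0_ge0 : 0 <= grid 0. Proof. by rewrite grid0. Qed.

Let grid_block n : grid (n * mm) = n%:R * dt.
Proof. by rewrite /grid natrM mulfK// gt_eqF. Qed.

Let grid_step i : grid i.+1 - grid i = dt / mm%:R.
Proof. by rewrite /grid -natr1; field; rewrite gt_eqF. Qed.

(** The Wiener sum on a grid of [mm] cells per time step whose weights are the
    error kernel. It represents the Euler scheme exactly and the stochastic
    convolution approximately. *)
Definition grid_err n m w := \sum_(i < m) err_kernel z mm n i * dW ip W (grid i) (grid i.+1) (e j) w.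

Lemma euler_convolution_coord n w : ip (euler_convolution J W dt n w) (e j) =
  \sum_(i < n * mm) rr ^+ (n - i %/ mm) * dW ip W (grid i) (grid i.+1) (e j) w.
Proof.
rewrite /euler_convolution (ip_suml ipP) big_add1 -[n.+1.-1]/n big_mkord.
transitivity (\sum_(i < n) rr ^+ (n - i) * dW ip W (i%:R * dt) (i.+1%:R * dt) (e j) w).
  by apply: eq_bigr => i _; rewrite subnSK// (euler_iter_coord ipP eP dt0 JP).
have key l : (l <= n)%N -> \sum_(i < l) rr ^+ (n - i) * dW ip W (i%:R * dt) (i.+1%:R * dt) (e j) w =
   \sum_(i < l * mm) rr ^+ (n - i %/ mm) * dW ip W (grid i) (grid i.+1) (e j) w.
  elim: l => [|l IH] ln; first by rewrite mul0n !big_ord0.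
  rewrite big_ord_recr/= IH ?(ltnW ln)//.
  rewrite -!(big_mkord xpredT (fun i => rr ^+ (n - i %/ mm) * dW ip W (grid i) (grid i.+1) (e j) w)).
  rewrite mulSn addnC [RHS](@big_cat_nat _ _ _ (l * mm))//= ?leq_addr//; congr (_ + _).
  rewrite -grid_block -(grid_block l.+1) mulSn addnC.
  rewrite (eq_big_nat _ _ (F2 := fun i => rr ^+ (n - l) *
      (ip (W (grid i.+1) w) (e j) - ip (W (grid i) w) (e j)))).
    by rewrite -mulr_sumr telescope_sumr ?leq_addr// dWE.
  move=> i /andP[li il]; rewrite dWE//; congr (_ ^+ (_ - _) * _).
  apply/eqP; rewrite eqn_leq leq_divRL// li andbT -ltnS ltn_divLR// mulSn addnC.
  by rewrite il.
exact: key.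
Qed.

Lemma grid_err_widen n m w : (n * mm <= m)%N -> grid_err n m w = grid_err n (n * mm) w.
Proof.
move=> nm; rewrite /grid_err.
rewrite -!(big_mkord xpredT (fun i => err_kernel z mm n i * dW ip W (grid i) (grid i.+1) (e j) w)).
rewrite (@big_cat_nat _ _ _ (n * mm))//= [X in _ + X]big1_seq ?addr0// => i.
rewrite mem_index_iota => /andP[_ /andP[ni _]].
by rewrite /err_kernel ltnNge ni mul0r.
Qed.

(** The exponential kernel of the stochastic convolution varies by at most
    [z / mm] on a cell. *)
Lemma coord_err_approx n :
  (\int[P]_w ((coord_err n w - grid_err n (n * mm) w) ^+ 2)%:E <=
   (4 * c * (n%:R * dt) * (z / mm%:R) ^+ 2 * q)%:E)%E.
Proof.
pose gamma i := expR (- (lambda j * (n%:R * dt - grid i))).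
have h := @stochastic_convolution_approx _ _ _ ipP _ _ _ _ FP _ _ _ QP QhP WP _ c0 cP _ eB
  _ _ eP E j (fun t v t0 => semigroup_coord ipP eP dt0 JP EP v j t0) _ _ (tn0 n) (WAP (tn0 n))
  (n * mm) grid gamma (z / mm%:R) grid0 (grid_block n) grid_nd.
have zm : 0 <= z / mm%:R by rewrite divr_ge0 ?(ltW z0) ?(ltW mmR).
have {}h := h zm.
rewrite (_ : (\int[P]_w _)%E = (\int[P]_w ((ip (WA (n%:R * dt) w) (e j) -
    riemann_sum ip W e j (n * mm) grid gamma w) ^+ 2)%:E)%E); last first.
  apply: eq_integral => w _; congr ((_ ^+ 2)%:E).
  rewrite /coord_err (ipBl ipP) euler_convolution_coord /riemann_sum /grid_err.
  rewrite -addrA -opprD -big_split/=; congr (_ - _); apply: eq_bigr => i _.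
  rewrite -mulrDl /err_kernel ltn_ord /gamma; congr (_ * _).
  rewrite addrC subrK; congr (expR (- _)); rewrite /grid; ring.
apply: h => i s im /andP[si is_].
have sn : s <= n%:R * dt by rewrite (le_trans is_)// -grid_block grid_nd.
rewrite mulNr /gamma.
apply: le_trans (expRN_lip _ _) _.
- by rewrite mulr_ge0 ?(ltW l0)// subr_ge0.
- by rewrite ler_wpM2l ?(ltW l0)// lerB// ltW.
rewrite -mulrBr -mulrA ler_wpM2l ?(ltW l0)//.
rewrite (_ : _ - _ = s - grid i); last by ring.
by rewrite -(grid_step i) lerB.
Qed.

Lemma subgaussian_grid_err n V : \sum_(i < n * mm) err_kernel z mm n i ^+ 2 <= mm%:R * V ->
  subgaussian P (grid_err n (n * mm)) (V * dt * q).
Proof.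
move=> hV.
have [_] := @subgaussian_wiener_sum grid (err_kernel z mm n) (e j) (n * mm) grid0_ge0 grid_nd.
apply: subgaussian_le; under eq_bigr do rewrite grid_step.
rewrite -mulr_suml mulrA ler_wpM2r//.
rewrite (_ : V * dt = mm%:R * V * (dt / mm%:R)); last by field; rewrite gt_eqF.
by rewrite ler_wpM2r// divr_ge0 ?(ltW dt0) ?(ltW mmR).
Qed.

Lemma subgaussian_grid_errB l n V : (l <= n)%N ->
  \sum_(i < n * mm) (err_kernel z mm n i - err_kernel z mm l i) ^+ 2 <= mm%:R * V ->
  subgaussian P (fun w => grid_err n (n * mm) w - grid_err l (l * mm) w) (V * dt * q).
Proof.
move=> ln hV.
have [_] := @subgaussian_wiener_sum grid (fun i => err_kernel z mm n i - err_kernel z mm l i)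
  (e j) (n * mm) grid0_ge0 grid_nd.
rewrite (_ : (fun w => \sum_(i < n * mm) _) =
   (fun w => grid_err n (n * mm) w - grid_err l (l * mm) w)); last first.
  apply/funext => w; rewrite -(@grid_err_widen l (n * mm)) ?leq_mul2r ?ln ?orbT//.
  by rewrite /grid_err -sumrB; apply: eq_bigr => i _; rewrite mulrBl.
apply: subgaussian_le; under eq_bigr do rewrite grid_step.
rewrite -mulr_suml mulrA ler_wpM2r//.
rewrite (_ : V * dt = mm%:R * V * (dt / mm%:R)); last by field; rewrite gt_eqF.
by rewrite ler_wpM2r// divr_ge0 ?(ltW dt0) ?(ltW mmR).
Qed.

Lemma measurable_grid_err n m : measurable_fun setT (grid_err n m).
Proof.
apply: measurable_sum => i; apply: measurable_funM => //.
apply: (measurable_dW ipP FP WP); last exact: grid_nd.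
by rewrite -grid0 grid_nd.
Qed.

End grid.
End coordinate_error.

Section coordinate_bound.
Context {R : realType} {H : lmodType R} (ip : H -> H -> R).
Hypothesis ipP : semi_inner ip.
Context {dO : measure_display} {Omega : measurableType dO}.
Variables (P : probability Omega R) (F : R -> set (set Omega)).
Hypothesis FP : normal_filtration P F.
Variables (Q Qh : H -> H) (W : R -> Omega -> H).
Hypotheses (QP : psd_op ip Q) (QhP : is_sqrt_op ip Q Qh) (WP : Q_wiener ip P F Q W).
Variables (A : H -> H -> Prop) (e : nat -> H) (lambda : nat -> R).
Hypothesis eP : eigenbasis ip A e lambda.
Variable E : R -> H -> H.
Hypothesis EP : semigroup_of ip A E.
Variables (dt : R) (J : H -> H).
Hypotheses (dt0 : 0 < dt) (JP : euler_step ip A dt J).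
Variable WA : R -> Omega -> H.
Hypothesis WAP : forall t : R, 0 <= t ->
  is_ito_integral ip P F e Qh W (fun (s : R) _ => E (t - s)) t (WA t).
Variable j : nat.

Local Notation z := (lambda j * dt).
Local Notation q := (ip (Q (e j)) (e j)).
Local Notation X := (coord_err ip W e dt J WA j).
Local Notation Y k n := (grid_err ip W e lambda dt j k n (n * 2 ^ k)).

Let eB : orthonormal_basis ip e. Proof. by case: eP. Qed.
Let z0 : 0 < z. Proof. by rewrite mulr_gt0// (eigenvalue_gt0 eP). Qed.
Let q0 : 0 <= q. Proof. by case: QP. Qed.
Let tn0 n : 0 <= n%:R * dt. Proof. by rewrite mulr_ge0// ltW. Qed.
Let mY k n : measurable_fun setT (Y k n).
Proof. exact: (measurable_grid_err ipP FP WP). Qed.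

Lemma measurable_coord_err n : measurable_fun setT (X n).
Proof.
rewrite (_ : X n = fun w => ip (WA (n%:R * dt) w) (e j) -
    ip (euler_convolution J W dt n w) (e j)); last first.
  by apply/funext => w; rewrite /coord_err (ipBl ipP).
apply: measurable_funB; first exact: (measurable_ito_coord j (WAP (tn0 n))).
under eq_fun do rewrite (euler_convolution_coord ipP W eP dt0 JP j 0).
apply: measurable_sum => i; apply: measurable_funM => //.
apply: (measurable_dW ipP FP WP); rewrite /grid ?mulr_ge0 ?(ltW dt0)//.
by rewrite ler_wpM2r ?(ltW dt0)// ler_wpM2r// ler_nat.
Qed.

Let approx n : exists2 D, 0 <= D & forall k,
  (\int[P]_w ((X n w - Y k n w) ^+ 2)%:E <= (D * 2^-1 ^+ k)%:E)%E.
Proof.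
have [c c0 cP] := second_moment_dW ipP FP QP WP.
exists (4 * c * (n%:R * dt) * z ^+ 2 * q).
  by do !apply: mulr_ge0 => //; rewrite ?(ltW dt0) ?(ltW (eigenvalue_gt0 eP _)).
move=> k.
apply: (le_trans (coord_err_approx ipP FP QP QhP WP c0 cP eP EP dt0 JP WAP j k n)).
have C0 : 0 <= 4 * c * (n%:R * dt) by rewrite !mulr_ge0 ?(ltW dt0).
rewrite lee_fin -[leRHS]mulrA [q * _]mulrC [leRHS]mulrA ler_wpM2r// -[leRHS]mulrA ler_wpM2l//.
rewrite exprMn ler_wpM2l ?sqr_ge0// natrX -exprVn expr2.
by rewrite ler_piMr ?exprn_ge0 ?invr_ge0// exprn_ile1 ?invr_ge0// invf_le1// ler1n.
Qed.

(** A mean-square limit of Wiener sums whose variances are bounded by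
    [V * dt * q] is sub-Gaussian. *)
Lemma coord_err_Lp p n V : 0 < p -> 0 <= V ->
  (forall k, \sum_(i < n * 2 ^ k) err_kernel z (2 ^ k) n i ^+ 2 <= (2 ^ k)%:R * V) ->
  Lp_le P p (X n) (gauss_cst p * Num.sqrt (V * dt * q)).
Proof.
move=> p0 V0 hV; apply: subgaussian_Lp => //; first exact: measurable_coord_err.
  by rewrite !mulr_ge0// ltW.
have [D D0 hD] := approx n.
apply: (subgaussian_l2_cvg (X_ := fun k => Y k n) _ _ hD) => //.
  exact: measurable_coord_err.
by move=> k; exact: (subgaussian_grid_err ipP FP QP WP).
Qed.

Lemma coord_errB_Lp p l n V : 0 < p -> 0 <= V -> (l <= n)%N ->
  (forall k, \sum_(i < n * 2 ^ k) (err_kernel z (2 ^ k) n i - err_kernel z (2 ^ k) l i) ^+ 2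
     <= (2 ^ k)%:R * V) ->
  Lp_le P p (fun w => X n w - X l w) (gauss_cst p * Num.sqrt (V * dt * q)).
Proof.
move=> p0 V0 ln hV; have mB : measurable_fun setT (fun w => X n w - X l w).
  by apply: measurable_funB; exact: measurable_coord_err.
apply: subgaussian_Lp => //; first by rewrite !mulr_ge0// ltW.
have [D D0 hD] := approx n; have [D' D'0 hD'] := approx l.
apply: (@subgaussian_l2_cvg _ _ _ P _ (fun k w => Y k n w - Y k l w) (2 * D + 2 * D')) => //.
- by move=> k; apply: measurable_funB.
- move=> k.
  have msq m : measurable_fun setT (fun w => ((X m w - Y k m w) ^+ 2)%:E).
    by apply/measurable_EFinP; apply: measurable_funX; apply: measurable_funB => //;
      exact: measurable_coord_err.
  have sq0 m w : (0 <= ((X m w - Y k m w) ^+ 2)%:E)%E by rewrite lee_fin sqr_ge0.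
  apply: (@le_trans _ _ (\int[P]_w (2%:E * ((X n w - Y k n w) ^+ 2)%:E +
      2%:E * ((X l w - Y k l w) ^+ 2)%:E))%E).
    apply: le_lower_integral => w _; first by rewrite lee_fin sqr_ge0.
    rewrite -!EFinM -EFinD lee_fin.
    set x := X n w - Y k n w; set y := X l w - Y k l w.
    rewrite (_ : _ - _ = x - y); last by rewrite /x /y; ring.
    by have := sqr_ge0 (x + y); rewrite sqrrB sqrrD; lra.
  rewrite ge0_integralD//; last 4 first.
  - by move=> w _; rewrite mule_ge0.
  - exact: measurable_funeM.
  - by move=> w _; rewrite mule_ge0.
  - exact: measurable_funeM.
  rewrite !ge0_integralZl// mulrDl [leRHS]EFinD; apply: leeD.
    by rewrite -mulrA EFinM lee_wpmul2l.
  by rewrite -mulrA EFinM lee_wpmul2l.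
by move=> k; exact: (subgaussian_grid_errB ipP FP QP WP).
Qed.

End coordinate_bound.

(** * The maximal error in one mode *)

Section power_bounds.
Context {R : realType}.
Implicit Types x : R.

(** The factor 2 leaves room for [N.+1] times instead of [N]. *)
Lemma root_le x eps p : 1 <= x -> 0 < eps < 2^-1 -> eps^-1 < p ->
  (2 * x) `^ p^-1 <= 2 * x `^ eps.
Proof.
move=> x1 /andP[e0 e1] ep; have x0 : 0 < x by exact: lt_le_trans x1.
have p0 : 0 < p by apply: lt_trans ep; rewrite invr_gt0.
have pe : p^-1 <= eps by rewrite -[eps]invrK lef_pV2 ?posrE ?invr_gt0// ltW.
rewrite powRM ?(ltW x0)//; apply: ler_pM; rewrite ?powR_ge0//.
  rewrite -[leRHS]powRr1// ler_powR// ?ler1n//.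
  by rewrite (le_trans pe)// (le_trans (ltW e1))// invf_le1// ler1n.
exact: ler_powR.
Qed.

Lemma ler_powR_le1 x a b : 0 < x <= 1 -> a <= b -> x `^ b <= x `^ a.
Proof.
move=> /andP[x0 x1] ab; rewrite /powR gt_eqF// ler_expR ler_wnM2r//.
by rewrite ln_le0.
Qed.

Lemma exists_dyadic (z : R) (N : nat) : (0 < N)%N -> z <= 1 ->
  exists m, [/\ (2 ^ m <= N)%N, (2 ^ m)%:R * z <= 1 &
    (N < 2 ^ m.+1)%N \/ 1 < (2 ^ m.+1)%:R * z].
Proof.
move=> N0 z1.
pose Pr m := (2 ^ m <= N)%N && ((2 ^ m)%:R * z <= 1).
have ex : exists m, Pr m by exists 0%N; rewrite /Pr expn0 N0 mul1r.
have ub m : Pr m -> (m <= N)%N.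
  by move=> /andP[h _]; apply: leq_trans h; rewrite ltnW// ltn_expl.
case: (ex_maxnP ex ub) => m /andP[mN mz] mmax; exists m; split => //.
have : ~~ Pr m.+1 by apply/negP => /mmax; rewrite ltnn.
by rewrite negb_and -ltnNge -ltNge => /orP.
Qed.

End power_bounds.

Section mode_bound.
Context {R : realType} {H : lmodType R} (ip : H -> H -> R).
Hypothesis ipP : semi_inner ip.
Context {dO : measure_display} {Omega : measurableType dO}.
Variables (P : probability Omega R) (F : R -> set (set Omega)).
Hypothesis FP : normal_filtration P F.
Variables (Q Qh : H -> H) (W : R -> Omega -> H).
Hypotheses (QP : psd_op ip Q) (QhP : is_sqrt_op ip Q Qh) (WP : Q_wiener ip P F Q W).
Variables (A : H -> H -> Prop) (e : nat -> H) (lambda : nat -> R).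
Hypothesis eP : eigenbasis ip A e lambda.
Variable E : R -> H -> H.
Hypothesis EP : semigroup_of ip A E.
Variables (dt : R) (J : H -> H).
Hypotheses (dt0 : 0 < dt) (JP : euler_step ip A dt J).
Variable WA : R -> Omega -> H.
Hypothesis WAP : forall t : R, 0 <= t ->
  is_ito_integral ip P F e Qh W (fun (s : R) _ => E (t - s)) t (WA t).
Variable j : nat.

Local Notation z := (lambda j * dt).
Local Notation q := (ip (Q (e j)) (e j)).
Local Notation X := (coord_err ip W e dt J WA j).

Variables (eps p a : R) (N : nat).
Hypotheses (heps : 0 < eps < 2^-1) (hp : eps^-1 < p).
Hypotheses (ha : eps - 2^-1 <= a <= eps + 2^-1) (N0 : (0 < N)%N).

Local Notation G := (gauss_cst p).
Local Notation sigma := (Num.sqrt (dt * q)).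

Let z0 : 0 < z. Proof. by rewrite mulr_gt0// (eigenvalue_gt0 eP). Qed.
Let q0 : 0 <= q. Proof. by case: QP. Qed.
Let G0 : 0 <= G. Proof. exact: powR_ge0. Qed.
Let s0 : 0 <= sigma. Proof. exact: sqrtr_ge0. Qed.

Lemma exponent_gt2 : 2 < p.
Proof.
case/andP: heps => e0 e1; apply: lt_trans hp.
by rewrite -[ltLHS]invrK ltf_pV2 ?posrE// invr_gt0.
Qed.

Let p2 := exponent_gt2.
Let p0 : 0 < p. Proof. by apply: lt_trans p2. Qed.
Let p1 : 1 <= p. Proof. by apply: le_trans (ltW p2); rewrite ler1n. Qed.

Let sqrtV V : 0 <= V -> Num.sqrt (V * dt * q) = Num.sqrt V * sigma.
Proof. by move=> V0; rewrite -mulrA sqrtrM. Qed.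

Lemma coord_err_large n : Lp_le P p (X n) (G * (Num.sqrt (2 / z) * sigma)).
Proof.
rewrite -sqrtV ?divr_ge0 ?(ltW z0)//.
apply: (coord_err_Lp ipP FP QP QhP WP eP EP dt0 JP WAP) => //.
  by rewrite divr_ge0 ?(ltW z0).
by move=> k; apply: err_kernel_large => //; rewrite expn_gt0.
Qed.

Definition mode_cst : R :=
  G * (4 + 2 * (Num.sqrt 1248 + Num.sqrt 416 / (Num.sqrt 2 - 2 `^ p^-1))).

Let zN_ge0 : 0 <= N%:R `^ eps * z `^ a * sigma.
Proof. by rewrite !mulr_ge0 ?powR_ge0. Qed.

Let gap : 0 < Num.sqrt 2 - 2 `^ p^-1 :> R.
Proof.
rewrite subr_gt0 -[X in _ < X]powR12_sqrt// /powR pnatr_eq0 ltr_expR.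
by rewrite ltr_pM2r ?ltf_pV2 ?posrE// ln_gt0// ltr1n.
Qed.

Let chain_const_ge0 : 0 <= Num.sqrt 1248 + Num.sqrt 416 / (Num.sqrt 2 - 2 `^ p^-1) :> R.
Proof. by rewrite addr_ge0 ?divr_ge0 ?sqrtr_ge0 ?(ltW gap). Qed.

Let dominated_le n n' C C' : (n <= n')%N -> 0 <= C -> C <= C' ->
  dominated P p X n' C -> dominated P p X n C'.
Proof.
move=> nn' C0 CC' [S [mS S0 SX hS]]; exists S; split => //.
  by move=> i w ii; apply: SX; exact: leq_trans nn'.
exact: (Lp_le_mono p1 CC' C0 (fun w => lexx _) hS).
Qed.

Let mX n : measurable_fun setT (X n).
Proof. exact: (measurable_coord_err ipP FP WP eP dt0 JP WAP). Qed.

Lemma mode_cst_ge0 : 0 <= mode_cst.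
Proof. exact: (mulr_ge0 G0 (addr_ge0 (ler0n R 4) (mulr_ge0 (ler0n R 2) chain_const_ge0))). Qed.

(** All times have errors of size [z `^ (- 2^-1)], which [z `^ a] dominates,
    and the maximum over [N.+1] times costs a factor [N `^ eps]. *)
Lemma mode_bound_large : 1 <= z ->
  dominated P p X N.+1 (mode_cst * (N%:R `^ eps * z `^ a * sigma)).
Proof.
move=> z1; have N1 : 1 <= N%:R :> R by rewrite ler1n.
have C0 : 0 <= G * (Num.sqrt (2 / z) * sigma) by rewrite !mulr_ge0 ?sqrtr_ge0.
apply: dominated_le (leqnn _) _ _ (Lp_max p1 C0 mX (fun i _ => coord_err_large i)).
  by rewrite mulr_ge0 ?powR_ge0.
have h1 : N.+1%:R `^ p^-1 <= 2 * N%:R `^ eps.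
  apply: le_trans (root_le N1 heps hp); rewrite ge0_ler_powR ?nnegrE ?invr_ge0 ?(ltW p0) ?mulr_ge0//.
  by rewrite -natr1; lra.
have h2 : Num.sqrt (2 / z) <= 2 * z `^ a.
  rewrite sqrtrM//; apply: ler_pM; rewrite ?sqrtr_ge0//.
    by rewrite -[leRHS]ger0_norm// -sqrtr_sqr ler_wsqrtr// expr2 -natrM ler_nat.
  rewrite -powR12_sqrt ?invr_ge0 ?(ltW z0)// -powR_inv1 ?(ltW z0)// -powRrM mulN1r.
  by apply: ler_powR => //; case/andP: ha => h _; have := heps; lra.
apply: (@le_trans _ _ ((2 * N%:R `^ eps) * (G * (2 * z `^ a * sigma)))).
  by apply: ler_pM; rewrite ?powR_ge0// ler_wpM2l// ler_wpM2r.
rewrite (_ : _ * _ = (G * 4) * (N%:R `^ eps * z `^ a * sigma)); last by ring.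
by rewrite ler_wpM2r// ler_wpM2l// lerDl mulr_ge0.
Qed.

(** The mode relaxes within [1 / z] steps. Let [M] be the largest power of 2
    below [N] and [1 / z]. At every time the error has size [z * Num.sqrt M]
    at most, and over [n] steps it changes by [z * Num.sqrt n]. The maximum
    over the multiples of [M], about [N / M] in number, costs a factor
    [(N / M) `^ eps]; chaining fills in the times between them, and because of
    [p > 2] this only changes the constant. *)
Lemma mode_bound_small : z <= 1 ->
  dominated P p X N.+1 (mode_cst * (N%:R `^ eps * z `^ a * sigma)).
Proof.
move=> z1; have [m [mN mz mor]] := exists_dyadic N0 z1.
(* of the constants of the kernel estimates only the relations between B and
   its multiple matter *)
have [B [B0 BE]] : exists B : R, 0 <= B /\ B = 416.
  by exists 416; split; [exact: ler0n|reflexivity].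
have [B' [B'0 B'E B'3 B'128]] : exists B' : R, [/\ 0 <= B', B' = 1248, B' = 3 * B & 128 <= B'].
  by exists 1248; rewrite BE; split; [exact: ler0n|reflexivity|rewrite -natrM|rewrite ler_nat].
have hd i l k (il : (i <= l)%N) : \sum_(i0 < l * 2 ^ k)
    (err_kernel z (2 ^ k) l i0 - err_kernel z (2 ^ k) i i0) ^+ 2
    <= (2 ^ k)%:R * (B * z ^+ 2 * (l - i)%:R).
  by rewrite BE; apply: err_kernel_diff => //; rewrite expn_gt0.
pose M : R := (2 ^ m)%:R; pose K := (N %/ 2 ^ m).+1.
have M0 : 0 < M by rewrite ltr0n expn_gt0.
have NM : 1 <= N%:R / M by rewrite ler_pdivlMr// mul1r ler_nat.
have NK : (N.+1 <= K * 2 ^ m)%N by rewrite /K ltn_ceil// expn_gt0.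
have KN : K%:R <= 2 * (N%:R / M).
  have : (N %/ 2 ^ m)%:R <= N%:R / M :> R.
    by rewrite ler_pdivlMr// -natrM ler_nat leq_trunc_div.
  by rewrite /K -natr1; lra.
have KM : (K * 2 ^ m)%:R <= 3 * M \/ 1 < 2 * M * z.
  case: mor => [lt|gt]; [left|right]; last by rewrite /M -natrM -expnS.
  have -> : K = 2%N.
    rewrite /K; congr _.+1; apply/eqP; rewrite eqn_leq leq_divRL ?expn_gt0// mul1n mN andbT.
    by rewrite -ltnS ltn_divLR ?expn_gt0// mulnC -expnSr.
  by rewrite natrM ler_wpM2r ?(ltW M0)// ler_nat.
pose ca := G * (Num.sqrt B * z * sigma).
pose cb := G * (Num.sqrt B' * z * Num.sqrt M * sigma).
have ca0 : 0 <= ca by rewrite mulr_ge0// mulr_ge0// mulr_ge0 ?sqrtr_ge0 ?(ltW z0).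
have cb0 : 0 <= cb.
  by rewrite mulr_ge0// mulr_ge0// mulr_ge0 ?sqrtr_ge0// mulr_ge0 ?sqrtr_ge0 ?(ltW z0).
have sz : Num.sqrt (z ^+ 2) = z by rewrite sqrtr_sqr gtr0_norm.
have base n V : 0 <= V -> V <= B' * z ^+ 2 * M ->
    (forall k, \sum_(i < n * 2 ^ k) err_kernel z (2 ^ k) n i ^+ 2 <= (2 ^ k)%:R * V) ->
    Lp_le P p (X n) cb.
  move=> V0 VM hV.
  have := coord_err_Lp ipP FP QP QhP WP eP EP dt0 JP WAP p0 V0 hV; rewrite sqrtV//.
  apply: Lp_le_mono => //; last by rewrite mulr_ge0// mulr_ge0 ?sqrtr_ge0.
  rewrite ler_wpM2l// ler_wpM2r//.
  apply: (le_trans (ler_wsqrtr VM)).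
  by rewrite (sqrtrM M (mulr_ge0 B'0 (sqr_ge0 z))) (sqrtrM (z ^+ 2) B'0) sz.
have inc i l : (i <= l)%N -> Lp_le P p (fun w => X l w - X i w) (ca * Num.sqrt (l - i)%:R).
  move=> il; have V0 : 0 <= B * z ^+ 2 * (l - i)%:R.
    by apply: mulr_ge0 => //; exact: (mulr_ge0 B0 (sqr_ge0 z)).
  have := coord_errB_Lp ipP FP QP QhP WP eP EP dt0 JP WAP p0 V0 il
    (fun k => hd i l k il).
  rewrite sqrtV// (sqrtrM (l - i)%:R (mulr_ge0 B0 (sqr_ge0 z))) (sqrtrM (z ^+ 2) B0) sz.
  by rewrite (_ : G * _ = ca * Num.sqrt (l - i)%:R)// /ca; ring.
have hb n : (n < K * 2 ^ m)%N -> Lp_le P p (X n) cb.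
  move=> nK; case: KM => [KM|zM].
    apply: (base n (B * z ^+ 2 * n%:R)).
    - by apply: mulr_ge0 => //; exact: (mulr_ge0 B0 (sqr_ge0 z)).
    - have nM : n%:R <= 3 * M by apply: le_trans KM; rewrite ler_nat ltnW.
      rewrite B'3 (_ : 3 * B * _ * _ = B * z ^+ 2 * (3 * M)); last by ring.
      by rewrite ler_wpM2l//; exact: (mulr_ge0 B0 (sqr_ge0 z)).
    - move=> k; have := hd 0%N n k (leq0n n); rewrite subn0.
    apply: le_trans; apply: ler_sum => i _.
    by rewrite [err_kernel _ _ 0 _]/err_kernel mul0n ltn0 subr0.
  apply: (base n (64 * z)); first by rewrite mulr_ge0 ?(ltW z0).
    have : z * 1 <= z * (2 * M * z) by rewrite ler_wpM2l ?(ltW z0)// ltW.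
    have zz := mulr_gt0 z0 (mulr_gt0 M0 z0).
    have := ler_wpM2r (ltW zz) B'128.
    rewrite expr2; lra.
  by move=> k; apply: err_kernel_small => //; rewrite expn_gt0.
have D0 := chain_cst_ge0 p m.
apply: dominated_le NK _ _ (chaining p1 ca0 cb0 mX hb (fun i l il _ => inc i l il)).
  by rewrite mulr_ge0 ?powR_ge0// addr_ge0// mulr_ge0.
have sM : Num.sqrt 2 ^+ m = Num.sqrt M.
  rewrite /M natrX; elim: (m) => [|k IH]; first by rewrite !expr0 sqrtr1.
  by rewrite !exprS sqrtrM// IH.
have h1 : K%:R `^ p^-1 <= 2 * (N%:R / M) `^ eps.
  apply: le_trans (root_le NM heps hp); rewrite ge0_ler_powR ?nnegrE ?invr_ge0 ?(ltW p0)//.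
  by rewrite mulr_ge0// divr_ge0 ?(ltW M0).
have h2 : cb + ca * chain_cst p m <= G * (z * Num.sqrt M * sigma) *
    (Num.sqrt B' + Num.sqrt B / (Num.sqrt 2 - 2 `^ p^-1)).
  have := chain_cst_le p1 m p2; rewrite sM => /(ler_wpM2l ca0) h.
  apply: (le_trans (lerD (lexx cb) h)).
  rewrite /cb /ca; move: (Num.sqrt B) (Num.sqrt B') (Num.sqrt M) (Num.sqrt 2 - _)^-1.
  move: sigma G (z) => s G' y b b' r i.
  by rewrite (_ : _ + _ = G' * (y * r * s) * (b' + b * i))//; ring.
(* as M <= 1 / z, the left-hand side is at most N ^ eps * z ^ (1 / 2 + eps) *)
have h3 : (N%:R / M) `^ eps * (z * Num.sqrt M) <= N%:R `^ eps * z `^ a.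
  rewrite (powRM eps (ler0n R N) (_ : 0 <= M^-1)) ?invr_ge0 ?(ltW M0)//.
  rewrite -mulrA ler_wpM2l ?powR_ge0//.
  have -> : M^-1 `^ eps * (z * Num.sqrt M) = z * M `^ (2^-1 - eps).
    have MR : (2^-1 == eps) ==> (M != 0) by rewrite (gt_eqF M0) implybT.
    rewrite (powRB MR) (powR12_sqrt (ltW M0)) -(powR_inv1 (ltW M0)) -powRrM mulN1r powRN.
    by rewrite mulrC mulrA.
  apply: (@le_trans _ _ (z * (z^-1) `^ (2^-1 - eps))).
    rewrite ler_wpM2l ?(ltW z0)// ge0_ler_powR ?nnegrE ?invr_ge0 ?(ltW z0) ?(ltW M0)//.
      by case/andP: heps => _ /ltW; rewrite subr_ge0.
    by rewrite -[leRHS]mul1r ler_pdivlMr.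
  rewrite -(powR_inv1 (ltW z0)) -powRrM -[X in X * _](powRr1 (ltW z0)).
  have zR : (1 + (-1) * (2^-1 - eps) == 0) ==> (z != 0) by rewrite (gt_eqF z0) implybT.
  rewrite -(powRD zR); apply: ler_powR_le1; first by rewrite z0 z1.
  by case/andP: ha => _; lra.
apply: (le_trans (ler_pM (powR_ge0 _ _) (addr_ge0 cb0 (mulr_ge0 ca0 D0)) h1 h2)).
have L0 := chain_const_ge0; rewrite -BE -B'E in L0.
set L := Num.sqrt B' + _ in L0 *.
rewrite [leLHS](_ : _ = (G * (2 * L)) * (((N%:R / M) `^ eps * (z * Num.sqrt M)) * sigma)); last by ring.
apply: ler_pM => //.
- by apply: mulr_ge0 => //; apply: mulr_ge0.
- apply: mulr_ge0 => //; apply: mulr_ge0; first exact: powR_ge0.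
  by apply: mulr_ge0; [exact: ltW|exact: sqrtr_ge0].
- by rewrite /mode_cst -BE -B'E -/L ler_wpM2l// lerDr.
- by rewrite ler_wpM2r.
Qed.

Lemma mode_bound : dominated P p X N.+1 (mode_cst * (N%:R `^ eps * z `^ a * sigma)).
Proof.
by have [z1|/ltW z1] := leP 1 z; [exact: mode_bound_large|exact: mode_bound_small].
Qed.

End mode_bound.

(** * Summation over the modes *)

Section sum_of_modes.
Context {R : realType} {H : lmodType R} (ip : H -> H -> R).
Hypothesis ipP : semi_inner ip.
Variable e : nat -> H.
Hypothesis eB : orthonormal_basis ip e.
Local Notation hnorm := (hnorm ip).

Lemma bessel w n : \sum_(j < n) ip w (e j) ^+ 2 <= hnorm w ^+ 2.
Proof.
have nd : nondecreasing_seq (fun n => \sum_(j < n) ip w (e j) ^+ 2).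
  by apply/nondecreasing_seqP => m; rewrite big_ord_recr/= lerDl sqr_ge0.
have := @parseval_ip _ _ _ ipP _ eB w w.
under eq_fun do under eq_bigr do rewrite -expr2.
move=> c; have := nondecreasing_cvgn_le nd (cvgP _ c) n.
by rewrite (cvg_lim _ c)// (hnorm_sqr ipP).
Qed.

Lemma hnorm_le_coord w b : (forall n, \sum_(j < n) ip w (e j) ^+ 2 <= b) -> hnorm w ^+ 2 <= b.
Proof.
move=> h; have := @parseval_ip _ _ _ ipP _ eB w w.
under eq_fun do under eq_bigr do rewrite -expr2.
rewrite (hnorm_sqr ipP) => c; rewrite -(cvg_lim _ c)//.
by apply: limr_le; [exact: cvgP c|exact: nearW].
Qed.

Lemma frac_power_coord (lambda : nat -> R) a v w j :
  frac_power ip e lambda a v w -> ip w (e j) = lambda j `^ a * ip v (e j).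
Proof.
move=> vw; have h := @hcvg_ip _ _ _ ipP _ _ (e j) vw; refine (cvgR_unique h _).
apply/cvg_ballP => r r0; exists j.+1 => // n /= jn.
rewrite (ip_suml ipP) (bigD1 (Ordinal jn))//= big1 ?addr0.
  by rewrite (ipZl ipP) eB.1 eqxx mulr1; exact: ballxx.
move=> i ij; rewrite -(inj_eq val_inj)/= in ij.
by rewrite (ipZl ipP) eB.1 (negbTE ij) mulr0.
Qed.

(** The vectors [A^a Qh e_k] have coordinates [lambda j `^ a * <Qh e_k, e_j>].
    By Bessel's inequality the [k]-th term of the Hilbert-Schmidt norm is at
    least the sum of the squares of these over [j < n]; summing over [k] first
    gives [<Q e_j, e_j>]. *)
Lemma modes_le_hs_norm2 Q Qh (lambda : nat -> R) a n : is_sqrt_op ip Q Qh ->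
  ((\sum_(j < n) (lambda j `^ a) ^+ 2 * ip (Q (e j)) (e j))%:E <=
   hs_norm2 ip e (fun v => frac_power ip e lambda a (Qh v)))%E.
Proof.
move=> QhP; rewrite /hs_norm2.
set u := fun k => ereal_inf [set (hnorm w ^+ 2)%:E | w in frac_power ip e lambda a (Qh (e k))].
pose s k := \sum_(j < n) (lambda j `^ a) ^+ 2 * ip (Qh (e k)) (e j) ^+ 2.
have s0 k : 0 <= s k by apply: sumr_ge0 => j _; rewrite mulr_ge0 ?sqr_ge0.
have su k : ((s k)%:E <= u k)%E.
  apply: le_ereal_inf_tmp => _ [w hw <-]; rewrite lee_fin.
  apply: le_trans (bessel w n); apply: ler_sum => j _.
  by rewrite (frac_power_coord j hw) exprMn.
have u0 k : (0 <= u k)%E by apply: le_trans (su k); rewrite lee_fin.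
(* the infimum over the images of a basis vector outside the domain is +oo,
   which agrees with these bounds *)
have S_le K : ((\sum_(k < K) s k)%:E <= \sum_(0 <= k <oo) u k)%E.
  apply: (@le_trans _ _ (\sum_(0 <= k < K) u k)%E).
    by rewrite big_mkord -sumEFin; apply: lee_sum => k _; exact: su.
  exact: nneseries_lim_ge.
have : (0 <= \sum_(0 <= k <oo) u k)%E by exact: nneseries_ge0.
case: (\sum_(0 <= k <oo) u k)%E S_le => [h| |]//; last by move=> _ _; rewrite leey.
move=> S_le _; rewrite lee_fin.
have c : (fun K => \sum_(k < K) s k) @ \oo -->
    \sum_(j < n) (lambda j `^ a) ^+ 2 * ip (Q (e j)) (e j).
  under eq_fun do (rewrite /s exchange_big/=; under eq_bigr do rewrite -mulr_sumr).
  apply: cvg_big => [|j _]; first exact: add_continuous.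
  by apply: cvgMr; exact: (sqrt_op_parseval ipP eB QhP).
rewrite -(cvg_lim _ c)//; apply: limr_le; first exact: cvgP c.
by apply: nearW => K; rewrite -lee_fin.
Qed.

Context {dO : measure_display} {Omega : measurableType dO} (P : probability Omega R).

Lemma Lp_le_sqr (p : R) (S : Omega -> R) b : 0 <= b ->
  Lp_le P p S b -> Lp_le P (p / 2) (fun w => S w ^+ 2) (b ^+ 2).
Proof.
move=> b0; have sqr2 (x : R) : 0 <= x -> (x ^+ 2) `^ (p / 2) = x `^ p.
  by move=> x0; rewrite -powR_mulrn// -powRrM mulrC divfK.
rewrite /Lp_le (sqr2 b b0) => h; refine (le_trans _ h).
apply: le_lower_integral => w _; first by rewrite lee_fin powR_ge0.
by rewrite normrX sqr2.
Qed.

Lemma Lp_le_sum (r : R) n (Z : nat -> Omega -> R) (b : nat -> R) : 1 <= r ->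
  (forall j, measurable_fun setT (Z j)) -> (forall j, 0 <= b j) ->
  (forall j, Lp_le P r (Z j) (b j)) ->
  Lp_le P r (fun w => \sum_(j < n) Z j w) (\sum_(j < n) b j).
Proof.
move=> r1 mZ b0 hZ; elim: n => [|n IH].
  rewrite /Lp_le big_ord0 powR0 ?gt_eqF ?(lt_le_trans _ r1)//.
  rewrite integral0_eq// => w _.
  by rewrite big_ord0 normr0 powR0 ?gt_eqF ?(lt_le_trans _ r1).
rewrite big_ord_recr/=; under [X in Lp_le _ _ X]eq_fun do rewrite big_ord_recr/=.
by apply: Lp_leD => //; [exact: sumr_ge0|exact: measurable_sum].
Qed.

(** By Parseval the squared norms are sums over the modes, and the triangle
    inequality in [L^(p/2)] adds up the bounds for their squares. Monotone
    convergence passes to infinitely many modes. *)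
Lemma max_hnorm_le (p B : R) N (X : nat -> Omega -> H) (S : nat -> Omega -> R) (b : nat -> R) :
  2 < p -> 0 <= B ->
  (forall j, measurable_fun setT (S j)) -> (forall j w, 0 <= S j w) ->
  (forall j n w, (0 < n < N.+1)%N -> `|ip (X n w) (e j)| <= S j w) ->
  (forall j, 0 <= b j) -> (forall j, Lp_le P p (S j) (b j)) ->
  (forall n, \sum_(j < n) b j ^+ 2 <= B ^+ 2) ->
  (\int[P]_w ((\big[Num.max/0]_(1 <= n < N.+1) hnorm (X n w)) `^ p)%:E <= (B `^ p)%:E)%E.
Proof.
move=> p2 B0 mS S0 XS b0 hS hb.
have p0 : 0 < p by apply: lt_trans p2.
have r1 : 1 <= p / 2 by rewrite ler_pdivlMr// mul1r ltW.
have r0 : 0 <= p / 2 by rewrite divr_ge0// ltW.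
pose V n w := \sum_(j < n) S j w ^+ 2.
have V0 n w : 0 <= V n w by apply: sumr_ge0 => j _; exact: sqr_ge0.
pose g n w := ((V n w) `^ (p / 2))%:E.
have g0 n w : (0 <= g n w)%E by rewrite lee_fin powR_ge0.
have mV n : measurable_fun setT (V n).
  by apply: measurable_sum => j; exact: measurable_funX.
have mg n : measurable_fun setT (g n).
  by apply/measurable_EFinP; apply: (measurableT_comp (measurable_powR _)).
have ndg w : {homo g ^~ w : n m / (n <= m)%N >-> (n <= m)%E}.
  apply/nondecreasing_seqP => n; rewrite lee_fin ge0_ler_powR ?nnegrE//.
  by rewrite /V big_ord_recr/= lerDl sqr_ge0.
have gB n : (\int[P]_w g n w <= (B `^ p)%:E)%E.
  have := Lp_le_sum n r1 (fun j => measurable_funX 2 (mS j)) (fun j => sqr_ge0 (b j))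
    (fun j => Lp_le_sqr (b0 j) (hS j)).
  rewrite /Lp_le; under eq_integral do rewrite ger0_norm ?V0//.
  move/le_trans; apply; rewrite lee_fin.
  have -> : B `^ p = (B ^+ 2) `^ (p / 2).
    by rewrite -powR_mulrn// -powRrM mulrC divfK.
  by rewrite ge0_ler_powR ?nnegrE ?sqr_ge0// sumr_ge0// => j _; exact: sqr_ge0.
have gsup w : limn (g ^~ w) = ereal_sup (range (g ^~ w)).
  by apply/cvg_lim => //; apply: ereal_nondecreasing_cvgn; exact: ndg.
apply: (@le_trans _ _ (\int[P]_w (limn (g ^~ w)))%E); last first.
  rewrite monotone_convergence//; apply: lime_le; last exact: nearW.
  apply: ereal_nondecreasing_is_cvgn => n m nm.
  by apply: le_lower_integral => w _ //; exact: ndg.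
apply: le_lower_integral => w _; first by rewrite lee_fin powR_ge0.
have gle n : (g n w <= limn (g ^~ w))%E.
  by rewrite gsup; apply: ereal_sup_ubound; exists n.
case: (limn _) gle => [l| |]gle; last 2 first.
- by rewrite leey.
- by have := le_trans (g0 0%N w) (gle 0%N).
have l0 : 0 <= l by rewrite -lee_fin; exact: le_trans (g0 0%N w) (gle 0%N).
pose c := l `^ p^-1; have c0 : 0 <= c by exact: powR_ge0.
have cp : c `^ p = l by rewrite -powRrM mulVf ?gt_eqF// powRr1.
have c2 : c ^+ 2 = l `^ (p / 2)^-1.
  by rewrite -powR_mulrn// -powRrM invfM invrK.
rewrite lee_fin -cp ge0_ler_powR ?nnegrE ?(ltW p0)//; last first.
  rewrite big_nat_cond; apply: bigmax_le => // n; rewrite andbT => nN.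
  rewrite -(@ler_pXn2r _ 2) ?nnegrE ?hnorm_ge0//; apply: hnorm_le_coord => m.
  apply: (@le_trans _ _ (V m w)).
    apply: ler_sum => j _; rewrite -real_normK ?num_real//.
    by rewrite lerXn2r ?nnegrE//; exact: XS.
  rewrite c2 -[leLHS]powRr1// -[X in _ `^ X](divff (lt0r_neq0 (lt_le_trans ltr01 r1))) powRrM.
  by rewrite ge0_ler_powR ?nnegrE ?powR_ge0 ?invr_ge0// -lee_fin; exact: gle.
by elim/big_ind: _ => // [x y x0 y0|n _]; rewrite ?hnorm_ge0// le_max x0.
Qed.

End sum_of_modes.

Section assembly.
Context {R : realType}.

(** The powers of the step size: [a + 1/2 = beta / 2 + eps], and [N * dt]
    collects the part with exponent [eps]. *)
Lemma mode_weightE (N dt l q eps beta : R) : 0 <= N -> 0 < dt -> 0 < l -> 0 <= q ->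
  N `^ eps * (l * dt) `^ ((beta - 1) / 2 + eps) * Num.sqrt (dt * q) =
  (N * dt) `^ eps * dt `^ (beta / 2) * (l `^ ((beta - 1) / 2 + eps) * Num.sqrt q).
Proof.
move=> N0 dt0 l0 q0; set a := _ + eps.
rewrite (powRM a (ltW l0) (ltW dt0)) (powRM eps N0 (ltW dt0)) sqrtrM ?(ltW dt0)//.
rewrite -(powR12_sqrt (ltW dt0)).
have dtR (r s : R) : (r + s == 0) ==> (dt != 0) by rewrite (gt_eqF dt0) implybT.
have h : dt `^ a * dt `^ 2^-1 = dt `^ eps * dt `^ (beta / 2).
  rewrite -(powRD (dtR a 2^-1)) -(powRD (dtR eps (beta / 2))).
  by congr (dt `^ _); rewrite /a; field.
transitivity (N `^ eps * l `^ a * Num.sqrt q * (dt `^ a * dt `^ 2^-1)); first by ring.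
by rewrite h; ring.
Qed.

Context {H : lmodType R} (ip : H -> H -> R).
Hypothesis ipP : semi_inner ip.
Context {dO : measure_display} {Omega : measurableType dO}.
Variables (P : probability Omega R) (F : R -> set (set Omega)).
Hypothesis FP : normal_filtration P F.
Variables (Q Qh : H -> H) (W : R -> Omega -> H).
Hypotheses (QP : psd_op ip Q) (QhP : is_sqrt_op ip Q Qh) (WP : Q_wiener ip P F Q W).
Variables (A : H -> H -> Prop) (e : nat -> H) (lambda : nat -> R).
Hypothesis eP : eigenbasis ip A e lambda.
Variable E : R -> H -> H.
Hypothesis EP : semigroup_of ip A E.
Variables (dt : R) (J : H -> H).
Hypotheses (dt0 : 0 < dt) (JP : euler_step ip A dt J).
Variable WA : R -> Omega -> H.
Hypothesis WAP : forall t : R, 0 <= t ->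
  is_ito_integral ip P F e Qh W (fun (s : R) _ => E (t - s)) t (WA t).

Lemma strong_error (eps p beta : R) (N : nat) :
  0 < eps < 2^-1 -> eps^-1 < p -> 0 <= beta <= 2 ->
  ('E_P[fun w => ((\big[Num.max/0]_(1 <= n < N.+1)
       hnorm ip (WA (n%:R * dt) w - euler_convolution J W dt n w)) `^ p)%R] `^ p^-1
   <= ((mode_cst p * (N%:R * dt) `^ eps + 1) * dt `^ (beta / 2))%:E
      * hs_norm ip e (fun v => frac_power ip e lambda ((beta - 1) / 2 + eps) (Qh v)))%E.
Proof.
move=> heps hp hbeta; have p2 := exponent_gt2 heps hp.
have p0 : 0 < p by apply: lt_trans p2.
have eB : orthonormal_basis ip e by case: eP.
set a := _ / 2 + eps; set C := _ + 1; rewrite /hs_norm; set HS := hs_norm2 ip e _.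
pose mc : R := mode_cst p.
have mc0 : 0 <= mc by exact: (mode_cst_ge0 heps hp).
have T0 : 0 <= (N%:R * dt) `^ eps by exact: powR_ge0.
have C0 : 0 < C by exact: (ltr_wpDl (mulr_ge0 mc0 T0) ltr01).
have D0 : 0 < C * dt `^ (beta / 2) by rewrite mulr_gt0// powR_gt0.
set D := C * _ in D0 *.
have HS0 : (0 <= HS)%E.
  by have := modes_le_hs_norm2 ipP eB lambda a 0 QhP; rewrite big_ord0.
pose q j := ip (Q (e j)) (e j).
have q0 j : 0 <= q j by rewrite /q; case: QP.
pose b j := lambda j `^ a * Num.sqrt (q j).
have b0 j : 0 <= b j by rewrite mulr_ge0 ?powR_ge0 ?sqrtr_ge0.
have := fun n => modes_le_hs_norm2 ipP eB lambda a n QhP; rewrite -/HS => hb0.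
move: hb0; case: HS HS0 => [h| |]// h0 hb; last first.
  by rewrite poweRyr ?gt_eqF// gt0_muley ?leey// lte_fin.
rewrite lee_fin in h0.
have [S hS] : exists S : nat -> Omega -> R, forall j,
    [/\ measurable_fun setT (S j), forall w, 0 <= S j w,
      forall n w, (0 < n < N.+1)%N -> `|coord_err ip W e dt J WA j n w| <= S j w
      & Lp_le P p (S j) (D * b j)].
  suff hj j : exists S : Omega -> R,
    [/\ measurable_fun setT S, forall w, 0 <= S w,
      forall n w, (0 < n < N.+1)%N -> `|coord_err ip W e dt J WA j n w| <= S w
      & Lp_le P p S (D * b j)].
    by have [S hS] := choice hj; exists S.
  (* without any time step there is nothing to dominate *)
  case: (posnP N) => [N0|N0].
    exists (cst 0); split => //.
      by move=> n w; rewrite N0; case: n.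
    rewrite /Lp_le integral0_eq ?lee_fin ?powR_ge0// => w _.
    by rewrite normr0 powR0// gt_eqF.
  have ha : eps - 2^-1 <= a <= eps + 2^-1.
    by rewrite /a; case/andP: hbeta => h1 h2; apply/andP; split; lra.
  have [S [mS S0 SX Sp]] :=
    mode_bound ipP FP QP QhP WP eP EP dt0 JP WAP j heps hp ha N0.
  exists S; split => // [n w /andP[_ nN]|]; first exact: SX.
  move: Sp; rewrite /a (mode_weightE eps beta (ler0n R N) dt0 (eigenvalue_gt0 eP j) (q0 j)) -/a -/(b j) => Sp.
  apply: (Lp_le_mono (ltW (lt_trans (ltr1n R 2) p2)) _ _ (fun w => lexx _) Sp).
    rewrite mulrA ler_wpM2r// mulrA ler_wpM2r ?powR_ge0//.
    by rewrite /C lerDl.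
  by apply: (mulr_ge0 mc0); apply: mulr_ge0 => //; apply: mulr_ge0 => //; exact: powR_ge0.
pose B := D * Num.sqrt h; have B0 : 0 <= B by rewrite mulr_ge0 ?sqrtr_ge0// ltW.
have := @max_hnorm_le _ _ _ ipP _ eB _ _ P p B N
  (fun n w => WA (n%:R * dt) w - euler_convolution J W dt n w) S (fun j => D * b j) p2 B0.
move=> /(_ (fun j => let: And4 m _ _ _ := hS j in m)).
move=> /(_ (fun j => let: And4 _ m _ _ := hS j in m)).
move=> /(_ (fun j => let: And4 _ _ m _ := hS j in m)).
move=> /(_ (fun j => mulr_ge0 (ltW D0) (b0 j))).
move=> /(_ (fun j => let: And4 _ _ _ m := hS j in m)) hmax.
have {}hmax := hmax _.
rewrite unlock; apply: (@le_trans _ _ ((B `^ p)%:E `^ p^-1)%E).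
  apply: gt0_ler_poweR; rewrite ?in_itv/= ?leey ?lee_fin ?powR_ge0 ?invr_ge0 ?(ltW p0)//.
    by rewrite andbT; apply: integral_ge0 => w _; rewrite lee_fin powR_ge0.
  apply: hmax => n; rewrite /B exprMn sqr_sqrtr//.
  under eq_bigr do rewrite exprMn.
  rewrite -mulr_sumr ler_wpM2l ?sqr_ge0// -lee_fin; apply: le_trans (hb n).
  by rewrite lee_fin; apply: ler_sum => j _; rewrite /b exprMn sqr_sqrtr.
by rewrite !poweR_EFin -powRrM divff ?gt_eqF// powRr1// powR12_sqrt// -EFinM.
Qed.

End assembly.

Theorem proposition5p1 (R : realType) (d : nat) (hd : (0 < d <= 3)%N)
  (D : set 'rV[R]_d) (oD : open D) (cD : connected D) (D0 : D !=set0)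
  (bD : bounded_set D) (sD : smooth_boundary D)
  (kappa : 'rV[R]_d -> R) (kappa0 : R) (hkappa : smooth kappa)
  (kappa0_gt0 : 0 < kappa0) (kappa_gt : forall x, D x -> kappa0 < kappa x)
  (eps p T : R) (heps : 0 < eps < 2^-1) (hp : eps^-1 < p) :
  exists2 C : R, 0 < C &
  forall (e : nat -> L2 oD) (lambda : nat -> R)
    (he : eigenbasis (l2_ip oD) (elliptic_op oD kappa) e lambda)
    (E : R -> L2 oD -> L2 oD)
    (hE : semigroup_of (l2_ip oD) (elliptic_op oD kappa) E)
    (beta : R) (hbeta : 0 <= beta <= 2)
    (N : nat) (dt : R) (hdt : 0 < dt) (hT : T = N%:R * dt)
    (J : L2 oD -> L2 oD)
    (hJ : euler_step (l2_ip oD) (elliptic_op oD kappa) dt J)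
    (dO : measure_display) (Omega : measurableType dO) (P : probability Omega R)
    (F : R -> set (set Omega)) (hF : normal_filtration P F)
    (Q Qh : L2 oD -> L2 oD) (hQ : psd_op (l2_ip oD) Q)
    (hQh : is_sqrt_op (l2_ip oD) Q Qh)
    (W : R -> Omega -> L2 oD) (hW : Q_wiener (l2_ip oD) P F Q W)
    (WA : R -> Omega -> L2 oD)
    (hWA : forall t : R, 0 <= t -> is_ito_integral (l2_ip oD) P F e Qh W
             (fun (s : R) _ => E (t - s)) t (WA t)),
  ('E_P[fun w => ((\big[Num.max/0]_(1 <= n < N.+1)
                     hnorm (l2_ip oD) (WA (n%:R * dt) w
                                       - euler_convolution J W dt n w)) `^ p)%R]
     `^ p^-1
   <= (C * dt `^ (beta / 2))%:E
      * hs_norm (l2_ip oD) e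
          (fun v => frac_power (l2_ip oD) e lambda
                      ((beta - 1) / 2 + eps) (Qh v)))%E.
Proof.
exists (mode_cst p * T `^ eps + 1).
  exact: (ltr_wpDl (mulr_ge0 (mode_cst_ge0 heps hp) (powR_ge0 T eps)) ltr01).
move=> e lambda he E hE beta hbeta N dt hdt hT J hJ dO Omega P F hF Q Qh hQ hQh W hW WA hWA.
rewrite hT; exact: (strong_error (l2_semi_inner oD) hF hQ hQh hW he hE hdt hJ hWA N heps hp hbeta).
Qed.
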